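(* Let $0<p<\infty$, $\alpha>-1$, $a\in\mathbb{D}$ and let $N$ be a positive integer. If $f\in A^p_\alpha$ satisfies $f(a)=f'(a)=\dots=f^{(N-1)}(a)=0$, then $f/\varphi_a^N$ (extended analytically to $z=a$) belongs to $A^p_\alpha$ and $$\left\|\frac{f}{\varphi_a^N}\right\|_{p,\alpha}\le\left(\frac{\Gamma\left(\frac{Np}{2}+2+\alpha\right)}{\Gamma(2+\alpha)\,\Gamma\left(\frac{Np}{2}+1\right)}\right)^{1/p}\|f\|_{p,\alpha},$$ and the inequality is sharp (equality is attained by a nonzero function in $A^p_\alpha$ with such a zero at $a$). In particular, for the unweighted Bergman space $A^p=A^p_0$ and $N=1$: if $f\in A^p$ and $f(a)=0$, then $$\left\|\frac{f}{\varphi_a}\right\|_{p}\le\left(\frac{p+2}{2}\right)^{1/p}\|f\|_p.$$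
   Context: $\mathbb{D}$ is the unit disk and $dA(z)=\pi^{-1}\,dx\,dy$ the normalized area measure on $\mathbb{D}$. For $\alpha>-1$ and $0<p<\infty$, $A^p_\alpha$ is the space of analytic functions $f$ on $\mathbb{D}$ with $$\|f\|_{p,\alpha}=\left(\int_{\mathbb{D}}|f(z)|^p(\alpha+1)(1-|z|^2)^\alpha\,dA(z)\right)^{1/p}<\infty$$ (for $0<p<1$ this is not a norm but the same notation is used); $\|\cdot\|_p$ denotes $\|\cdot\|_{p,0}$. For $a\in\mathbb{D}$, $\varphi_a(z)=\frac{a-z}{1-\overline{a}z}$. $\Gamma$ is the Euler Gamma function. *)

(* Defs.v *)
(* MathComp-Analysis over an abstract R : realType,
   complex numbers are R[i] (mathcomp-real-closed), viewed as a normed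
   module over itself via (R[i])^o so that derivable/derive1 are the
   complex derivative. *)
From HB Require Import structures.
From mathcomp Require Import all_boot all_order all_algebra.
From mathcomp Require Import all_classical all_reals all_analysis.
From mathcomp Require Import complex.
Import Order.TTheory GRing.Theory Num.Theory.
Import numFieldNormedType.Exports.

Set Implicit Arguments.
Unset Strict Implicit.
Unset Printing Implicit Defensive.

Local Open Scope ring_scope.
Local Open Scope classical_set_scope.

Section Bergman.
Variable R : realType.

Definition CC : Type := (R[i])^o.

Definition cabs (z : CC) : R := Normc.normc (z : R[i]).

Definition disk : set CC := [set z | cabs z < 1].

Definition holo_disk (f : CC -> CC) : Prop :=
  forall z : CC, z \in disk -> derivable f z 1.

Definition cderiv (k : nat) (f : CC -> CC) : CC -> CC := derive1n k f.

Definition cpt (xy : R * R) : CC := Complex xy.1 xy.2.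

(** integral over D of |f|^p (alpha+1)(1-|z|^2)^alpha dA(z),
    dA = (1/pi) dx dy the normalized area measure *)
Definition bergman_int (p alpha : R) (f : CC -> CC) : \bar R :=
  let F := fun xy : R * R =>
    (cabs (f (cpt xy))) `^ p * ((alpha + 1) * (1 - cabs (cpt xy) ^+ 2) `^ alpha)
      / pi in
  (\int[(@lebesgue_measure R) \x (@lebesgue_measure R)]_(xy in cpt @^-1` disk)
     (F xy)%:E)%E.

Definition in_Apa (p alpha : R) (f : CC -> CC) : Prop :=
  holo_disk f /\ (bergman_int p alpha f < +oo)%E.

(** ||f||_{p,alpha} (meaningful for f in A^p_alpha) *)
Definition bergman_norm (p alpha : R) (f : CC -> CC) : R :=
  (fine (bergman_int p alpha f)) `^ (p^-1).

Definition phi (a z : CC) : CC := (a - z) / (1 - conjc (a : R[i]) * z).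

Definition Gamma (x : R) : R :=
  let F := fun t : R => t `^ (x - 1) * expR (- t) in
  fine (\int[@lebesgue_measure R]_(t in [set t : R | (0 < t)%R]) (F t)%:E)%E.

Definition is_div_ext (a : CC) (N : nat) (f g : CC -> CC) : Prop :=
  holo_disk g /\ forall z : CC, z \in disk -> z != a -> g z = f z / phi a z ^+ N.

End Bergman.
Arguments disk {R}.

(* Main.v *)
(* With h holomorphic and zero-free such that |h|^p = |phi_a'|^(alpha+2), the change of
   variables z |-> phi_a z maps g to G = (g o phi_a) h isometrically in A^p_alpha and maps
   phi_a^N g to z^N G, up to a unimodular factor; this reduces the inequality to a = 0.
   There, in polar coordinates, both sides are integrals over 0 < r < 1 of the mean M(r) of
   |G|^p on the circle of radius r, against w(r) = (1-r^2)^alpha r and r^(Np) w(r).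
   M is nondecreasing because |G|^p is subharmonic, so Chebyshev's integral inequality
   bounds the quotient of the two integrals by that of the weights, a quotient of Beta
   values. Equality holds when M is constant, i.e. for g = h.

   M is compared on two circles through the maximum principle for a discrete rotational
   average; subharmonicity enters only as the mean inequality over the four points
   z + i^k h with an error O(h^3). *)
Require Import Defs.
From HB Require Import structures.
From mathcomp Require Import all_boot all_order all_algebra.
From mathcomp Require Import all_classical all_reals all_analysis.
From mathcomp Require Import measurable_realfun.
From mathcomp Require Import complex.
From mathcomp Require Import ring lra.
Import Order.TTheory GRing.Theory Num.Theory.
Import numFieldNormedType.Exports.
Set Implicit Arguments.
Unset Strict Implicit.
Unset Printing Implicit Defensive.
Local Open Scope ring_scope.
Local Open Scope classical_set_scope.

(** * Complex integrals and the Cauchy formula *)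

(** Holomorphy is given as complex differentiability alone, whereas the proof needs that a zero of
    order N divides out holomorphically, that derivatives are holomorphic again, and a second order
    expansion with bounded remainder. All three come from the Cauchy formula, hence Goursat's
    argument below.

    That g lies in the space is part of the conclusion, so the main inequality c * mass g <= mass f
    is proved between nonnegative extended integrals; finiteness of the left side is read off from
    it.

    The map phi_a is a composition of affine maps and z -> 1/z, and each of these reduces by Tonelli
    to substitutions on lines. Polar coordinates are built in the same way from the slope y / x =
    tan t with |t| < pi / 2, which is why a circle appears as a half circle and its opposite.

    With b = N p / 2, the substitution t = r^2 / (1 - r^2) turns the integral of r^(2b) (1 -
    r^2)^alpha r into half of B(alpha + 1, b + 1). Its quotient by the value at b = 0 is c, and the
    constant of the theorem is c^(-1/p). *)

Section ComplexTopology.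
Variable R : realType.
Implicit Types (z w c : CC R) (f g : CC R -> CC R).

Lemma normCC z : `|z| = (cabs z)%:C%C.
Proof. by []. Qed.

Lemma cabs_ge0 z : 0 <= cabs z.
Proof. by rewrite -lecR -normCC normr_ge0. Qed.

Lemma cabsD z w : cabs (z + w) <= cabs z + cabs w.
Proof. exact: le_normcD. Qed.

Lemma cabsM z w : cabs (z * w) = cabs z * cabs w.
Proof. exact: Normc.normcM. Qed.

Lemma cabsN z : cabs (- z) = cabs z.
Proof. exact: normcN. Qed.

Lemma cabsV z : cabs z^-1 = (cabs z)^-1.
Proof. exact: Normc.normcV. Qed.

Lemma cabs0 : cabs (0 : CC R) = 0.
Proof. exact: Normc.normc0. Qed.

Lemma cabs1 : cabs (1 : CC R) = 1.
Proof. exact: Normc.normc1. Qed.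

Lemma cabsX z n : cabs (z ^+ n) = cabs z ^+ n.
Proof. by elim: n => [|n ih]; rewrite ?expr0 ?cabs1// !exprS cabsM ih. Qed.

Lemma cabs_div z w : cabs (z / w) = cabs z / cabs w.
Proof. by rewrite cabsM cabsV. Qed.

Lemma cabsB z w : cabs (z - w) <= cabs z + cabs w.
Proof. by rewrite -(cabsN w) cabsD. Qed.

Lemma cabs_distC z w : cabs (z - w) = cabs (w - z).
Proof. by rewrite -cabsN opprB. Qed.

Lemma cabs_eq0 z : (cabs z == 0) = (z == 0).
Proof.
by apply/eqP/eqP => [/Normc.eq0_normc//|->]; rewrite cabs0.
Qed.

Lemma cabs_gt0 z : (0 < cabs z) = (z != 0).
Proof. by rewrite lt_neqAle cabs_ge0 andbT eq_sym cabs_eq0. Qed.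

Lemma cabs_sub_ge z w : cabs z - cabs w <= cabs (z - w).
Proof. by have := cabsD (z - w) w; rewrite subrK; lra. Qed.

Lemma cabs_sqr z : cabs z ^+ 2 = complex.Re z ^+ 2 + complex.Im z ^+ 2.
Proof. by case: z => x y; rewrite /cabs /= sqr_sqrtr// addr_ge0// sqr_ge0. Qed.

Lemma cabs_real (x : R) : cabs (x%:C%C) = `|x|.
Proof. by rewrite /cabs /= expr0n /= addr0 sqrtr_sqr. Qed.

Lemma cabs_conj z : cabs (conjc (z : R[i])) = cabs z.
Proof. by case: z => x y; rewrite /cabs /= sqrrN. Qed.

Lemma Re_le_cabs z : `|complex.Re z| <= cabs z.
Proof. by rewrite -lecR; exact: normc_ge_Re. Qed.

Lemma Im_le_cabs z : `|complex.Im z| <= cabs z.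
Proof.
by rewrite -(ler_pXn2r (ltn0Sn 1)) ?nnegrE ?cabs_ge0// cabs_sqr real_normK ?num_real// lerDr sqr_ge0.
Qed.

Lemma cabs_le_ReIm z : cabs z <= `|complex.Re z| + `|complex.Im z|.
Proof.
rewrite -(ler_pXn2r (ltn0Sn 1)) ?nnegrE ?cabs_ge0 ?addr_ge0// cabs_sqr sqrrD.
rewrite !real_normK ?num_real// -addrA -subr_ge0.
have := mulr_ge0 (normr_ge0 (complex.Re z)) (normr_ge0 (complex.Im z)); lra.
Qed.

Lemma mulcJ_cabs z : z * conjc (z : R[i]) = ((cabs z) ^+ 2)%:C%C :> CC R.
Proof.
rewrite cabs_sqr; case: z => x y /=; apply/eqP; rewrite eq_complex /=.
by apply/andP; split; apply/eqP; ring.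
Qed.

(** The radii of balls in [CC R] are themselves complex numbers. Positivity forces their imaginary
    part to vanish, so all later estimates can use real radii. *)
Lemma nbhs_CC z (P : set (CC R)) : nbhs z P <->
  exists2 d : R, 0 < d & forall w, cabs (w - z) < d -> P w.
Proof.
split.
  move=> zP; have [[d d'] /= d0 H] := (nbhs_ballP z P).1 zP.
  move: (d0); rewrite ltcE /= => /andP[/eqP d'0 dpos].
  exists d => // w wz; apply: H; rewrite /ball /= normCC cabs_distC.
  by rewrite ltcE /= -d'0 eqxx.
move=> [d d0 H]; apply/nbhs_ballP; exists (d%:C)%C => /=; first by rewrite ltcR.
by move=> w; rewrite /ball /= normCC ltcR cabs_distC => /H.
Qed.

Lemma disk_nbhs z r : cabs z < r -> \forall w \near z, cabs w < r.
Proof.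
move=> zr; apply/nbhs_CC; exists (r - cabs z); first by rewrite subr_gt0.
by move=> w; have := cabs_sub_ge w z; lra.
Qed.

Lemma in_diskE z : (z \in (@disk R)) = (cabs z < 1).
Proof. by apply/idP/idP => [/set_mem//|h]; apply/mem_set. Qed.

Lemma cvgCC_dist (T : Type) (F : set_system T) {FF : Filter F} (f : T -> CC R) c :
  f x @[x --> F] --> c <->
  forall e : R, 0 < e -> \forall x \near F, cabs (f x - c) < e.
Proof.
split.
  move=> fc e e0; apply: (fc [set w | cabs (w - c) < e]).
  by apply/nbhs_CC; exists e.
move=> H A /nbhs_CC[d d0 dA]; have := H _ d0; apply: filterS => x /= ?.
exact: dA.
Qed.

Lemma cabs_continuous : continuous (@cabs R).
Proof.
move=> z; apply/(@cvgrPdist_lt _ _ _ (nbhs z)) => e e0; apply/nbhs_CC; exists e => // w wz.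
rewrite ltr_norml; have := cabs_sub_ge w z; have := cabs_sub_ge z w.
by rewrite (cabs_distC z w); move: wz; lra.
Qed.

Lemma Re_continuous : continuous (fun z => complex.Re z).
Proof.
move=> z; apply/(@cvgrPdist_lt _ _ _ (nbhs z)) => e e0; apply/nbhs_CC; exists e => // w wz.
rewrite distrC; apply: le_lt_trans wz; case: z w => a b [c d].
exact: (Re_le_cabs (Complex (c - a) (d - b))).
Qed.

Lemma Im_continuous : continuous (fun z => complex.Im z).
Proof.
move=> z; apply/(@cvgrPdist_lt _ _ _ (nbhs z)) => e e0; apply/nbhs_CC; exists e => // w wz.
rewrite distrC; apply: le_lt_trans wz; case: z w => a b [c d].
exact: (Im_le_cabs (Complex (c - a) (d - b))).
Qed.

Lemma cvg_Complex (T : Type) (F : set_system T) {FF : Filter F} (u v : T -> R) a b :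
  u x @[x --> F] --> a -> v x @[x --> F] --> b ->
  (Complex (u x) (v x) : CC R) @[x --> F] --> (Complex a b : CC R).
Proof.
move=> /cvgrPdist_lt ua /cvgrPdist_lt vb; apply/cvgCC_dist => e e0.
have e20 : 0 < e / 2 by rewrite divr_gt0.
near=> x; apply: le_lt_trans (cabs_le_ReIm _) _ => /=.
have h1 : `|a - u x| < e / 2 by near: x; exact: ua.
have h2 : `|b - v x| < e / 2 by near: x; exact: vb.
by move: h1 h2; rewrite distrC (distrC b); lra.
Unshelve. all: by end_near. Qed.

Lemma continuous_CCP f z : {for z, continuous f} <->
  forall e : R, 0 < e -> exists2 d : R, 0 < d &
    forall w, cabs (w - z) < d -> cabs (f w - f z) < e.
Proof.
split=> [fz e e0|H].
  exact: (nbhs_CC z _).1 ((@cvgCC_dist _ (nbhs z) _ f (f z)).1 fz e e0).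
apply/(@cvgCC_dist _ (nbhs z) _ f (f z)) => e e0; apply/nbhs_CC.
by have [d d0 h] := H e e0; exists d.
Qed.

(** The quotient-free form allows h = 0 and can be integrated directly; it serves both Goursat's
    estimate and differentiation under the integral sign. *)
Lemma is_deriveCP f z d : is_derive z 1 f d <->
  forall e : R, 0 < e -> exists2 del : R, 0 < del &
   forall h : CC R, cabs h < del -> cabs (f (z + h) - f z - d * h) <= e * cabs h.
Proof.
set D := fun h : CC R => h^-1 *: ((f \o shift z) (h *: (1 : CC R)) - f z).
have DE h : h != 0 -> D h - d = (f (z + h) - f z - d * h) / h.
  move=> h0; rewrite /D /= /GRing.scale /= mulr1 (addrC h z) mulrBl mulrC.
  by rewrite mulfK.
split.
  move=> [df vf].
  have Dc : D h @[h --> 0^'] --> d by rewrite -vf; exact: df.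
  move=> e e0; move/cvgCC_dist : Dc => /(_ e e0)/nbhs_CC[del del0 H].
  exists del => // h hd; have [->|h0] := eqVneq h 0.
    by rewrite addr0 mulr0 !subrr cabs0 mulr0.
  have := H h; rewrite subr0 => /(_ hd h0).
  by rewrite -/(D h) DE// cabs_div ltr_pdivrMr ?cabs_gt0// => /ltW.
move=> H.
have Dc : D h @[h --> 0^'] --> d.
  apply/cvgCC_dist => e e0.
  have e20 : 0 < e / 2 by rewrite divr_gt0.
  have [del del0 {}H] := H _ e20.
  apply/nbhs_CC; exists del => // h; rewrite subr0 => hd h0.
  rewrite -/(D h) DE// cabs_div ltr_pdivrMr ?cabs_gt0//.
  apply: le_lt_trans (H h hd) _; rewrite ltr_pM2r ?cabs_gt0//.
  by rewrite ltr_pdivrMr// ltr_pMr// ltr1n.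
split; first by apply/cvg_ex; exists d.
by apply/cvg_lim => //; exact: norm_hausdorff.
Qed.

End ComplexTopology.

Section ComplexIntegral.
Variable R : realType.
Local Notation mu := (@lebesgue_measure R).
Implicit Types (a b c d x : R) (F G : R -> CC R) (u v : R -> R).

(** Two-sided continuity at each point, endpoints included, so that it composes pointwise without
    passing to the subspace topology of the segment. *)
Definition cont_on (T : topologicalType) a b (F : R -> T) :=
  forall x, a <= x <= b -> {for x, continuous F}.

Lemma cont_onB F G a b : cont_on a b F -> cont_on a b G ->
  cont_on a b (fun x => F x - G x).
Proof. by move=> FF GG x ab; apply: cvgB; [exact: FF|exact: GG]. Qed.

Lemma cont_onM F G a b : cont_on a b F -> cont_on a b G ->
  cont_on a b (fun x => F x * G x).
Proof. by move=> FF GG x ab; apply: cvgM; [exact: FF|exact: GG]. Qed.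

Lemma cont_onV F a b : (forall x, a <= x <= b -> F x != 0) -> cont_on a b F ->
  cont_on a b (fun x => (F x)^-1).
Proof. by move=> F0 FF x ab; apply: cvgV; [exact: F0|exact: FF]. Qed.

Lemma cont_on_cst (T : topologicalType) (k : T) a b : cont_on a b (fun=> k).
Proof. by move=> x _; exact: cvg_cst. Qed.

Lemma cont_onT (T : topologicalType) (F : R -> T) a b : continuous F -> cont_on a b F.
Proof. by move=> cF x _; exact: cF. Qed.

Lemma cont_on_integrable u a b : cont_on a b u ->
  mu.-integrable `[a, b] (EFin \o u).
Proof.
move=> cu; apply: continuous_compact_integrable; first exact: segment_compact.
apply: continuous_in_subspaceT => x /set_mem /=; rewrite in_itv /= => xab.
exact: cu.
Qed.

Lemma cont_on_Re F a b : cont_on a b F -> cont_on a b (fun x => complex.Re (F x)).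
Proof. by move=> cF x ab; exact: (continuous_comp (cF x ab) (@Re_continuous _ _)). Qed.

Lemma cont_on_Im F a b : cont_on a b F -> cont_on a b (fun x => complex.Im (F x)).
Proof. by move=> cF x ab; exact: (continuous_comp (cF x ab) (@Im_continuous _ _)). Qed.

Definition Cint a b F : CC R :=
  Complex (\int[mu]_(x in `[a, b]) complex.Re (F x))
          (\int[mu]_(x in `[a, b]) complex.Im (F x)).

Lemma eq_Cint F G a b : (forall x, a <= x <= b -> F x = G x) -> Cint a b F = Cint a b G.
Proof.
by move=> FG; rewrite /Cint; congr Complex; apply: eq_Rintegral => x /set_mem /=;
  rewrite in_itv /= => /FG ->.
Qed.

Lemma CintD F G a b : cont_on a b F -> cont_on a b G ->
  Cint a b (fun x => F x + G x) = Cint a b F + Cint a b G.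
Proof.
move=> cF cG; rewrite /Cint [RHS]/GRing.add /=; congr Complex.
- rewrite -RintegralD//; try exact: (cont_on_integrable (cont_on_Re _)).
  by apply: eq_Rintegral => x _; case: (F x) (G x) => ? ? [].
- rewrite -RintegralD//; try exact: (cont_on_integrable (cont_on_Im _)).
  by apply: eq_Rintegral => x _; case: (F x) (G x) => ? ? [].
Qed.

Lemma CintZ (k : CC R) F a b : cont_on a b F ->
  Cint a b (fun x => k * F x) = k * Cint a b F.
Proof.
move=> cF; have iR := cont_on_integrable (cont_on_Re cF).
have iI := cont_on_integrable (cont_on_Im cF).
case: k => p q; rewrite /Cint [RHS]/GRing.mul /=.
rewrite -!RintegralZl//.
have iZ u t : mu.-integrable `[a, b] (EFin \o u) ->
    mu.-integrable `[a, b] (EFin \o (fun x => t * u x)).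
  by move=> iu; have := @integrableZl _ _ _ mu `[a, b]%classic (measurable_itv _) t (EFin \o u) iu.
congr Complex.
- rewrite -RintegralB//; try exact: iZ.
  by apply: eq_Rintegral => x _; case: (F x).
- rewrite -RintegralD//; try exact: iZ.
  by apply: eq_Rintegral => x _; case: (F x).
Qed.

Lemma CintN F a b : cont_on a b F -> Cint a b (fun x => - F x) = - Cint a b F.
Proof.
move=> cF; rewrite -mulN1r -CintZ//.
by apply: eq_Cint => x _; rewrite mulN1r.
Qed.

Lemma CintB F G a b : cont_on a b F -> cont_on a b G ->
  Cint a b (fun x => F x - G x) = Cint a b F - Cint a b G.
Proof.
move=> cF cG; rewrite -(CintN cG); apply: (CintD cF).
by move=> x ab; apply: cvgN; exact: cG.
Qed.

Lemma cont_on_Rint_split u a b c : a <= c <= b -> cont_on a b u ->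
  \int[mu]_(x in `[a, b]) u x = \int[mu]_(x in `[a, c]) u x + \int[mu]_(x in `[c, b]) u x.
Proof.
move=> /andP[ac cb] cu; have iu := cont_on_integrable cu.
have := Rintegral_itvB iu; move=> /(_ c); rewrite !bnd_simp => /(_ ac cb) h.
rewrite -(Rintegral_itv_obnd_cbnd (r := c)).
  by rewrite -h addrC subrK.
apply: integrableS iu => //; apply: subset_itv => //.
Qed.

Lemma Cint_split F a b c : a <= c <= b -> cont_on a b F ->
  Cint a b F = Cint a c F + Cint c b F.
Proof.
move=> abc cF; rewrite /Cint [RHS]/GRing.add /=.
by rewrite !(@cont_on_Rint_split _ a b c)//; [exact: cont_on_Im|exact: cont_on_Re].
Qed.

Lemma Rint_cst a b k : a <= b -> \int[mu]_(x in `[a, b]) k = k * (b - a).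
Proof.
move=> ab; rewrite Rintegral_cst//= lebesgue_measure_itv /= lte_fin.
by case: ltP => [//|ba]; rewrite (@le_anti _ _ a b) ?ab// subrr.
Qed.

Lemma Cint_cst (k : CC R) a b : a <= b -> Cint a b (fun=> k) = k * ((b - a)%:C)%C.
Proof.
move=> ab; rewrite /Cint !Rint_cst//; case: k => p q /=.
by apply/eqP; rewrite eq_complex /= !mulr0 subr0 add0r !eqxx.
Qed.

Lemma cont_on_Rint_le u k a b : a <= b -> cont_on a b u ->
  (forall x, a <= x <= b -> `|u x| <= k) ->
  `|\int[mu]_(x in `[a, b]) u x| <= k * (b - a).
Proof.
move=> ab cu uk; have iu := cont_on_integrable cu.
apply: le_trans (le_normr_Rintegral _ iu) _ => //.
rewrite -Rint_cst//; apply: le_Rintegral => //.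
- exact: (integrable_abse iu).
- by apply: cont_on_integrable; exact: cont_on_cst.
Qed.

(** The factor 2 is the price of bounding real and imaginary parts separately; the uses only require
    some constant. *)
Lemma cabs_Cint_le F k a b : a <= b -> cont_on a b F ->
  (forall x, a <= x <= b -> cabs (F x) <= k) ->
  cabs (Cint a b F) <= 2 * k * (b - a).
Proof.
move=> ab cF Fk; apply: le_trans (cabs_le_ReIm _) _ => /=.
rewrite -mulrA mulr_natl mulr2n lerD//; apply: cont_on_Rint_le => //.
- exact: cont_on_Re.
- by move=> x /Fk; apply: le_trans; exact: Re_le_cabs.
- exact: cont_on_Im.
- by move=> x /Fk; apply: le_trans; exact: Im_le_cabs.
Qed.

Lemma Rint_FTC u v a b : a <= b -> continuous v ->
  (forall x, is_derive x 1 u (v x)) ->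
  \int[mu]_(x in `[a, b]) v x = u b - u a.
Proof.
rewrite le_eqVlt => /predU1P[->|ab] cv du; first by rewrite set_itv1 Rintegral_set1 subrr.
have cu : continuous u.
  by move=> x; apply/differentiable_continuous/derivable1_diffP; exact: ex_derive.
rewrite /Rintegral (@continuous_FTC2 _ v u a b)//.
- exact: continuous_subspaceT.
- split; first by move=> x _; exact: ex_derive.
  + exact/cvg_at_right_filter/cu.
  + exact/cvg_at_left_filter/cu.
- by move=> x _; rewrite derive1E; exact: derive_val.
Qed.

Definition cis (t : R) : CC R := Complex (cos t) (sin t).

Lemma cis_continuous : continuous cis.
Proof. by move=> t; apply: cvg_Complex; [exact: continuous_cos|exact: continuous_sin]. Qed.

Lemma cabs_cis t : cabs (cis t) = 1.
Proof. by rewrite /cabs /= cos2Dsin2 sqrtr1. Qed.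

Lemma cisD s t : cis (s + t) = cis s * cis t.
Proof. by rewrite /cis sinD cosD [RHS]/GRing.mul /=; congr Complex; rewrite (mulrC (sin s)) addrC. Qed.

Lemma cisDpi t : cis (t + pi) = - cis t.
Proof. by rewrite /cis sinDpi cosDpi. Qed.

Lemma cis2pi : cis (2 * pi) = cis 0.
Proof. by rewrite mulr_natl /cis cos2pi sin2pi cos0 sin0. Qed.

Lemma Cint_cis a b : a <= b -> Cint a b (fun t => 'i%C * cis t) = cis b - cis a.
Proof.
move=> ab; rewrite /Cint [RHS]/GRing.add /=; congr Complex.
- rewrite -(@Rint_FTC cos (fun t => - sin t))//.
  + by apply: eq_Rintegral => x _; rewrite mul0r mul1r sub0r.
  + by move=> x; apply: cvgN; exact: continuous_sin.
- rewrite -(@Rint_FTC sin cos)//; last exact: continuous_cos.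
  by apply: eq_Rintegral => x _; rewrite mul0r mul1r add0r.
Qed.

Lemma cis_lip s t : s <= t -> cabs (cis t - cis s) <= 2 * (t - s).
Proof.
move=> st; rewrite -Cint_cis//; have := @cabs_Cint_le (fun t => 'i%C * cis t) 1 s t st.
rewrite mulr1; apply.
  by apply: cont_onM; [exact: cont_on_cst|apply: cont_onT; exact: cis_continuous].
move=> x _; rewrite cabsM cabs_cis mulr1.
by rewrite /cabs /= expr0n expr1n /= add0r sqrtr1.
Qed.

End ComplexIntegral.

(** * Goursat's argument and the Cauchy integral formula *)

Section Bisection.
Variable R : realType.

Lemma nested_intervals (a b : nat -> R) :
  (forall n, a n <= a n.+1) -> (forall n, b n.+1 <= b n) -> (forall n, a n <= b n) ->
  exists t, forall n, a n <= t <= b n.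
Proof.
move=> a_nd b_ni ab.
have aD n k : a n <= a (n + k)%N.
  by elim: k => [|k ih]; rewrite ?addn0// addnS (le_trans ih).
have bD n k : b (n + k)%N <= b n.
  by elim: k => [|k ih]; rewrite ?addn0// addnS (le_trans _ ih).
have abb m n : a m <= b n.
  by apply: le_trans (aD m n) _; apply: le_trans (ab _) _; rewrite addnC.
have ubA n : ubound (range a) (b n) by move=> _ [m _ <-].
exists (sup (range a)) => n; apply/andP; split.
- by apply: ub_le_sup; [exists (b 0%N)|exists n].
- by apply: ge_sup => //; exists (a 0%N), 0%N.
Qed.

Let rect := ((R * R) * (R * R))%type.

(** Goursat's argument for an abstract function of rectangles that is additive under cuts in both
    directions. If it is also o of the squared half-perimeter near every point, repeated quartering
    around a limit point contradicts a nonzero value. *)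
Lemma bisection (I : R -> R -> R -> R -> CC R) (t0 t1 s0 s1 : R) :
  t0 <= t1 -> s0 <= s1 ->
  (forall a m b c d, t0 <= a -> a <= m -> m <= b -> b <= t1 ->
     s0 <= c -> c <= d -> d <= s1 -> I a b c d = I a m c d + I m b c d) ->
  (forall a b c m d, t0 <= a -> a <= b -> b <= t1 ->
     s0 <= c -> c <= m -> m <= d -> d <= s1 -> I a b c d = I a b c m + I a b m d) ->
  (forall t s, t0 <= t <= t1 -> s0 <= s <= s1 -> forall e, 0 < e ->
     exists2 del, 0 < del & forall a b c d,
       t0 <= a -> a <= t -> t <= b -> b <= t1 ->
       s0 <= c -> c <= s -> s <= d -> d <= s1 -> (b - a) + (d - c) < del ->
       cabs (I a b c d) <= e * ((b - a) + (d - c)) ^+ 2) ->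
  I t0 t1 s0 s1 = 0.
Proof.
move=> t01 s01 Ht Hs Hloc; apply/eqP; rewrite -cabs_eq0 -[_ == 0]negbK; apply/negP => I0.
have {I0} eta0 : 0 < cabs (I t0 t1 s0 s1) by rewrite lt_neqAle eq_sym I0 cabs_ge0.
set eta := cabs _ in eta0.
pose J (Q : rect) := cabs (I Q.1.1 Q.1.2 Q.2.1 Q.2.2).
pose m (x : R * R) := (x.1 + x.2) / 2.
pose q1 (Q : rect) : rect := ((Q.1.1, m Q.1), (Q.2.1, m Q.2)).
pose q2 (Q : rect) : rect := ((m Q.1, Q.1.2), (Q.2.1, m Q.2)).
pose q3 (Q : rect) : rect := ((Q.1.1, m Q.1), (m Q.2, Q.2.2)).
pose q4 (Q : rect) : rect := ((m Q.1, Q.1.2), (m Q.2, Q.2.2)).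
(* By additivity some quarter carries at least a fourth of the value; the last one is taken when the
   first three fail. *)
pose step Q := if J Q / 4 <= J (q1 Q) then q1 Q else
               if J Q / 4 <= J (q2 Q) then q2 Q else
               if J Q / 4 <= J (q3 Q) then q3 Q else q4 Q.
pose ok (Q : rect) := [/\ t0 <= Q.1.1, Q.1.1 <= Q.1.2 & Q.1.2 <= t1] /\
                      [/\ s0 <= Q.2.1, Q.2.1 <= Q.2.2 & Q.2.2 <= s1].
have stepP Q : ok Q -> [/\ ok (step Q), J Q / 4 <= J (step Q),
    Q.1.1 <= (step Q).1.1 /\ (step Q).1.2 <= Q.1.2,
    Q.2.1 <= (step Q).2.1 /\ (step Q).2.2 <= Q.2.2 &
    (step Q).1.2 - (step Q).1.1 = (Q.1.2 - Q.1.1) / 2 /\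
    (step Q).2.2 - (step Q).2.1 = (Q.2.2 - Q.2.1) / 2].
  case: Q => -[a b] [c d] [/= [t0a ab bt1] [s0c cd ds1]].
  have JQ : J ((a, b), (c, d)) <= J (q1 ((a, b), (c, d))) + J (q2 ((a, b), (c, d))) +
      (J (q3 ((a, b), (c, d))) + J (q4 ((a, b), (c, d)))).
    have [am mb] : a <= m (a, b) /\ m (a, b) <= b.
      by split; move: ab; rewrite /m /=; clear; lra.
    have [cn nd] : c <= m (c, d) /\ m (c, d) <= d.
      by split; move: cd; rewrite /m /=; clear; lra.
    have nd1 := le_trans nd ds1; have s0n := le_trans s0c cn.
    rewrite /J /= (Hs a b c (m (c, d)) d)// (Ht a (m (a, b)) b c (m (c, d)))//.
    rewrite (Ht a (m (a, b)) b (m (c, d)) d)//.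
    by apply: le_trans (cabsD _ _) _; apply: lerD; exact: cabsD.
  move: JQ; rewrite /step; clear Hloc Ht Hs eta0.
  have mid (x y : R) : x <= y -> [/\ x <= (x + y) / 2, (x + y) / 2 <= y,
      (x + y) / 2 - x = (y - x) / 2 & y - (x + y) / 2 = (y - x) / 2].
    by clear; move=> xy; split; lra.
  have [am mb am2 mb2] := mid a b ab; have [cn nd cn2 nd2] := mid c d cd.
  have t0m := le_trans t0a am; have mt1 := le_trans mb bt1.
  have s0n := le_trans s0c cn; have ns1 := le_trans nd ds1.
  have J4 (x y z u v : R) : u <= x + y + (z + v) -> x < u / 4 -> y < u / 4 -> z < u / 4 -> u / 4 <= v.
    by clear; lra.
  case: ifPn => [?|]; first by move=> _; do !split.
  rewrite -ltNge => J1; case: ifPn => [?|]; first by move=> _; do !split.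
  rewrite -ltNge => J2; case: ifPn => [?|]; first by move=> _; do !split.
  by rewrite -ltNge => J3 J0; do !split => //; exact: J4 J0 J1 J2 J3.
pose Q n : rect := iter n step ((t0, t1), (s0, s1)).
have Qok n : ok (Q n).
  by elim: n => [|n /stepP[]//]; split; split.
have QS n : Q n.+1 = step (Q n) by [].
have QJ n : eta / 4 ^+ n <= J (Q n).
  elim: n => [|n ih]; first by rewrite expr0 divr1.
  have [_ h _ _ _] := stepP _ (Qok n); rewrite QS; apply: le_trans h.
  by rewrite exprSr invfM mulrA ler_pM2r// invr_gt0.
have Qw n : (Q n).1.2 - (Q n).1.1 = (t1 - t0) / 2 ^+ n /\
            (Q n).2.2 - (Q n).2.1 = (s1 - s0) / 2 ^+ n.
  elim: n => [|n [h1 h2]]; first by rewrite expr0 !divr1.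
  have [_ _ _ _] := stepP _ (Qok n); rewrite -QS => -[-> ->].
  by rewrite h1 h2 exprSr invfM !mulrA.
have [t tP] : exists t, forall n, (Q n).1.1 <= t <= (Q n).1.2.
  apply: nested_intervals => n; first by have [_ _ []] := stepP _ (Qok n).
  - by have [_ _ []] := stepP _ (Qok n).
  - by have [[]] := Qok n.
have [s sP] : exists s, forall n, (Q n).2.1 <= s <= (Q n).2.2.
  apply: nested_intervals => n; first by have [_ _ _ []] := stepP _ (Qok n).
  - by have [_ _ _ []] := stepP _ (Qok n).
  - by have [_ []] := Qok n.
set L := (t1 - t0) + (s1 - s0).
have L0 : 0 <= L by rewrite addr_ge0// subr_ge0.
(* At level n the half-perimeter is L / 2^n, so the local bound is this number times L^2 / 4^n,
   below the lower bound eta / 4^n of [QJ]. The added 1 covers L = 0. *)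
have e0 : 0 < eta / (L ^+ 2 + 1) / 2 by rewrite !divr_gt0// ltr_wpDl// sqr_ge0.
have [del del0 H] := Hloc t s (tP 0%N) (sP 0%N) _ e0.
have [n nP] : exists n, L / 2 ^+ n < del.
  exists (Num.truncn (L / del)).+1.
  rewrite ltr_pdivrMr ?exprn_gt0// mulrC -ltr_pdivrMr//.
  apply: lt_le_trans (truncnS_gt _) _.
  by rewrite -natrX ler_nat ltnW// ltn_expl.
have [[h1 h2 h3] [h4 h5 h6]] := Qok n; have /andP[h7 h8] := tP n; have /andP[h9 h10] := sP n.
have [w1 w2] := Qw n.
have wE : (Q n).1.2 - (Q n).1.1 + ((Q n).2.2 - (Q n).2.1) = L / 2 ^+ n.
  by rewrite w1 w2 -mulrDl.
have := H _ _ _ _ h1 h7 h8 h3 h4 h9 h10 h6; rewrite wE => /(_ nP).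
apply/negP; rewrite -ltNge; apply: lt_le_trans (QJ n).
have -> : (L / 2 ^+ n) ^+ 2 = L ^+ 2 / 4 ^+ n.
  rewrite expr_div_n [in LHS]exprAC; congr (_ / _ ^+ n); ring.
rewrite mulrA ltr_pM2r ?invr_gt0 ?exprn_gt0//.
have k0 : 0 < L ^+ 2 + 1 by rewrite ltr_wpDl// sqr_ge0.
rewrite mulrAC ltr_pdivrMr// mulrAC ltr_pdivrMr//.
by rewrite -mulrA ltr_pM2l//; move: (sqr_ge0 L) => ?; lra.
Qed.

End Bisection.

Section CauchyFormula.
Variable R : realType.
Local Notation rc x := ((x%:C)%C : CC R).

Lemma rc_continuous : continuous (fun x : R => rc x).
Proof. by move=> x; apply: cvg_Complex; [exact: cvg_id|exact: cvg_cst]. Qed.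

Lemma derivable_CC_continuous (f : CC R -> CC R) w : derivable f w 1 -> {for w, continuous f}.
Proof. by move=> /derivable1_diffP; exact: differentiable_continuous. Qed.

Variables (r : R) (z : CC R) (f : CC R -> CC R).
Hypothesis zr : cabs z < r.
Hypothesis fh : forall w, cabs w <= r -> derivable f w 1.

Let g (t : R) : CC R := rc r * cis t.
Let K (t : R) : CC R := 'i%C * g t / (g t - z).
Let cw (x t : R) : CC R := z + rc x * (g t - z).

Let r0 : 0 < r. Proof. exact: le_lt_trans (cabs_ge0 z) zr. Qed.

Let cabs_g t : cabs (g t) = r.
Proof. by rewrite cabsM cabs_cis mulr1 cabs_real gtr0_norm. Qed.

Let g_continuous : continuous g.
Proof. by move=> t; apply: cvgM; [exact: cvg_cst|exact: cis_continuous]. Qed.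

Let gz_ge t : r - cabs z <= cabs (g t - z).
Proof. by rewrite -(cabs_g t); exact: cabs_sub_ge. Qed.

Let gz_neq0 t : g t - z != 0.
Proof. by rewrite -cabs_gt0 (lt_le_trans _ (gz_ge t))// subr_gt0. Qed.

Let gz_le t : cabs (g t - z) <= 2 * r.
Proof. by apply: le_trans (cabsB _ _) _; rewrite cabs_g; move: (ltW zr); lra. Qed.

Let K_continuous : continuous K.
Proof.
move=> t; apply: cvgM; first by apply: cvgM; [exact: cvg_cst|exact: g_continuous].
apply: cvgV; first exact: gz_neq0.
by apply: cvgB; [exact: g_continuous|exact: cvg_cst].
Qed.

Let K_le t : cabs (K t) <= r / (r - cabs z).
Proof.
rewrite cabs_div cabsM cabs_g -[cabs 'i%C]/(Num.sqrt (0 ^+ 2 + 1 ^+ 2)).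
rewrite expr0n expr1n /= add0r sqrtr1 mul1r ler_pM2l// lef_pV2 ?gz_ge//.
  by rewrite posrE cabs_gt0 gz_neq0.
by rewrite posrE subr_gt0.
Qed.

Let cwE x t : cw x t = (1 - rc x) * z + rc x * g t.
Proof. rewrite /cw; ring. Qed.

Let cabs_cw x t : 0 <= x <= 1 -> cabs (cw x t) <= r.
Proof.
move=> /andP[x0 x1]; rewrite cwE; apply: le_trans (cabsD _ _) _.
rewrite (cabsM (rc x)) cabs_g (cabsM _ z) cabs_real (_ : 1 - rc x = rc (1 - x)); last by rewrite rmorphB.
rewrite cabs_real !ger0_norm ?subr_ge0//.
have := ler_wpM2l (_ : 0 <= 1 - x) (ltW zr); rewrite subr_ge0 => /(_ x1); lra.
Qed.

Let cw_continuous1 x : continuous (cw x).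
Proof.
move=> t; apply: cvgD; first exact: cvg_cst.
apply: cvgM; first exact: cvg_cst.
by apply: cvgB; [exact: g_continuous|exact: cvg_cst].
Qed.

Let cw_continuous2 t : continuous (cw ^~ t).
Proof.
move=> x; apply: cvgD; first exact: cvg_cst.
by apply: cvgM; [exact: rc_continuous|exact: cvg_cst].
Qed.

Let fcw1 x a b : 0 <= x <= 1 -> cont_on a b (fun t => f (cw x t)).
Proof.
move=> x01 t _; apply: (continuous_comp (@cw_continuous1 x t)).
by apply/derivable_CC_continuous/fh; exact: cabs_cw.
Qed.

Let fcw2 t a b : 0 <= a -> b <= 1 -> cont_on a b (fun x => f (cw x t)).
Proof.
move=> a0 b1 x /andP[ax xb]; apply: (continuous_comp (@cw_continuous2 t x)).
apply/derivable_CC_continuous/fh; apply: cabs_cw.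
by rewrite (le_trans a0 ax) (le_trans xb b1).
Qed.

Let rcV_cont a b : 0 < a -> cont_on a b (fun x => (rc x)^-1).
Proof.
move=> a0; apply: cont_onV; last exact/cont_onT/rc_continuous.
by move=> x /andP[ax _]; rewrite -cabs_gt0 cabs_real normr_gt0 gt_eqF// (lt_le_trans a0).
Qed.

(** With w = [cw x t] one has w - z = x (g t - z), hence dw / (w - z) = dx / x + K dt. This is the
    integral of f(w) dw / (w - z) along the boundary of the parameter rectangle,
    counterclockwise. *)
Let I (a b c d : R) : CC R :=
  Cint c d (fun t => (f (cw b t) - f (cw a t)) * K t) -
  Cint a b (fun x => (f (cw x d) - f (cw x c)) * (rc x)^-1).

Let cont1 a b c d : 0 <= a <= 1 -> 0 <= b <= 1 ->
  cont_on c d (fun t => (f (cw b t) - f (cw a t)) * K t).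
Proof.
move=> a01 b01; apply: cont_onM; last exact/cont_onT/K_continuous.
by apply: cont_onB; exact: fcw1.
Qed.

Let cont2 a b c d : 0 < a -> b <= 1 ->
  cont_on a b (fun x => (f (cw x d) - f (cw x c)) * (rc x)^-1).
Proof.
move=> a0 b1; apply: cont_onM; last exact: rcV_cont.
by apply: cont_onB; apply: fcw2 => //; exact: ltW.
Qed.

Let Cint_g a b : a <= b -> Cint a b (fun t => 'i%C * g t) = g b - g a.
Proof.
move=> ab; rewrite /g -mulrBr -Cint_cis// -CintZ.
  by apply: eq_Cint => x _; rewrite mulrCA.
by apply: cont_onM; [exact: cont_on_cst|exact/cont_onT/cis_continuous].
Qed.

Let g_lip s t : cabs (g t - g s) <= 2 * r * `|t - s|.
Proof.
wlog st : s t / s <= t => [H|].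
  have [/H//|/ltW/H] := leP s t.
  by rewrite cabs_distC distrC.
rewrite /g -mulrBr cabsM cabs_real gtr0_norm// ger0_norm ?subr_ge0//.
by have := cis_lip st; rewrite -(ler_pM2l r0) => h; rewrite [2 * r]mulrC -mulrA.
Qed.

Let cw_lip x t y s : 0 <= y <= 1 -> cabs (cw x t - cw y s) <= 2 * r * (`|x - y| + `|t - s|).
Proof.
move=> /andP[y0 y1].
have -> : cw x t - cw y s = rc (x - y) * (g t - z) + rc y * (g t - g s).
  rewrite /cw rmorphB; ring.
apply: le_trans (cabsD _ _) _; rewrite (cabsM (rc (x - y))) (cabsM (rc y)) !cabs_real mulrDr (ger0_norm y0); apply: lerD.
  by rewrite mulrC ler_wpM2r.
by apply: le_trans (g_lip _ _); rewrite -[leRHS]mul1r ler_wpM2r// cabs_ge0.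
Qed.

(** Starting the radial parameter at tau > 0 keeps dx / x bounded, by 1 / tau. *)
Let I0 tau : 0 < tau <= 1 -> I tau 1 0 (2 * pi) = 0.
Proof.
move=> /andP[tau0 tau1].
have pi2 : 0 <= 2 * pi :> R by rewrite mulr_ge0// pi_ge0.
apply: bisection => //.
- move=> a m b c d ta am mb b1 _ cd _.
  have a0 := lt_le_trans tau0 ta.
  have a01 : 0 <= a <= 1 by apply/andP; split; lra.
  have b01 : 0 <= b <= 1 by apply/andP; split; lra.
  have m01 : 0 <= m <= 1 by apply/andP; split; lra.
  rewrite /I (@Cint_split _ _ a b m) ?am//; last exact: cont2.
  rewrite (_ : Cint c d _ = Cint c d (fun t => (f (cw m t) - f (cw a t)) * K t) +
     Cint c d (fun t => (f (cw b t) - f (cw m t)) * K t)); first by ring.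
  rewrite -CintD; [|exact: cont1|exact: cont1].
  by apply: eq_Cint => x _; ring.
- move=> a b c m d ta ab b1 _ cm md _.
  have a0 := lt_le_trans tau0 ta.
  have a01 : 0 <= a <= 1 by apply/andP; split; lra.
  have b01 : 0 <= b <= 1 by apply/andP; split; lra.
  rewrite /I (@Cint_split _ _ c d m) ?cm//; last exact: cont1.
  rewrite (_ : Cint a b _ = Cint a b (fun x => (f (cw x m) - f (cw x c)) * (rc x)^-1) +
     Cint a b (fun x => (f (cw x d) - f (cw x m)) * (rc x)^-1)); first by ring.
  rewrite -CintD; [|exact: cont2|exact: cont2].
  by apply: eq_Cint => x _; ring.
move=> t s /andP[taut t1] _ e e0.
have t0 : 0 < t := lt_le_trans tau0 taut.
have t01 : 0 <= t <= 1 by rewrite (ltW t0).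
set ws := cw t s; set D := 'D_1 f ws.
set Km := r / (r - cabs z).
have Km0 : 0 < Km by rewrite divr_gt0// subr_gt0.
(* The 8 r collects the 2 of [cabs_Cint_le], the 2 of a difference of two remainders and the
   Lipschitz constant 2 r of [cw]; [Km] bounds K and 1 / tau bounds 1 / x. *)
set C := 8 * r * (Km + tau^-1).
have C0 : 0 < C by rewrite !mulr_gt0// addr_gt0// invr_gt0.
have dfw : is_derive ws 1 f D by apply: DeriveDef => //; exact/fh/cabs_cw.
have [del del0 H] := (is_deriveCP f ws D).1 dfw (e / C) (divr_gt0 e0 C0).
exists (del / (2 * r)); first by rewrite divr_gt0// mulr_gt0.
move=> a b c d ta at_ tb b1 _ cs sd _; rewrite ltr_pdivlMr ?mulr_gt0// [_ * (2 * r)]mulrC => Sdel.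
set S := (b - a + (d - c)) in Sdel *.
have S0 : 0 <= S by rewrite /S; lra.
have a0 := lt_le_trans tau0 ta.
have a01 : 0 <= a <= 1 by apply/andP; split; lra.
have b01 : 0 <= b <= 1 by apply/andP; split; lra.
pose rho w := f w - f ws - D * (w - ws).
have rhoP x y : a <= x <= b -> c <= y <= d -> cabs (rho (cw x y)) <= e / C * (2 * r * S).
  move=> /andP[ax xb] /andP[cy yd].
  have wS : cabs (cw x y - ws) <= 2 * r * S.
    apply: le_trans (cw_lip _ _ _ t01) _; rewrite ler_pM2l ?mulr_gt0//.
    by rewrite /S; apply: lerD; rewrite ler_norml; apply/andP; split; lra.
  have := H (cw x y - ws) (le_lt_trans wS Sdel).
  rewrite (addrC ws) subrK => /le_trans; apply; rewrite ler_pM2l//; exact: divr_gt0.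
have f_rho w w' : f w - f w' = (rho w - rho w') + D * (w - w') by rewrite /rho; ring.
have rho1 x : 0 <= x <= 1 -> cont_on c d (fun y => rho (cw x y)).
  move=> x01; apply: cont_onB.
    by apply: cont_onB; [exact: fcw1|exact: cont_on_cst].
  apply: cont_onM; first exact: cont_on_cst.
  by apply: cont_onB; [exact/cont_onT/cw_continuous1|exact: cont_on_cst].
have rho2 y : cont_on a b (fun x => rho (cw x y)).
  apply: cont_onB.
    by apply: cont_onB; [apply: fcw2 => //; exact: ltW|exact: cont_on_cst].
  apply: cont_onM; first exact: cont_on_cst.
  by apply: cont_onB; [exact/cont_onT/cw_continuous2|exact: cont_on_cst].
have ab : a <= b by lra.
have cd : c <= d by lra.
have cr1 : cont_on c d (fun y => (rho (cw b y) - rho (cw a y)) * K y).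
  by apply: cont_onM; [apply: cont_onB; exact: rho1|exact/cont_onT/K_continuous].
have cr2 : cont_on a b (fun x => (rho (cw x d) - rho (cw x c)) * (rc x)^-1).
  by apply: cont_onM; [apply: cont_onB; exact: rho2|exact: rcV_cont].
(* The affine part of f at [ws] contributes D (b - a) (g d - g c) to both integrals, so it cancels
   and only the remainder [rho] is left. *)
have -> : I a b c d = Cint c d (fun y => (rho (cw b y) - rho (cw a y)) * K y) -
                      Cint a b (fun x => (rho (cw x d) - rho (cw x c)) * (rc x)^-1).
  have cig : cont_on c d (fun y => 'i%C * g y : CC R).
    by apply: cont_onM; [exact: cont_on_cst|exact/cont_onT/g_continuous].
  have -> : Cint c d (fun y => (rho (cw b y) - rho (cw a y)) * K y) =
     Cint c d (fun t => (f (cw b t) - f (cw a t)) * K t) - D * rc (b - a) * (g d - g c).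
    rewrite -(Cint_g cd) -(CintZ _ cig) -CintB; [|exact: cont1|by apply: cont_onM; [exact: cont_on_cst|]].
    apply: eq_Cint => y _; rewrite f_rho /cw rmorphB /K; have := gz_neq0 y => h; field.
    exact: h.
  have -> : Cint a b (fun x => (rho (cw x d) - rho (cw x c)) * (rc x)^-1) =
     Cint a b (fun x => (f (cw x d) - f (cw x c)) * (rc x)^-1) - D * (g d - g c) * rc (b - a).
    rewrite -Cint_cst// -CintB; [|exact: cont2|exact: cont_on_cst].
    apply: eq_Cint => x /andP[ax _]; rewrite f_rho /cw; field.
    by rewrite -cabs_gt0 cabs_real normr_gt0 gt_eqF// (lt_le_trans a0).
  rewrite /I; ring.
have rho2_le u v : cabs (rho u) <= e / C * (2 * r * S) -> cabs (rho v) <= e / C * (2 * r * S) ->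
    cabs (rho u - rho v) <= 2 * (e / C * (2 * r * S)).
  by move=> ? ?; apply: le_trans (cabsB _ _) _; lra.
set M := 2 * (e / C * (2 * r * S)) in rho2_le.
have M0 : 0 <= M by rewrite !mulr_ge0// ?invr_ge0 ltW.
have B1 : cabs (Cint c d (fun y => (rho (cw b y) - rho (cw a y)) * K y)) <= 2 * (M * Km) * (d - c).
  apply: cabs_Cint_le => // y cyd; rewrite cabsM; apply: ler_pM; rewrite ?cabs_ge0 ?K_le//.
  by apply: rho2_le; apply: rhoP => //; rewrite ?lexx ?ab.
have B2 : cabs (Cint a b (fun x => (rho (cw x d) - rho (cw x c)) * (rc x)^-1)) <=
    2 * (M * tau^-1) * (b - a).
  apply: cabs_Cint_le => // x /andP[ax xb]; rewrite cabsM; apply: ler_pM; rewrite ?cabs_ge0//.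
    by apply: rho2_le; apply: rhoP => //; rewrite ?lexx ?cd ?ax.
  have x0 := lt_le_trans a0 ax.
  rewrite cabsV cabs_real gtr0_norm// lef_pV2 ?posrE//; exact: le_trans ta ax.
apply: le_trans (cabsB _ _) _; apply: le_trans (lerD B1 B2) _.
have MS : 2 * M * (Km + tau^-1) * S = e * S ^+ 2.
  rewrite /M (_ : C = 8 * r * (Km + tau^-1))//.
  have h1 : Km + tau^-1 != 0 by rewrite gt_eqF// addr_gt0// invr_gt0.
  have h2 : r != 0 by rewrite gt_eqF.
  by set q := Km + tau^-1 in h1 *; field; rewrite h1 h2.
rewrite -MS /S.
have p1 : 0 <= M * Km * (b - a).
  by apply: mulr_ge0; [apply: mulr_ge0 => //; exact: ltW|rewrite subr_ge0].
have p2 : 0 <= M * tau^-1 * (d - c).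
  by apply: mulr_ge0; [apply: mulr_ge0 => //; rewrite invr_ge0 ltW|rewrite subr_ge0].
have -> : 2 * M * (Km + tau^-1) * (b - a + (d - c)) =
    2 * (M * Km) * (d - c) + 2 * (M * tau^-1) * (b - a) +
    (2 * (M * Km * (b - a)) + 2 * (M * tau^-1 * (d - c))) by ring.
by rewrite lerDl addr_ge0// mulr_ge0.
Qed.

(* Goursat bisection for the pullback of f(w) dw / (w - z) under
   (tau, t) |-> z + tau (g t - z) shows that the integral over the contracted circle
   does not depend on tau; then let tau tend to 0. *)
Lemma Cauchy_kernel :
  Cint 0 (2 * pi) (fun t => f (g t) * K t) = f z * Cint 0 (2 * pi) K.
Proof.
have pi2 : 0 < 2 * pi :> R by rewrite mulr_gt0// pi_gt0.
have cK : cont_on 0 (2 * pi) K by exact/cont_onT/K_continuous.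
have g2pi : g (2 * pi) = g 0 by rewrite /g cis2pi.
have Phi tau : 0 < tau <= 1 -> Cint 0 (2 * pi) (fun t => f (g t) * K t) =
   Cint 0 (2 * pi) (fun t => f (cw tau t) * K t).
  move=> tau01; have /andP[tau0 tau1] := tau01; have := I0 tau01; rewrite /I.
  (* The circle is closed: the two radial sides of the rectangle have the same image and cancel. *)
  rewrite (_ : Cint tau 1 _ = 0) ?subr0; last first.
    rewrite -[RHS](mul0r (rc (1 - tau))) -Cint_cst//.
    by apply: eq_Cint => x _; rewrite /cw g2pi subrr mul0r.
  have t01 : 0 <= tau <= 1 by rewrite ltW.
  have o01 : 0 <= (1 : R) <= 1 by rewrite ler01 lexx.
  rewrite (_ : Cint 0 _ _ = Cint 0 (2 * pi) (fun t => f (g t) * K t) -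
     Cint 0 (2 * pi) (fun t => f (cw tau t) * K t)); first by move/subr0_eq.
  have cg : cont_on 0 (2 * pi) (fun t => f (g t) * K t).
    apply: cont_onM cK => t _; apply: (continuous_comp (@g_continuous t)).
    by apply/derivable_CC_continuous/fh; rewrite cabs_g.
  have cf := cont_onM (@fcw1 tau 0 (2 * pi) t01) cK.
  rewrite -(CintB cg cf).
  have cw1 x : cw 1 x = g x by rewrite /cw rmorph1; ring.
  by apply: eq_Cint => x _; rewrite mulrBl cw1.
apply/eqP; rewrite -subr_eq0 -cabs_eq0 eq_le cabs_ge0 andbT.
apply/ler_addgt0Pl => e e0; rewrite addr0.
set Km := r / (r - cabs z).
have Km0 : 0 < Km by rewrite divr_gt0// subr_gt0.
have fzc : {for z, continuous f} by apply/derivable_CC_continuous/fh/ltW.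
set e1 := e / (2 * Km * (2 * pi)).
have e10 : 0 < e1.
  by apply: divr_gt0 => //; apply: mulr_gt0 => //; exact: mulr_gt0.
have [del del0 H] := (continuous_CCP _ _).1 fzc _ e10.
(* On the contracted circle |w - z| <= 2 r tau < del. *)
pose tau := Num.min 1 (del / (4 * r)).
have tau0 : 0 < tau by rewrite lt_min ltr01 divr_gt0// mulr_gt0.
have tau1 : tau <= 1 by rewrite ge_min lexx.
have taud : tau * (2 * r) < del.
  have : tau <= del / (4 * r) by rewrite ge_min lexx orbT.
  rewrite ler_pdivlMr ?mulr_gt0//; lra.
have t01 : 0 <= tau <= 1 by rewrite ltW.
rewrite (Phi tau); last by rewrite tau0.
have cf := cont_onM (@fcw1 tau 0 (2 * pi) t01) cK.
have cc := cont_onM (@cont_on_cst _ _ (f z) 0 (2 * pi)) cK.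
rewrite -(CintZ _ cK) -(CintB cf cc).
apply: (@le_trans _ _ (2 * (e1 * Km) * (2 * pi - 0))).
  apply: cabs_Cint_le; first exact: ltW.
    exact: cont_onB cf cc.
  move=> x _; rewrite -mulrBl cabsM; apply: ler_pM; rewrite ?cabs_ge0 ?K_le//.
  apply/ltW/H; rewrite /cw (addrC z) addrK cabsM cabs_real gtr0_norm//.
  by apply: le_lt_trans taud; rewrite ler_pM2l.
have n0 : 2 * Km * (2 * pi) != 0 by rewrite gt_eqF//; apply: mulr_gt0 => //; exact: mulr_gt0.
rewrite subr0 (_ : 2 * (e1 * Km) * (2 * pi) = e1 * (2 * Km * (2 * pi))); last by ring.
by rewrite divfK.
Qed.

End CauchyFormula.

Section CauchyTransform.
Variable R : realType.
Local Notation rc x := ((x%:C)%C : CC R).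
Implicit Types (r t : R) (z w : CC R) (f : CC R -> CC R).

Definition circ r t : CC R := rc r * cis t.

Lemma cabs_circ r t : 0 <= r -> cabs (circ r t) = r.
Proof. by move=> r0; rewrite cabsM cabs_cis mulr1 cabs_real ger0_norm. Qed.

Lemma circ_continuous r : continuous (circ r).
Proof. by move=> t; apply: cvgM; [exact: cvg_cst|exact: cis_continuous]. Qed.

Lemma circB_ge r t w : 0 <= r -> r - cabs w <= cabs (circ r t - w).
Proof. by move=> r0; rewrite -{1}(cabs_circ t r0); exact: cabs_sub_ge. Qed.

Lemma circB_neq0 r t w : cabs w < r -> circ r t - w != 0.
Proof.
move=> wr; rewrite -cabs_gt0; apply: lt_le_trans (circB_ge t w _); rewrite ?subr_gt0//.
exact/ltW/(le_lt_trans (cabs_ge0 w)).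
Qed.

Lemma conjc_continuous : continuous (fun z : CC R => conjc (z : R[i]) : CC R).
Proof.
move=> z; apply/continuous_CCP => e e0; exists e => // w wz.
by rewrite -cabs_conj rmorphB /= !conjcK.
Qed.

Lemma conjc_div z w : conjc (z / w : R[i]) = (conjc (z : R[i]) : CC R) / (conjc (w : R[i]) : CC R).
Proof. exact: (fmorph_div (@conjc R) (z : R[i]) (w : R[i])). Qed.

Lemma conjcB z w : conjc (z - w : R[i]) = (conjc (z : R[i]) : CC R) - (conjc (w : R[i]) : CC R).
Proof. exact: (rmorphB (@conjc R) (z : R[i]) (w : R[i])). Qed.

Lemma Cint_conj (F : R -> CC R) a b : cont_on a b F ->
  Cint a b (fun t => conjc (F t : R[i]) : CC R) = conjc (Cint a b F : R[i]).
Proof.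
move=> cF; rewrite /Cint /=; congr Complex.
  by apply: eq_Rintegral => x _; case: (F x).
have h : Cint a b (fun x => -1 * F x) = - Cint a b F by rewrite (CintZ _ cF) mulN1r.
rewrite -[RHS]/(complex.Im (- Cint a b F)) -h /Cint /=.
by apply: eq_Rintegral => x _; rewrite mulN1r; case: (F x).
Qed.

(** At the centre 0 the kernel of [Cauchy_kernel] is the constant i. It is applied to F(w) = r^2 /
    (r^2 - conj z w): on |w| = r the relation r^2 = w conj w makes F(w) the conjugate of w / (w -
    z), and F(0) = 1. *)
Lemma Cint_Cauchy_kernel r z : cabs z < r ->
  Cint 0 (2 * pi) (fun t => 'i%C * circ r t / (circ r t - z)) = 'i%C * rc (2 * pi).
Proof.
move=> zr; have r0 : 0 < r := le_lt_trans (cabs_ge0 z) zr.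
have pi2 : 0 <= 2 * pi :> R by rewrite mulr_ge0// pi_ge0.
pose F (w : CC R) : CC R := rc (r ^+ 2) / (rc (r ^+ 2) - conjc (z : R[i]) * w).
have den w : cabs w <= r -> rc (r ^+ 2) - conjc (z : R[i]) * w != 0.
  move=> wr; rewrite -cabs_gt0; apply: lt_le_trans (cabs_sub_ge _ _).
  rewrite cabs_real cabsM cabs_conj ger0_norm ?sqr_ge0// subr_gt0 expr2.
  apply: le_lt_trans (_ : cabs z * r < _); first by rewrite ler_wpM2l// cabs_ge0.
  by rewrite ltr_pM2r.
have dF w : cabs w <= r -> derivable F w 1.
  move=> wr; apply: derivableM; first exact: derivable_cst.
  apply: derivableV; first exact: den.
  apply: derivableB; first exact: derivable_cst.
  by apply: derivableM; [exact: derivable_cst|exact: derivable_id].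
have h0 : cabs (0 : CC R) < r by rewrite cabs0.
have := Cauchy_kernel h0 dF.
have circ0 t : circ r t != 0 by rewrite -cabs_gt0 cabs_circ// ltW.
rewrite (@eq_Cint _ (fun t => 'i%C * (rc r * cis t) / (rc r * cis t - 0)) (fun=> 'i%C)); last first.
  by move=> x _; rewrite subr0 mulfK//; exact: circ0.
rewrite Cint_cst// subr0 {2}/F mulr0 subr0 divff ?mul1r; last first.
  by rewrite -cabs_gt0 cabs_real normr_gt0 gt_eqF// exprn_gt0.
have cK : cont_on 0 (2 * pi) (fun t => circ r t / (circ r t - z)).
  apply: cont_onT => t; apply: cvgM; first exact: circ_continuous.
  apply: cvgV; first exact: circB_neq0.
  by apply: cvgB; [exact: circ_continuous|exact: cvg_cst].
have cKc : cont_on 0 (2 * pi) (fun t => conjc ((circ r t / (circ r t - z)) : R[i]) : CC R).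
  by move=> t t0; apply: (continuous_comp (cK t t0)); exact: conjc_continuous.
have FE t : F (circ r t) = conjc ((circ r t / (circ r t - z)) : R[i]).
  have hh := mulcJ_cabs (circ r t); rewrite cabs_circ ?ltW// in hh.
  have cz0 := circB_neq0 t zr.
  have czc0 : conjc (circ r t : R[i]) - conjc (z : R[i]) != 0 :> R[i].
    by rewrite -rmorphB conjc_eq0.
  rewrite conjc_div conjcB /F -hh; field.
  rewrite czc0 (mulrC (conjc (z : R[i]))) -mulrBr mulf_neq0//; exact: circ0.
rewrite (@eq_Cint _ _ (fun t => 'i%C * (conjc ((circ r t / (circ r t - z)) : R[i]) : CC R))); last first.
  move=> t _; rewrite -[rc r * cis t]/(circ r t) FE subr0 mulfK// mulrC//.
rewrite (CintZ _ cKc) (Cint_conj cK).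
have i0 : 'i%C != 0 :> R[i] by rewrite eq_complex /= oner_eq0 andbF.
move=> /(mulfI i0) /(congr1 conjc); rewrite conjcK conjc_real => h.
rewrite -[in RHS]h -(CintZ _ cK).
by apply: eq_Cint => t _; rewrite mulrA.
Qed.

Lemma Cauchy_formula r z f : cabs z < r ->
  (forall w, cabs w <= r -> derivable f w 1) ->
  f z * rc (2 * pi) = Cint 0 (2 * pi) (fun t => f (circ r t) * circ r t / (circ r t - z)).
Proof.
move=> zr df; have r0 : 0 < r := le_lt_trans (cabs_ge0 z) zr.
have i0 : 'i%C != 0 :> R[i] by rewrite eq_complex /= oner_eq0 andbF.
apply: (mulfI i0); rewrite -CintZ; last first.
  apply: cont_onM; first apply: cont_onM.
  - move=> t _; apply: (continuous_comp (@circ_continuous r t)).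
    by apply/derivable_CC_continuous/df; rewrite cabs_circ// ltW.
  - exact/cont_onT/circ_continuous.
  - apply: cont_onV; first by move=> t _; exact: circB_neq0.
    by apply: cont_onB; [exact/cont_onT/circ_continuous|exact: cont_on_cst].
have := Cauchy_kernel zr df; rewrite -[X in _ = _ * X]/(Cint 0 (2 * pi) (fun t => 'i%C * circ r t / (circ r t - z))).
rewrite (Cint_Cauchy_kernel zr) => h; rewrite mulrCA -h.
by apply: eq_Cint => t _; rewrite -[rc r * cis t]/(circ r t) !mulrA (mulrC 'i%C).
Qed.

Lemma cont_on_bounded (g : R -> CC R) (a b : R) : a <= b -> cont_on a b g ->
  exists2 B, 0 < B & forall t, a <= t <= b -> cabs (g t) <= B.
Proof.
move=> ab cg; have [|c _ H] := @EVT_max R (fun t => cabs (g t)) a b ab.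
  apply: continuous_in_subspaceT => x /set_mem /=; rewrite in_itv /= => xab.
  by apply: (continuous_comp (cg x xab)); exact: cabs_continuous.
exists (cabs (g c) + 1); first by rewrite ltr_wpDl// cabs_ge0.
move=> t tab; apply: le_trans (H t _) _; first by rewrite in_itv.
by rewrite lerDl.
Qed.

Lemma is_derive_Cint (a b : R) (g k' : R -> CC R) (k : R -> CC R -> CC R) w (M d : R) :
  a <= b -> cont_on a b g -> cont_on a b k' -> 0 < d -> 0 <= M ->
  (forall h, cabs h < d -> cont_on a b (k ^~ (w + h))) ->
  (forall h t, cabs h < d -> cabs (k t (w + h) - k t w - h * k' t) <= M * cabs h ^+ 2) ->
  is_derive w 1 (fun z => Cint a b (fun t => g t * k t z)) (Cint a b (fun t => g t * k' t)).
Proof.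
move=> ab cg ck' d0 M0 ck H; apply/is_deriveCP => e e0.
have [B B0 gB] := cont_on_bounded ab cg.
(* The integrated remainder is at most (C - 1) |h|^2; the added 1 makes C positive, so that |h| < e
   / C suffices. *)
set C := 2 * (B * M) * (b - a) + 1.
have C0 : 0 < C.
  by rewrite ltr_wpDl// !mulr_ge0 ?subr_ge0// ltW.
exists (Num.min d (e / C)); first by rewrite lt_min d0 divr_gt0.
move=> h; rewrite lt_min => /andP[hd he].
have ck0 : cont_on a b (k ^~ w) by rewrite -(addr0 w); apply: ck; rewrite cabs0.
have c1 := cont_onM cg (ck h hd); have c0 := cont_onM cg ck0; have c' := cont_onM cg ck'.
have -> : Cint a b (fun t => g t * k t (w + h)) - Cint a b (fun t => g t * k t w) -
   Cint a b (fun t => g t * k' t) * h =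
   Cint a b (fun t => g t * (k t (w + h) - k t w - h * k' t)).
  rewrite [X in _ - X]mulrC -(CintZ _ c') -(CintB c1 c0) -CintB.
  - by apply: eq_Cint => t _; ring.
  - exact: (cont_onB c1 c0).
  - exact: (cont_onM (@cont_on_cst _ _ h a b) c').
apply: (@le_trans _ _ (2 * (B * (M * cabs h ^+ 2)) * (b - a))).
  apply: (cabs_Cint_le ab).
    exact: (cont_onM cg (cont_onB (cont_onB (ck h hd) ck0) (cont_onM (@cont_on_cst _ _ h a b) ck'))).
  by move=> t tab; rewrite cabsM; apply: ler_pM; rewrite ?cabs_ge0// ?gB//; exact: H.
rewrite (_ : 2 * _ * _ = 2 * (B * M) * (b - a) * cabs h * cabs h); last by ring.
rewrite ler_wpM2r ?cabs_ge0//; move: he; rewrite ltr_pdivlMr// => /ltW; apply: le_trans.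
rewrite mulrC ler_wpM2l ?cabs_ge0//; by rewrite /C lerDl.
Qed.

Lemma Cauchy_transform1 r w (g : R -> CC R) : cabs w < r -> cont_on 0 (2 * pi) g ->
  is_derive w 1 (fun z => Cint 0 (2 * pi) (fun t => g t * (circ r t - z)^-1))
    (Cint 0 (2 * pi) (fun t => g t * (circ r t - w) ^- 2)).
Proof.
move=> wr cg; have r0 : 0 < r := le_lt_trans (cabs_ge0 w) wr.
(* For |h| < q both w and w + h stay at distance at least q from the circle; the remainder is h^2
   divided by three such distances. *)
pose q := (r - cabs w) / 2; have q0 : 0 < q by rewrite divr_gt0// subr_gt0.
have wh h : cabs h < q -> cabs (w + h) < r - q.
  by move=> hq; apply: le_lt_trans (cabsD _ _) _; rewrite /q in hq *; lra.
have wh' h : cabs h < q -> cabs (w + h) < r by move=> /wh; lra.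
have pi2 : 0 <= 2 * pi :> R by rewrite mulr_ge0// pi_ge0.
apply: (@is_derive_Cint _ _ g (fun t => (circ r t - w) ^- 2) (fun t z => (circ r t - z)^-1) w (q ^- 3) q pi2 cg _ q0).
- apply: cont_onT => t; apply: cvgV; first by rewrite expf_neq0// circB_neq0.
  by rewrite expr2; apply: cvgM; apply: cvgB; [exact: circ_continuous|exact: cvg_cst
    |exact: circ_continuous|exact: cvg_cst].
- by rewrite invr_ge0 exprn_ge0// ltW.
- move=> h hq; apply: cont_onT => t; apply: cvgV; first exact/circB_neq0/wh'.
  by apply: cvgB; [exact: circ_continuous|exact: cvg_cst].
move=> h t hq.
have A0 := circB_neq0 t wr; have Ah0 := circB_neq0 t (wh' h hq).
have -> : (circ r t - (w + h))^-1 - (circ r t - w)^-1 - h * (circ r t - w) ^- 2 =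
    h ^+ 2 / ((circ r t - (w + h)) * (circ r t - w) ^+ 2) by field; rewrite A0 Ah0.
rewrite cabs_div cabsX mulrC ler_wpM2r ?sqr_ge0// lef_pV2 ?posrE ?exprn_gt0//; last first.
  by rewrite cabs_gt0 mulf_neq0// expf_neq0.
rewrite cabsM cabsX exprS; apply: ler_pM; rewrite ?exprn_ge0 ?(ltW q0)//.
  by apply: le_trans (circB_ge t (w + h) (ltW r0)); move: (wh h hq); lra.
rewrite ler_pXn2r ?nnegrE ?cabs_ge0 ?(ltW q0)//.
apply: le_trans (circB_ge t w (ltW r0)); move: (ltW q0); rewrite /q; lra.
Qed.

Lemma Cauchy_transform2 r w (g : R -> CC R) : cabs w < r -> cont_on 0 (2 * pi) g ->
  derivable (fun z => Cint 0 (2 * pi) (fun t => g t * (circ r t - z) ^- 2)) w 1.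
Proof.
move=> wr cg; have r0 : 0 < r := le_lt_trans (cabs_ge0 w) wr.
pose q := (r - cabs w) / 2; have q0 : 0 < q by rewrite divr_gt0// subr_gt0.
have wh h : cabs h < q -> cabs (w + h) < r - q.
  by move=> hq; apply: le_lt_trans (cabsD _ _) _; rewrite /q in hq *; lra.
have wh' h : cabs h < q -> cabs (w + h) < r by move=> /wh; lra.
have pi2 : 0 <= 2 * pi :> R by rewrite mulr_ge0// pi_ge0.
suff : is_derive w 1 (fun z => Cint 0 (2 * pi) (fun t => g t * (circ r t - z) ^- 2))
  (Cint 0 (2 * pi) (fun t => g t * (2 * (circ r t - w) ^- 3))) by move=> [].
(* The remainder is h^2 times 3 (circ - w) - 2 h, which is bounded by 8 r, divided by five distances
   of size at least q. *)
apply: (@is_derive_Cint _ _ g (fun t => 2 * (circ r t - w) ^- 3) (fun t z => (circ r t - z) ^- 2) w (8 * r * q ^- 5) q pi2 cg _ q0).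
- apply: cont_onT => t; apply: cvgM; first exact: cvg_cst.
  apply: cvgV; first by rewrite expf_neq0// circB_neq0.
  rewrite !exprS expr0 mulr1; have cc : circ r t0 - w @[t0 --> t] --> circ r t - w.
    by apply: cvgB; [exact: circ_continuous|exact: cvg_cst].
  exact: (cvgM cc (cvgM cc cc)).
- by rewrite !mulr_ge0// ?invr_ge0 ?exprn_ge0// ltW.
- move=> h hq; apply: cont_onT => t; apply: cvgV.
    by rewrite expf_neq0//; exact/circB_neq0/wh'.
  by rewrite expr2; apply: cvgM; apply: cvgB; [exact: circ_continuous|exact: cvg_cst
    |exact: circ_continuous|exact: cvg_cst].
move=> h t hq.
have A0 := circB_neq0 t wr; have Ah0 := circB_neq0 t (wh' h hq).
have -> : (circ r t - (w + h)) ^- 2 - (circ r t - w) ^- 2 - h * (2 * (circ r t - w) ^- 3) =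
    h ^+ 2 * ((3 * (circ r t - w) - 2 * h) / ((circ r t - (w + h)) ^+ 2 * (circ r t - w) ^+ 3)).
  by field; rewrite A0 Ah0.
rewrite cabsM cabsX mulrC ler_wpM2r ?sqr_ge0// cabs_div; apply: ler_pM.
- exact: cabs_ge0.
- by rewrite invr_ge0 cabs_ge0.
- apply: le_trans (cabsB _ _) _.
  rewrite !cabsM (_ : cabs 3 = 3); last by rewrite (_ : 3 = rc 3) ?cabs_real ?ger0_norm// rmorph_nat.
  rewrite (_ : cabs 2 = 2); last by rewrite (_ : 2 = rc 2) ?cabs_real ?ger0_norm// rmorph_nat.
  have := cabsB (circ r t) w; rewrite (cabs_circ t (ltW r0)) => h1.
  have hq2 : cabs h < (r - cabs w) / 2 by [].
  by have := cabs_ge0 w; lra.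
rewrite lef_pV2 ?posrE ?exprn_gt0//; last by rewrite cabs_gt0 mulf_neq0// expf_neq0.
rewrite cabsM !cabsX (_ : 5 = 2 + 3)%N// exprD; apply: ler_pM; rewrite ?exprn_ge0 ?(ltW q0)//.
  rewrite ler_pXn2r ?nnegrE ?cabs_ge0 ?(ltW q0)//.
  by apply: le_trans (circB_ge t (w + h) (ltW r0)); move: (wh h hq); lra.
rewrite ler_pXn2r ?nnegrE ?cabs_ge0 ?(ltW q0)//.
by apply: le_trans (circB_ge t w (ltW r0)); move: (ltW q0); rewrite /q; lra.
Qed.

End CauchyTransform.

(** * Holomorphic functions on the disk *)

Section HolomorphicDisk.
Variable R : realType.
Local Notation rc x := ((x%:C)%C : CC R).
Implicit Types (z w a : CC R) (f g q : CC R -> CC R).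

Lemma holo_derivable f z : holo_disk f -> cabs z < 1 -> derivable f z 1.
Proof. by move=> hf z1; apply: hf; rewrite in_diskE. Qed.

Lemma holo_continuous f z : holo_disk f -> cabs z < 1 -> {for z, continuous f}.
Proof. by move=> hf z1; apply: derivable_CC_continuous; exact: holo_derivable. Qed.

Lemma near_disk z (P : CC R -> Prop) : cabs z < 1 -> (forall w, cabs w < 1 -> P w) ->
  \forall w \near z, P w.
Proof. by move=> /disk_nbhs H PP; apply: filterS H. Qed.

Lemma eq_holo f g : (forall z, cabs z < 1 -> f z = g z) -> holo_disk f -> holo_disk g.
Proof.
move=> fg hf z; rewrite in_diskE => z1.
by apply: near_eq_derivable (holo_derivable hf z1); exact: near_disk.
Qed.

Lemma holo_cst (k : CC R) : holo_disk (fun=> k).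
Proof. by move=> z _; exact: derivable_cst. Qed.

Lemma holo_id : holo_disk (fun z : CC R => z).
Proof. by move=> z _; exact: derivable_id. Qed.

Lemma holoB f g : holo_disk f -> holo_disk g -> holo_disk (fun z => f z - g z).
Proof. by move=> hf hg z zD; apply: derivableB; [exact: hf|exact: hg]. Qed.

Lemma holoM f g : holo_disk f -> holo_disk g -> holo_disk (fun z => f z * g z).
Proof. by move=> hf hg z zD; apply: derivableM; [exact: hf|exact: hg]. Qed.

Lemma holoX f n : holo_disk f -> holo_disk (fun z => f z ^+ n).
Proof.
move=> hf; elim: n => [|n ih].
  by apply: (@eq_holo (fun=> 1)) (@holo_cst 1) => z _; rewrite expr0.
by apply: (@eq_holo (fun z => f z * f z ^+ n)) (holoM hf ih) => z _; rewrite exprS.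
Qed.

Lemma holoV f : (forall z, cabs z < 1 -> f z != 0) -> holo_disk f ->
  holo_disk (fun z => (f z)^-1).
Proof.
by move=> f0 hf z zD; apply: derivableV; [apply: f0; rewrite -in_diskE|exact: hf].
Qed.

Lemma derivable_compCC f g z : derivable f z 1 -> derivable g (f z) 1 ->
  derivable (fun w => g (f w)) z 1.
Proof.
move=> /derivable1_diffP df /derivable1_diffP dg; apply/derivable1_diffP.
exact: (@differentiable_comp _ _ _ _ f g z df dg).
Qed.

Lemma holo_comp f g : (forall z, cabs z < 1 -> cabs (f z) < 1) -> holo_disk f ->
  holo_disk g -> holo_disk (fun z => g (f z)).
Proof.
move=> fD hf hg z zD; apply: derivable_compCC; first exact: hf.
by apply: holo_derivable => //; apply: fD; rewrite -in_diskE.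
Qed.

Let r_of z : cabs z < 1 -> exists r : R, cabs z < r /\ r < 1.
Proof. by move=> z1; exists ((cabs z + 1) / 2); split; lra. Qed.

(** A removable singularity: near a the quotient coincides with the Cauchy transform of f(w) / (w -
    a) on a circle around 0, which is differentiable at a as well. The identity holds for all z,
    inside the disk or not, because q is defined by the quotient everywhere. *)
Lemma divided_difference f a : holo_disk f -> cabs a < 1 ->
  exists2 q, holo_disk q & forall z, f z = f a + (z - a) * q z.
Proof.
move=> hf a1.
pose q z := if z == a then f^`() a else (f z - f a) / (z - a).
have fq z : f z = f a + (z - a) * q z.
  rewrite /q; have [->|za] := eqVneq z a; first by rewrite subrr mul0r addr0.
  by rewrite mulrC divfK ?subr_eq0// addrC subrK.
exists q; last exact: fq.
move=> z; rewrite in_diskE => z1; have [->|za] := eqVneq z a; last first.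
  have : derivable (fun w => (f w - f a) * (w - a)^-1) z 1.
    apply: derivableM.
      by apply: derivableB; [exact: holo_derivable|exact: derivable_cst].
    apply: derivableV; first by rewrite subr_eq0.
    by apply: derivableB; [exact: derivable_id|exact: derivable_cst].
  apply: near_eq_derivable; apply/nbhs_CC; exists (cabs (z - a)).
    by rewrite cabs_gt0 subr_eq0.
  move=> w wz; rewrite /q; case: eqVneq => // wa.
  by move: wz; rewrite wa cabs_distC ltxx.
have [r [ar r1]] := r_of a1.
have r0 : 0 < r := le_lt_trans (cabs_ge0 a) ar.
have pi2 : rc (2 * pi) != 0.
  by rewrite -cabs_gt0 cabs_real normr_gt0 gt_eqF// mulr_gt0// pi_gt0.
have df w : cabs w <= r -> derivable f w 1.
  by move=> wr; apply: holo_derivable => //; exact: le_lt_trans r1.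
have cg : cont_on 0 (2 * pi) (fun t => f (circ r t) * circ r t).
  apply: cont_onM; last exact/cont_onT/circ_continuous.
  move=> t _; apply: (continuous_comp (@circ_continuous _ r t)).
  by apply/derivable_CC_continuous/df; rewrite cabs_circ// ltW.
have cV w : cabs w < r -> cont_on 0 (2 * pi) (fun t => (circ r t - w)^-1).
  move=> wr; apply: cont_onV; first by move=> t _; exact: circB_neq0.
  by apply: cont_onB; [exact/cont_onT/circ_continuous|exact: cont_on_cst].
pose g t := f (circ r t) * circ r t * (circ r t - a)^-1.
have cga : cont_on 0 (2 * pi) g by exact: (cont_onM cg (cV a ar)).
pose Q z := Cint 0 (2 * pi) (fun t => g t * (circ r t - z)^-1) * (rc (2 * pi))^-1.
have dQ : derivable Q a 1.
  apply: derivableM; last exact: derivable_cst.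
  by have [] := Cauchy_transform1 ar cga.
have fQ w : cabs w < r -> f w - f a = (w - a) * Q w.
  move=> wr; apply: (mulIf pi2); rewrite mulrBl (Cauchy_formula wr df) (Cauchy_formula ar df).
  rewrite /Q mulrA divfK// -CintB; [|exact: (cont_onM cg (cV w wr))|exact: (cont_onM cg (cV a ar))].
  rewrite -CintZ; last exact: (cont_onM cga (cV w wr)).
  apply: eq_Cint => t _; rewrite /g; have h1 := circB_neq0 t wr; have h2 := circB_neq0 t ar.
  by field; rewrite h1 h2.
(* The value chosen for q at a is the limit of the quotient, by continuity of [Q]. *)
have f'a : f^`() a = Q a.
  have : is_derive a 1 f (Q a).
    apply/is_deriveCP => e e0.
    have [d d0 H] := (continuous_CCP _ _).1 (derivable_CC_continuous dQ) e e0.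
    exists (Num.min d (r - cabs a)); first by rewrite lt_min d0 subr_gt0.
    move=> h; rewrite lt_min => /andP[hd hr].
    have hr' : cabs (a + h) < r by apply: le_lt_trans (cabsD _ _) _; lra.
    have aha : a + h - a = h by rewrite (addrC a) addrK.
    rewrite (fQ _ hr') aha (mulrC _ h) -mulrBr cabsM mulrC ler_wpM2r ?cabs_ge0//.
    by apply/ltW/H; rewrite aha.
  by rewrite derive1E => dfa; exact: derive_val.
apply: near_eq_derivable dQ; apply/nbhs_CC; exists (r - cabs a); first by rewrite subr_gt0.
move=> w wa; rewrite /q; case: eqVneq => [->//|wna].
have wr : cabs w < r by have := cabsD (w - a) a; rewrite subrK; lra.
by rewrite (fQ w wr) mulrC mulKf// subr_eq0.
Qed.

(** On |w| < r the Cauchy formula writes f as a Cauchy transform of its boundary values;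
    [Cauchy_transform1] identifies f' there and [Cauchy_transform2] differentiates it again. *)
Lemma holo_derive1 f : holo_disk f -> holo_disk f^`().
Proof.
move=> hf z; rewrite in_diskE => z1.
have [r [zr r1]] := r_of z1.
have r0 : 0 < r := le_lt_trans (cabs_ge0 z) zr.
have pi2 : rc (2 * pi) != 0.
  by rewrite -cabs_gt0 cabs_real normr_gt0 gt_eqF// mulr_gt0// pi_gt0.
have df w : cabs w <= r -> derivable f w 1.
  by move=> wr; apply: holo_derivable => //; exact: le_lt_trans r1.
have cg : cont_on 0 (2 * pi) (fun t => f (circ r t) * circ r t).
  apply: cont_onM; last exact/cont_onT/circ_continuous.
  move=> t _; apply: (continuous_comp (@circ_continuous _ r t)).
  by apply/derivable_CC_continuous/df; rewrite cabs_circ// ltW.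
have := Cauchy_transform2 zr cg.
move=> /derivableM/(_ (derivable_cst (rc (2 * pi))^-1 _ _)).
apply: near_eq_derivable; apply: filterS (disk_nbhs zr) => w wr.
have d1 := Cauchy_transform1 wr cg.
rewrite derive1E; apply: esym.
set T := (X in 'D_1 X w).
have : is_derive w 1 (fun z => Cint 0 (2 * pi) (fun t => f (circ r t) * circ r t * (circ r t - z)^-1) *
   (rc (2 * pi))^-1) (Cint 0 (2 * pi) (fun t => f (circ r t) * circ r t * (circ r t - w) ^- 2) *
   (rc (2 * pi))^-1).
  have := is_deriveM d1 (is_derive_cst (rc (2 * pi))^-1 w 1).
  by rewrite scaler0 add0r [X in is_derive _ _ _ X -> _]mulrC.
move=> d2; have : is_derive w 1 f (Cint 0 (2 * pi) (fun t => f (circ r t) * circ r t * (circ r t - w) ^- 2) *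
   (rc (2 * pi))^-1).
  apply: near_eq_is_derive d2; apply: filterS (disk_nbhs wr) => v vr.
  by rewrite -(Cauchy_formula vr df) mulfK.
by move=> d3; exact: derive_val.
Qed.

Lemma holo_derive1n f n : holo_disk f -> holo_disk (cderiv n f).
Proof. by move=> hf; elim: n => [//|n ih]; exact: holo_derive1 ih. Qed.

Lemma eq_cderiv f g n : (forall z, cabs z < 1 -> f z = g z) ->
  forall z, cabs z < 1 -> cderiv n f z = cderiv n g z.
Proof.
move=> fg; elim: n => [//|n ih] z z1; rewrite /cderiv /= !derive1E.
by apply: near_eq_derive; apply: near_disk => // w /ih.
Qed.

Lemma is_derive_XsubM (F : CC R -> CC R) dF a z : is_derive z 1 F dF ->
  is_derive z 1 (fun w => (w - a) * F w) ((z - a) * dF + F z).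
Proof.
move=> dFz; have d := is_deriveM (is_deriveB (is_derive_id z 1) (is_derive_cst a z 1)) dFz.
by apply: is_derive_eq d _; rewrite subr0 /GRing.scale /= mulr1.
Qed.

Lemma is_derive_XsubMD (F G : CC R -> CC R) dF dG a k z :
  is_derive z 1 F dF -> is_derive z 1 G dG ->
  is_derive z 1 (fun w => (w - a) * F w + k * G w) ((z - a) * dF + F z + k * dG).
Proof.
move=> hF hG; have d2 := is_deriveM (is_derive_cst k z 1) hG.
apply: is_derive_eq (is_deriveD (is_derive_XsubM a hF) d2) _.
by rewrite scaler0 addr0.
Qed.

(** Leibniz's rule has only two terms since z - a is affine. At z = a it leaves (n + 1) times the
    n-th derivative of q, so the vanishing order of q is one less than that of the product. *)
Lemma cderiv_XsubM q a n z : holo_disk q -> cabs z < 1 ->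
  cderiv n.+1 (fun z => (z - a) * q z) z = (z - a) * cderiv n.+1 q z + n.+1%:R * cderiv n q z.
Proof.
move=> hq.
have dn k w : cabs w < 1 -> is_derive w 1 (cderiv k q) (cderiv k.+1 q w).
  move=> w1; rewrite -[cderiv k.+1 q w]/(derive1 (cderiv k q) w) derive1E.
  by apply: DeriveDef; [exact/holo_derivable/w1/holo_derive1n|].
elim: n z => [|n ih] z z1.
  rewrite -[LHS]/(derive1 (fun z => (z - a) * q z) z) derive1E.
  by rewrite (@derive_val _ _ _ _ _ _ _ (is_derive_XsubM a (dn 0%N z z1))) mul1r.
rewrite -[LHS]/(derive1 (cderiv n.+1 (fun z => (z - a) * q z)) z) derive1E.
pose G w := (w - a) * cderiv n.+1 q w + n.+1%:R * cderiv n q w.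
rewrite (@near_eq_derive _ _ _ _ G); last by apply: near_disk => // w w1; rewrite ih.
have d := is_derive_XsubMD a n.+1%:R (dn n.+1 z z1) (dn n z z1).
rewrite (@derive_val _ _ _ _ _ _ _ d); move: (cderiv n.+2 q z) (cderiv n.+1 q z) => u v.
have -> : n.+2%:R = n.+1%:R + 1 :> CC R by rewrite mulrSr.
by move: (n.+1%:R : CC R) => m; ring.
Qed.

(** One divided difference per zero: by [cderiv_XsubM] at a, the quotient inherits the remaining N
    vanishing derivatives. *)
Lemma divide_zeros f a N : holo_disk f -> cabs a < 1 ->
  (forall k, (k < N)%N -> cderiv k f a = 0) ->
  exists2 q, holo_disk q & forall z, f z = (z - a) ^+ N * q z.
Proof.
elim: N f => [|N ih] f hf a1 f0.
  by exists f; [exact: hf|move=> z; rewrite expr0 mul1r].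
have [q hq fq] := divided_difference hf a1.
have fa0 : f a = 0 by exact: (f0 0%N).
have fq' z : cabs z < 1 -> f z = (z - a) * q z by rewrite (fq z) fa0 add0r.
have [k kN|q' hq' qq'] := ih q hq a1.
  have := f0 k.+1 kN; rewrite (eq_cderiv _ fq' a1) cderiv_XsubM// subrr mul0r add0r.
  by move=> /eqP; rewrite mulf_eq0 pnatr_eq0 /= => /eqP.
by exists q'; [exact: hq'|move=> z; rewrite fq fa0 add0r qq' mulrA -exprS].
Qed.

Lemma cderiv_zeros q a N k : holo_disk q -> cabs a < 1 -> (k < N)%N ->
  cderiv k (fun z => (z - a) ^+ N * q z) a = 0.
Proof.
move=> hq a1; elim: N k => // N ih k kN.
have E z : cabs z < 1 -> (z - a) ^+ N.+1 * q z = (z - a) * ((z - a) ^+ N * q z).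
  by rewrite exprS mulrA.
have h : holo_disk (fun z => (z - a) ^+ N * q z).
  exact: (holoM (@holoX (fun z => z - a) N (holoB holo_id (@holo_cst a))) hq).
rewrite (eq_cderiv _ E a1); case: k kN => [|k] kN; first by rewrite /cderiv /= subrr mul0r.
by rewrite cderiv_XsubM// subrr mul0r add0r ih// mulr0.
Qed.

(** Three successive divided differences at z. The cubic coefficient q is holomorphic, hence bounded
    near z, which gives the O(h^3) error. *)
Lemma Taylor2 f z : holo_disk f -> cabs z < 1 -> exists b c q, holo_disk q /\
  forall h, f (z + h) = f z + b * h + c * h ^+ 2 + q (z + h) * h ^+ 3.
Proof.
move=> hf z1.
have [q1 hq1 E1] := divided_difference hf z1.
have [q2 hq2 E2] := divided_difference hq1 z1.
have [q3 hq3 E3] := divided_difference hq2 z1.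
exists (q1 z), (q2 z), q3; split; first exact: hq3.
move=> h.
rewrite E1 E2 E3 (addrC z) addrK; ring.
Qed.

End HolomorphicDisk.

(** * Monotonicity of circular means *)

Section MaximumPrinciple.
Variable R : realType.
Local Notation rc x := ((x%:C)%C : CC R).
Implicit Types (z w : CC R) (p e s h : R).

Lemma cpt_continuous : continuous (@cpt R).
Proof.
move=> [x y]; rewrite /continuous_at /cpt /=.
by apply: cvg_Complex; [exact: cvg_fst|exact: cvg_snd].
Qed.

Lemma cabs_powR_continuous p : 0 < p -> continuous (fun z : CC R => cabs z `^ p).
Proof.
move=> p0 z; have [->|z0] := eqVneq z 0; last first.
  apply: (@continuous_comp _ _ _ (@cabs R) (fun x => x `^ p) z (@cabs_continuous R z)).
  apply/differentiable_continuous/derivable1_diffP/derivable_powR.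
  by rewrite in_itv /= andbT cabs_gt0.
apply/(@cvgrPdist_lt _ _ _ (nbhs (0 : CC R))) => e e0; apply/nbhs_CC.
exists (e `^ p^-1); first exact: powR_gt0.
move=> w; rewrite subr0 => we; rewrite cabs0 powR0 ?gt_eqF// sub0r normrN ger0_norm ?powR_ge0//.
have := gt0_ltr_powR p0 (cabs_ge0 w) (powR_ge0 _ _) we.
by rewrite -powRrM mulVf ?gt_eqF// powRr1// ltW.
Qed.

Lemma powR_ge1Dln x p : 0 < x -> 1 + p * ln x <= x `^ p.
Proof. by move=> x0; rewrite /powR gt_eqF//; exact: expR_ge1Dx. Qed.

(* [e^t >= 1 + t] reduces the sum of powers to the logarithm of the product. *)
Lemma sum4_powR_ge (x1 x2 x3 x4 p s : R) : 0 < x1 -> 0 < x2 -> 0 < x3 -> 0 < x4 ->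
  0 < p -> 0 <= s -> s <= 1 / 2 -> 1 - s <= x1 * x2 * x3 * x4 ->
  4 - 2 * p * s <= x1 `^ p + x2 `^ p + x3 `^ p + x4 `^ p.
Proof.
move=> x10 x20 x30 x40 p0 s0 s1 H.
set y := x1 * x2 * x3 * x4 in H.
have y0 : 0 < y by rewrite !mulr_gt0.
have lny : ln y = ln x1 + ln x2 + ln x3 + ln x4 by rewrite /y !lnM ?posrE ?mulr_gt0.
have yge : - (2 * s) <= ln y.
  have h : - ln y <= y^-1 - 1.
    have := @le_ln1Dx R (y^-1 - 1); rewrite (addrC 1) subrK lnV ?posrE//; apply.
    by rewrite ltrBrDr addNr invr_gt0.
  have : y^-1 <= 1 + 2 * s.
    rewrite -div1r ler_pdivrMr// -subr_ge0.
    have -> : (1 + 2 * s) * y - 1 = (1 + 2 * s) * (y - (1 - s)) + s * (1 - 2 * s) by ring.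
    by apply: addr_ge0; apply: mulr_ge0; lra.
  by lra.
have := powR_ge1Dln p x10; have := powR_ge1Dln p x20.
have := powR_ge1Dln p x30; have := powR_ge1Dln p x40.
have : p * (- (2 * s)) <= p * ln y by rewrite ler_pM2l.
rewrite lny !mulrDr; lra.
Qed.

(** Telescoping: the factors are exchanged one at a time, and each exchange costs M^3 e. *)
Lemma mul4_perturb (A B : 'I_4 -> CC R) (M e : R) :
  (forall i, cabs (A i) <= M) -> (forall i, cabs (B i) <= M) ->
  (forall i, cabs (A i - B i) <= e) ->
  cabs (\prod_i A i - \prod_i B i) <= 4 * M ^+ 3 * e.
Proof.
move=> AM BM ABe; have M0 : 0 <= M := le_trans (cabs_ge0 _) (AM 0).
rewrite !big_ord_recl !big_ord0 !mulr1.
set i1 := ord0; set i2 := lift _ _; set i3 := lift _ (lift _ _); set i4 := lift _ (lift _ (lift _ _)).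
have -> : A i1 * (A i2 * (A i3 * A i4)) - B i1 * (B i2 * (B i3 * B i4)) =
  A i2 * A i3 * A i4 * (A i1 - B i1) + B i1 * A i3 * A i4 * (A i2 - B i2) +
  (B i1 * B i2 * A i4 * (A i3 - B i3) + B i1 * B i2 * B i3 * (A i4 - B i4)) by ring.
have H u v w d : cabs u <= M -> cabs v <= M -> cabs w <= M -> cabs d <= e ->
    cabs (u * v * w * d) <= M ^+ 3 * e.
  move=> uM vM wM de; rewrite !cabsM; apply: ler_pM => //; rewrite ?mulr_ge0 ?cabs_ge0//.
  rewrite !exprS expr0 mulr1 mulrA; apply: ler_pM => //; rewrite ?mulr_ge0 ?cabs_ge0//.
  by apply: ler_pM => //; rewrite cabs_ge0.
rewrite (_ : 4 * M ^+ 3 * e = (M ^+ 3 * e + M ^+ 3 * e) + (M ^+ 3 * e + M ^+ 3 * e)); last by ring.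
apply: le_trans (cabsD _ _) _; apply: lerD; (apply: le_trans (cabsD _ _) _; apply: lerD);
  by apply: H.
Qed.

Definition omega4 (i : 'I_4) : CC R := nth 0 [:: 1; 'i%C; -1; - 'i%C] i.

Lemma cabs_omega4 i : cabs (omega4 i) = 1.
Proof.
have ci : cabs ('i%C : CC R) = 1 by rewrite /cabs /= expr0n expr1n /= add0r sqrtr1.
case: i => -[|[|[|[|//]]]] ?; rewrite /omega4 /nth /=.
- exact: cabs1.
- exact: ci.
- exact: (etrans (cabsN _) (@cabs1 R)).
- exact: (etrans (cabsN _) ci).
Qed.

(** Replacing k by i k permutes the factors, so the product is a polynomial in k^4: it differs from
    u^4 by O(k^4), although each single factor differs from u by O(k). *)
Lemma omega4_prod (u b c k : CC R) :
  \prod_i (u + b * (omega4 i * k) + c * (omega4 i * k) ^+ 2) =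
  u ^+ 4 + k ^+ 4 * (2 * u ^+ 2 * c ^+ 2 + c ^+ 4 * k ^+ 4 - (2 * u * c - b ^+ 2) ^+ 2).
Proof.
rewrite !big_ord_recl !big_ord0 !mulr1 /omega4 /=.
have i2 : ('i%C : CC R) ^+ 2 = -1 by exact: sqr_i.
rewrite !mulNr !mul1r !mulrN !sqrrN !exprMn i2.
set i := 'i%C in i2 *.
transitivity (((u + c * k ^+ 2) ^+ 2 - b ^+ 2 * k ^+ 2) *
   ((u - c * k ^+ 2) ^+ 2 - b ^+ 2 * (i ^+ 2 * k ^+ 2))); last by rewrite i2; ring.
ring.
Qed.

(* The product of the four values is G(z)^4 + O(h^3). *)
Lemma sub_mean4 (G : CC R -> CC R) z p : holo_disk G -> cabs z < 1 -> 0 < p ->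
  exists C : R, exists2 d, 0 < d & forall h, 0 < h -> h < d ->
    4 * cabs (G z) `^ p - C * h ^+ 3 <= \sum_i cabs (G (z + omega4 i * rc h)) `^ p.
Proof.
move=> hG z1 p0; have [Gz0|Gz0] := eqVneq (G z) 0.
  exists 0, 1 => // h h0 _; rewrite Gz0 cabs0 powR0 ?gt_eqF// mulr0 mul0r subr0.
  by apply: sumr_ge0 => i _; exact: powR_ge0.
have [b [c [q [hq GT]]]] := Taylor2 hG z1.
have [d1 d10 Hq] := (continuous_CCP _ _).1 (holo_continuous hq z1) 1 ltr01.
set B := cabs (q z) + 1.
set u := cabs (G z); have u0 : 0 < u by rewrite cabs_gt0.
set M := u + cabs b + cabs c + B.
set C1 := 4 * M ^+ 3 * B.
set C2 := 2 * u ^+ 2 * cabs c ^+ 2 + cabs c ^+ 4 + (2 * u * cabs c + cabs b ^+ 2) ^+ 2.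
have B0 : 0 < B by rewrite ltr_wpDl ?cabs_ge0.
have M0 : 0 <= M by move: (cabs_ge0 b) (cabs_ge0 c); rewrite /M; lra.
(* [C1] bounds the effect of the Taylor remainders on the product, [C2] the coefficient of k^4 in
   [omega4_prod] for |k| <= 1; the division by u^4 makes the error relative to G(z)^4. *)
set C := (C1 + C2) / u ^+ 4.
have C20 : 0 <= C2.
  apply: addr_ge0; last exact: sqr_ge0.
  apply: addr_ge0; last by rewrite exprn_ge0// cabs_ge0.
  by apply: mulr_ge0; [apply: mulr_ge0 => //|]; exact: sqr_ge0.
have C10 : 0 <= C1.
  by apply: mulr_ge0; [apply: mulr_ge0 => //; exact: exprn_ge0|exact: ltW].
have C0 : 0 <= C.
  by apply: divr_ge0; [exact: addr_ge0|rewrite exprn_ge0// ltW].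
(* The constant is that of [sum4_powR_ge] with s = C h^3, rescaled by u^p. The radius keeps the
   cubic coefficient below [B], the powers of h below 1, and C h^3 below 1 / 2. *)
exists (u `^ p * (2 * p * C)), (Num.min d1 (Num.min 1 (1 / (2 * (C + 1))))).
  by rewrite !lt_min d10 ltr01 divr_gt0// mulr_gt0// ltr_wpDl.
move=> h h0; rewrite !lt_min => /and3P[hd1 h1 hC].
have ch i : cabs (omega4 i * rc h) = h by rewrite cabsM cabs_omega4 mul1r cabs_real gtr0_norm.
have hn n : h ^+ n <= 1 by rewrite exprn_ile1 ?ltW.
pose A i := G (z + omega4 i * rc h).
pose T i := G z + b * (omega4 i * rc h) + c * (omega4 i * rc h) ^+ 2.
have AT i : cabs (A i - T i) <= B * h ^+ 3.
  rewrite /A /T GT (addrC _ (_ * _ ^+ 3)) addrK cabsM cabsX ch ler_wpM2r ?exprn_ge0 ?(ltW h0)//.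
  have := Hq (z + omega4 i * rc h); rewrite (addrC z) addrK ch => /(_ hd1) /ltW.
  by have := cabs_sub_ge (q (omega4 i * rc h + z)) (q z); rewrite /B; lra.
have TM' i : cabs (T i) <= u + cabs b + cabs c.
  apply: le_trans (cabsD _ _) _; apply: lerD.
    apply: le_trans (cabsD _ _) _; rewrite lerD2l cabsM ch.
    by rewrite ler_piMr ?cabs_ge0// ltW.
  by rewrite cabsM cabsX ch ler_piMr ?cabs_ge0.
have TM i : cabs (T i) <= M by apply: le_trans (TM' i) _; rewrite /M lerDl ltW.
have AM i : cabs (A i) <= M.
  have := cabsD (A i - T i) (T i); rewrite subrK => /le_trans; apply.
  rewrite /M addrC; apply: lerD => //; apply: le_trans (AT i) _.
  by rewrite ler_piMr ?(ltW B0).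
have PP : cabs (\prod_i A i - G z ^+ 4) <= (C1 + C2) * h ^+ 3.
  have -> : \prod_i A i - G z ^+ 4 = (\prod_i A i - \prod_i T i) + (\prod_i T i - G z ^+ 4) by ring.
  apply: le_trans (cabsD _ _) _; rewrite mulrDl; apply: lerD.
    by have := mul4_perturb AM TM AT; rewrite mulrA.
  rewrite /T omega4_prod (addrC (G z ^+ 4)) addrK cabsM cabsX cabs_real gtr0_norm// mulrC.
  have h3 : 0 <= h ^+ 3 by rewrite exprn_ge0 ?ltW.
  apply: ler_pM; rewrite ?cabs_ge0 ?exprn_ge0 ?(ltW h0)//; last first.
    by rewrite exprS ler_piMl// ltW.
  have c2 : cabs (2 : CC R) = 2 by rewrite (_ : 2 = rc 2) ?cabs_real ?ger0_norm// rmorph_nat.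
  apply: le_trans (cabsB _ _) _; apply: lerD; last first.
    rewrite cabsX; apply: lerXn2r; rewrite ?nnegrE ?cabs_ge0//.
      by apply: addr_ge0; [apply: mulr_ge0; rewrite ?cabs_ge0// mulr_ge0// ltW|exact: sqr_ge0].
    by apply: le_trans (cabsB _ _) _; rewrite (cabsM _ c) (cabsM 2) cabsX c2.
  apply: le_trans (cabsD _ _) _; apply: lerD.
    by rewrite (cabsM _ (c ^+ 2)) (cabsM 2) !cabsX c2.
  by rewrite (cabsM _ (rc h ^+ 4)) !cabsX cabs_real gtr0_norm// ler_piMr ?exprn_ge0 ?cabs_ge0.
have Ch : C * h ^+ 3 <= 1 / 2.
  have : C * h <= 1 / 2.
    move: hC; rewrite ltr_pdivlMr ?mulr_gt0 ?ltr_wpDl//; lra.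
  apply: le_trans; rewrite ler_wpM2l// exprS ler_piMr ?(ltW h0)//.
have Prod : 1 - C * h ^+ 3 <= cabs (\prod_i A i) / u ^+ 4.
  rewrite ler_pdivlMr ?exprn_gt0// mulrBl mul1r.
  have CE : C * h ^+ 3 * u ^+ 4 = (C1 + C2) * h ^+ 3.
    by rewrite mulrAC divfK// expf_neq0// gt_eqF.
  rewrite CE.
  have := cabs_sub_ge (G z ^+ 4) (G z ^+ 4 - \prod_i A i).
  rewrite subKr cabsX (cabs_distC (G z ^+ 4)) -/u; move: PP; lra.
(* No value vanishes, since the normalised product is at least 1 - C h^3 >= 1 / 2. *)
have A0 i : 0 < cabs (A i) / u.
  rewrite divr_gt0// cabs_gt0; apply/negP => /eqP Ai0.
  by move: Prod; rewrite (bigD1 i)//= Ai0 mul0r cabs0 mul0r; lra.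
have Ch0 : 0 <= C * h ^+ 3 by rewrite mulr_ge0// exprn_ge0// ltW.
have := @sum4_powR_ge _ _ _ _ p (C * h ^+ 3) (A0 ord0) (A0 (lift ord0 ord0))
  (A0 (lift ord0 (lift ord0 ord0))) (A0 (lift ord0 (lift ord0 (lift ord0 ord0)))) p0 Ch0 Ch.
have -> : cabs (A ord0) / u * (cabs (A (lift ord0 ord0)) / u) *
   (cabs (A (lift ord0 (lift ord0 ord0))) / u) *
   (cabs (A (lift ord0 (lift ord0 (lift ord0 ord0)))) / u) = cabs (\prod_i A i) / u ^+ 4.
  rewrite !big_ord_recl big_ord0 mulr1 !cabsM; field; exact: lt0r_neq0.
move=> /(_ Prod) H.
have powA i : cabs (A i) `^ p = u `^ p * (cabs (A i) / u) `^ p.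
  by rewrite -powRM ?(ltW u0) ?(ltW (A0 i))// mulrC divfK// gt_eqF.
have -> : \sum_i cabs (G (z + omega4 i * rc h)) `^ p = u `^ p * (
  (cabs (A ord0) / u) `^ p + (cabs (A (lift ord0 ord0)) / u) `^ p +
  (cabs (A (lift ord0 (lift ord0 ord0))) / u) `^ p +
  (cabs (A (lift ord0 (lift ord0 (lift ord0 ord0)))) / u) `^ p).
  under eq_bigr do rewrite -/(A _) powA.
  by rewrite -mulr_sumr !big_ord_recl big_ord0 addr0 !addrA.
rewrite (_ : _ - _ = u `^ p * (4 - 2 * p * (C * h ^+ 3))); last by ring.
by rewrite ler_pM2l ?powR_gt0.
Qed.

End MaximumPrinciple.

Section SubmeanFunctions.
Variable R : realType.
Local Notation rc x := ((x%:C)%C : CC R).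
Local Notation mu := (@lebesgue_measure R).
Implicit Types (z w : CC R) (p e s h r t : R) (v U : CC R -> R).

(* The O(h^3) error is beaten by the gain of order h^2 obtained from adding e |z|^2. *)
Definition submean4 U z := exists C : R, exists2 d, 0 < d & forall h, 0 < h -> h < d ->
  4 * U z - C * h ^+ 3 <= \sum_i U (z + omega4 R i * rc h).

Lemma submean4D U v z : submean4 U z -> submean4 v z -> submean4 (fun w => U w + v w) z.
Proof.
move=> [C [d d0 H]] [C' [d' d'0 H']]; exists (C + C'), (Num.min d d').
  by rewrite lt_min d0.
move=> h h0; rewrite lt_min => /andP[hd hd'].
by have := H h h0 hd; have := H' h h0 hd'; rewrite big_split /=; lra.
Qed.

Lemma submean4_sum n (F : nat -> CC R -> R) z : (forall k, submean4 (F k) z) ->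
  submean4 (fun w => \sum_(k < n) F k w) z.
Proof.
move=> H; elim: n => [|n ih].
  exists 0, 1 => // h _ _; rewrite big_ord0 mulr0 mul0r subr0.
  by apply: sumr_ge0 => i _; rewrite big_ord0.
have -> : (fun w => \sum_(k < n.+1) F k w) = (fun w => \sum_(k < n) F k w + F n w).
  by apply/funext => w; rewrite big_ord_recr.
exact: submean4D.
Qed.

Lemma sum_omega4_sqr z h : \sum_i cabs (z + omega4 R i * rc h) ^+ 2 = 4 * cabs z ^+ 2 + 4 * h ^+ 2.
Proof.
rewrite !big_ord_recl big_ord0 /omega4 /= !cabs_sqr; case: z => x y /=; ring.
Qed.

Lemma closed_disk_compact s : compact [set xy : R * R | cabs (cpt xy) <= s].
Proof.
apply: (@subclosed_compact _ _ (`[-s, s]%classic `*` `[-s, s]%classic)).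
- apply: (@closed_comp _ _ (fun xy : R * R => cabs (cpt xy)) [set x | x <= s]); last exact: closed_le.
  by move=> xy _; apply: (continuous_comp (@cpt_continuous R xy)); exact: cabs_continuous.
- by apply: compact_setX; exact: segment_compact.
move=> [x y] /= H; split; rewrite /= in_itv /= -ler_norml; apply: le_trans H.
- exact: (Re_le_cabs (cpt (x, y))).
- exact: (Im_le_cabs (cpt (x, y))).
Qed.

Lemma maximum_principle v s B : 0 <= s -> s < 1 ->
  (forall z, cabs z < 1 -> {for z, continuous v}) ->
  (forall z, cabs z < 1 -> submean4 v z) ->
  (forall z, cabs z = s -> v z <= B) -> forall z, cabs z <= s -> v z <= B.
Proof.
move=> s0 s1 cv sv vB z1 z1s; rewrite leNgt; apply/negP => Bv.
(* As |z| <= 1, the term e |z|^2 raises the boundary values by at most half of the excess of v at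
   [z1], so the maximum of [ve] is attained inside. *)
pose e := (v z1 - B) / 2; have e0 : 0 < e by rewrite divr_gt0// subr_gt0.
pose ve z := v z + e * cabs z ^+ 2.
have [||[x y] /set_mem xys H] := @compact_EVT_max _ R (fun xy => ve (cpt xy)) _ _ (@closed_disk_compact s).
- by exists (complex.Re z1, complex.Im z1) => /=; rewrite /cpt /=; case: z1 z1s {Bv e e0 ve}.
- apply: continuous_in_subspaceT => xy /set_mem xys; have {}xys : cabs (cpt xy) <= s := xys.
  apply: (@continuous_comp _ _ _ (@cpt R) ve xy (@cpt_continuous R xy)).
  have c1 : {for cpt xy, continuous v} := cv _ (le_lt_trans xys s1).
  have c2 : {for cpt xy, continuous (fun z : CC R => cabs z * cabs z)}.
    exact: (cvgM (@cabs_continuous R _) (@cabs_continuous R _)).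
  exact: (cvgD c1 (cvgM (cvg_cst e) c2)).
have {}H z : cabs z <= s -> ve z <= ve (cpt (x, y)).
  case: z => a b abs; have := H (a, b); apply; exact/mem_set.
have {}xys : cabs (cpt (x, y)) <= s := xys.
set zm := cpt (x, y) in xys H.
have sq1 z : cabs z <= s -> cabs z ^+ 2 <= 1.
  by move=> zs; rewrite expr_le1 ?cabs_ge0// (le_trans zs)// ltW.
have zms : cabs zm < s.
  rewrite lt_neqAle xys andbT; apply/negP => /eqP zms.
  have := H _ z1s; rewrite /ve.
  have := vB _ zms; have := ler_wpM2l (ltW e0) (sq1 _ xys).
  have := mulr_ge0 (ltW e0) (sqr_ge0 (cabs z1)); rewrite /e; lra.
have [C [d d0 HC]] := sv zm (lt_trans zms s1).
(* The last bound gives C h^3 <= e h^2, while the four-point sum of e |z|^2 gains 4 e h^2: this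
   contradicts maximality at [zm]. *)
pose h := Num.min (d / 2) (Num.min (s - cabs zm) (e / (`|C| + 1))).
have C0 : 0 < `|C| + 1 by rewrite ltr_wpDl.
have h0 : 0 < h.
  by rewrite !lt_min; apply/and3P; split; [rewrite divr_gt0|rewrite subr_gt0|rewrite divr_gt0].
have hd : h < d by rewrite gt_min; apply/orP; left; lra.
have hs : h <= s - cabs zm by rewrite /h !ge_min lexx orbT.
have he : h * (`|C| + 1) <= e by rewrite -ler_pdivlMr// /h !ge_min lexx !orbT.
have := HC h h0 hd.
have zhs i : cabs (zm + omega4 R i * rc h) <= s.
  apply: le_trans (cabsD _ _) _; rewrite cabsM cabs_omega4 mul1r cabs_real gtr0_norm//; lra.
have : \sum_i ve (zm + omega4 R i * rc h) <= 4 * ve zm.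
  apply: le_trans (ler_sum _ (fun i _ => H _ (zhs i))) _.
  by rewrite sumr_const card_ord mulr_natl lexx.
rewrite {1}/ve big_split /= -mulr_sumr sum_omega4_sqr /ve.
have h2 : 0 < h ^+ 2 by rewrite exprn_gt0.
have : C * h ^+ 3 <= e * h ^+ 2.
  rewrite exprS mulrA ler_pM2r//; apply: le_trans he; rewrite mulrC ler_pM2l//.
  by apply: le_trans (ler_norm C) _; rewrite lerDl.
have : 0 < e * h ^+ 2 by rewrite mulr_gt0.
set x1 := e * h ^+ 2; set x2 := cabs zm ^+ 2.
rewrite (_ : e * (4 * x2 + 4 * h ^+ 2) = 4 * (e * x2) + 4 * x1); last by rewrite /x1; ring.
by clear; lra.
Qed.

Lemma uniform_continuity (F : R -> R) (a b e : R) : continuous F -> 0 < e ->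
  exists2 d, 0 < d & forall x y, a <= x <= b -> `|y - x| < d -> `|F y - F x| < e.
Proof.
move=> cF e0.
pose P (d : R) (x : R) := forall y, `|y - x| < d -> `|F y - F x| < e.
have : \forall d \near 0^'+, `[a, b]%classic `<=` P d.
  have /compact_near_coveringP := @segment_compact R a b; apply => x _.
  have e20 : 0 < e / 2 by rewrite divr_gt0.
  have [d /= d0 H] := (nbhs_ballP x _).1 ((@cvgrPdist_lt _ _ _ (nbhs x) _ F (F x)).1 (cF x) _ e20).
  exists (ball x (d / 2), [set u | 0 < u < d / 2]).
    split; first by apply: nbhsx_ballx; rewrite divr_gt0.
    apply: filterS (_ : \forall u \near 0^'+, 0 < u < d / 2) => //.
    near=> u; apply/andP; split; near: u; [exact: nbhs_right_gt|apply: nbhs_right_lt].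
    by rewrite divr_gt0.
  move=> [x' u] /= [xx' /andP[u0 ud]] y yx'.
  have h1 := H x'; have h2 := H y.
  have {}h1 : `|F x - F x'| < e / 2.
    by apply: h1; rewrite /ball /=; move: xx'; rewrite /ball /=; lra.
  have {}h2 : `|F x - F y| < e / 2.
    apply: h2; move: xx'; rewrite /ball /= => xx'.
    have := ler_normD (x - x') (x' - y); rewrite addrA subrK (distrC x' y); lra.
  have := ler_normD (F y - F x) (F x - F x'); rewrite addrA subrK (distrC (F y) (F x)); lra.
move=> [d /= d0 H]; exists (d / 2); first by rewrite divr_gt0.
move=> x y xab yx; apply: (H (d / 2)) => //=.
- by rewrite sub0r normrN gtr0_norm ?divr_gt0//; lra.
- by rewrite divr_gt0.
Unshelve. all: by end_near. Qed.

(** One bound for all offsets [phi] of the sample points within their cells: the rotational average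
    has to be compared with the mean at every point of a circle. *)
Lemma Riemann_sum_dist (F : R -> R) (a L phi e : R) (n : nat) : continuous F ->
  0 <= phi <= L ->
  (forall x y, a <= x <= a + n%:R * L -> `|y - x| <= L -> `|F y - F x| <= e) ->
  `|\int[mu]_(t in `[a, a + n%:R * L]) F t - L * \sum_(k < n) F (a + phi + k%:R * L)| <= n%:R * L * e.
Proof.
move=> cF /andP[phi0 phiL] FH; have L0 : 0 <= L := le_trans phi0 phiL.
suff : forall m, (m <= n)%N ->
  `|\int[mu]_(t in `[a, a + m%:R * L]) F t - L * \sum_(k < m) F (a + phi + k%:R * L)| <= m%:R * L * e.
  by apply.
elim => [|m ih] mn.
  by rewrite big_ord0 mulr0 !mul0r addr0 set_itv1 Rintegral_set1 subrr normr0.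
have am : a <= a + m%:R * L by rewrite lerDl mulr_ge0.
have mm : a + m%:R * L <= a + m.+1%:R * L by rewrite lerD2l ler_wpM2r// ler_nat.
have mnL : a + m.+1%:R * L <= a + n%:R * L by rewrite lerD2l ler_wpM2r// ler_nat.
rewrite (@cont_on_Rint_split _ _ _ _ (a + m%:R * L)) ?am//; last exact: cont_onT.
have m1 : a + m.+1%:R * L = a + m%:R * L + L by rewrite -natr1 mulrDl mul1r addrA.
have -> : m.+1%:R * L * e = m%:R * L * e + L * e by rewrite -natr1; ring.
rewrite m1 big_ord_recr /= mulrDr opprD addrACA.
apply: le_trans (ler_normD _ _) _; apply: lerD; first exact/ih/ltnW.
have LE : a + m%:R * L + L - (a + m%:R * L) = L by rewrite addrC addKr.
have -> : L * F (a + phi + m%:R * L) =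
    \int[mu]_(t in `[a + m%:R * L, a + m%:R * L + L]) (F (a + phi + m%:R * L)).
  by rewrite Rint_cst ?LE 1?mulrC// lerDl.
rewrite -RintegralB//; last 2 first.
- by apply: cont_on_integrable; exact: cont_onT.
- by apply: cont_on_integrable; exact: cont_on_cst.
have := @cont_on_Rint_le _ (fun t => F t - F (a + phi + m%:R * L)) e (a + m%:R * L) (a + m%:R * L + L).
rewrite LE (mulrC e L); apply; first by rewrite lerDl.
  by move=> x _; apply: cvgB; [exact: cF|exact: cvg_cst].
move=> x /andP[x1 x2]; apply: FH; first by apply/andP; split; lra.
by rewrite ler_norml; apply/andP; split; lra.
Qed.

End SubmeanFunctions.

Section CircularMeans.
Variable R : realType.
Local Notation rc x := ((x%:C)%C : CC R).
Local Notation mu := (@lebesgue_measure R).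
Implicit Types (z w : CC R) (p e s h r t : R).

(** Replacing z by -z if needed makes the real part nonnegative; the angle is then the arcsine of Im
    z / s. *)
Lemma polar_half s z : 0 < s -> cabs z = s ->
  exists t, 0 <= t <= pi /\ (z = circ s (- (pi / 2) + t) \/ z = - circ s (- (pi / 2) + t)).
Proof.
move=> s0; wlog x0 : z / 0 <= complex.Re z => [H zs|].
  have [x0|x0] := leP 0 (complex.Re z); first exact: H.
  have [|t [t0 tz]] := H (- z) _ (etrans (cabsN z) zs).
    by case: z x0 {zs} => x y /= x0; rewrite oppr_ge0 ltW.
  exists t; split=> //; case: tz => E; first by right; rewrite -E opprK.
  by left; apply: oppr_inj.
case: z x0 => x y x0 zs; rewrite /= in x0.
have xys : x ^+ 2 + y ^+ 2 = s ^+ 2 by rewrite -zs cabs_sqr.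
have ys : -1 <= y / s <= 1.
  rewrite -ler_norml normrM normfV (gtr0_norm s0) ler_pdivrMr// mul1r.
  rewrite -(ler_pXn2r (ltn0Sn 1)) ?nnegrE ?(ltW s0)// real_normK ?num_real// -xys lerDr; exact: sqr_ge0.
exists (asin (y / s) + pi / 2); split.
  have := asin_geNpi2 ys; have := asin_lepi2 ys; move=> h1 h2; apply/andP; split; lra.
left; rewrite (_ : - (pi / 2) + _ = asin (y / s)); last by ring.
rewrite /circ /cis asinK ?in_itv// cos_asin//.
have -> : Num.sqrt (1 - (y / s) ^+ 2) = x / s.
  have -> : 1 - (y / s) ^+ 2 = (x / s) ^+ 2.
    rewrite !expr_div_n -[1](divff (_ : s ^+ 2 != 0)) ?expf_neq0 ?gt_eqF// -mulrBl -xys; congr (_ / _); ring.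
  by rewrite sqrtr_sqr ger0_norm// divr_ge0// (ltW s0).
by rewrite [RHS]/GRing.mul /=; congr Complex; field; rewrite gt_eqF.
Qed.

Variables (G : CC R -> CC R) (p : R).
Hypotheses (hG : holo_disk G) (p0 : 0 < p).

(** Symmetrisation makes the function even, so that angles matter only modulo pi and a half circle
    carries the whole mean. *)
Let U z := cabs (G z) `^ p + cabs (G (- z)) `^ p.

(* A half circle together with its opposite; the angles of the half circle are those of
   the polar substitution y / x = tan t. *)
Definition circle_mean r := \int[mu]_(t in `[- (pi / 2), pi / 2])
  (cabs (G (circ r t)) `^ p + cabs (G (- circ r t)) `^ p).

Let powG_continuous (w : CC R) z : cabs w = 1 -> cabs z < 1 ->
  {for z, continuous (fun z => cabs (G (z * w)) `^ p)}.
Proof.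
move=> w1 z1; have zw1 : cabs (z * w) < 1 by rewrite cabsM w1 mulr1.
have c1 : {for z, continuous (fun z => z * w : CC R)}.
  exact: (holo_continuous (holoM (@holo_id R) (@holo_cst R w)) z1).
have c2 : {for z, continuous (fun z => G (z * w))}.
  exact: (@continuous_comp _ _ _ (fun z => z * w : CC R) G z c1 (holo_continuous hG zw1)).
have c3 : {for G (z * w), continuous (fun u : CC R => cabs u `^ p)} := @cabs_powR_continuous R p p0 _.
exact: (@continuous_comp _ _ _ (fun z => G (z * w)) (fun u : CC R => cabs u `^ p) z c2 c3).
Qed.

Let powG_submean (w : CC R) z : cabs w = 1 -> cabs z < 1 ->
  submean4 (fun z => cabs (G (z * w)) `^ p) z.
Proof.
move=> w1 z1.
have hGw : holo_disk (fun z => G (z * w)).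
  apply: (@holo_comp R (fun z => z * w) G); last exact: hG.
    by move=> v v1; rewrite cabsM w1 mulr1.
  exact: (holoM (@holo_id R) (@holo_cst R w)).
exact: (sub_mean4 hGw z1 p0).
Qed.

Let U_rot (w : CC R) z : cabs w = 1 -> cabs z < 1 ->
  {for z, continuous (fun z => U (z * w))} /\ submean4 (fun z => U (z * w)) z.
Proof.
move=> w1 z1; have w1' : cabs (- w) = 1 by rewrite cabsN.
have UE : (fun z => U (z * w)) = (fun z => cabs (G (z * w)) `^ p + cabs (G (z * - w)) `^ p).
  by apply/funext => v; rewrite /U mulrN.
rewrite UE; split; first exact: (cvgD (powG_continuous w1 z1) (powG_continuous w1' z1)).
exact: (submean4D (powG_submean w1 z1) (powG_submean w1' z1)).
Qed.

Let UN z : U (- z) = U z.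
Proof. by rewrite /U opprK addrC. Qed.

Lemma circle_continuous r : 0 <= r -> r < 1 ->
  continuous (fun t => cabs (G (circ r t)) `^ p + cabs (G (- circ r t)) `^ p).
Proof.
move=> r0 r1 t; have c1 : cabs (1 : CC R) = 1 by exact: cabs1.
have ct : cabs (circ r t) < 1 by rewrite cabs_circ.
have [cU _] := U_rot c1 ct.
have cU' : {for circ r t, continuous U}.
  by move: cU; rewrite (_ : (fun z => U (z * 1)) = U)//; apply/funext => z; rewrite mulr1.
exact: (@continuous_comp _ _ _ (circ r) U t (@circ_continuous R r t) cU').
Qed.

(* Invariant under the rotation of angle pi / n, hence almost constant on circles: the
   maximum principle for v then compares the means over two circles. *)
Let v (n : nat) z := \sum_(k < n) U (z * cis (k%:R * (pi / n%:R))).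

Let v_continuous n z : cabs z < 1 -> {for z, continuous (v n)}.
Proof.
move=> z1; rewrite /v; move: (pi / n%:R) => L; elim: n => [|n ih].
  have -> : (fun w : CC R => \sum_(k < 0) U (w * cis (k%:R * L))) = cst 0.
    by apply/funext => w; rewrite big_ord0.
  exact: cst_continuous.
have -> : (fun w : CC R => \sum_(k < n.+1) U (w * cis (k%:R * L))) =
    (fun w => \sum_(k < n) U (w * cis (k%:R * L)) + U (w * cis (n%:R * L))).
  by apply/funext => w; rewrite big_ord_recr.
exact: (cvgD ih (proj1 (U_rot (cabs_cis _) z1))).
Qed.

Let v_submean n z : cabs z < 1 -> submean4 (v n) z.
Proof.
move=> z1; apply: (@submean4_sum R n (fun k w => U (w * cis (k%:R * (pi / n%:R))))) => k.
exact: (proj2 (U_rot (cabs_cis _) z1)).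
Qed.

(** A rotation by pi / n shifts the summands by one; the last wraps round to the first because
    rotation by pi is z -> -z and [U] is even. *)
Let v_rot n z j : (0 < n)%N -> v n (z * cis (j%:R * (pi / n%:R))) = v n z.
Proof.
move=> n0; elim: j z => [|j ih] z.
  by rewrite mul0r /cis cos0 sin0 (_ : Complex 1 0 = 1 :> CC R)// mulr1.
rewrite -natr1 mulrDl mul1r cisD mulrA mulrAC ih /v.
pose f k := U (z * cis (k%:R * (pi / n%:R))).
have fn : f n = f 0%N.
  rewrite /f mul0r; have -> : n%:R * (pi / n%:R) = 0 + pi :> R.
    by rewrite add0r mulrC divfK// pnatr_eq0 -lt0n.
  by rewrite cisDpi mulrN UN.
transitivity (\sum_(k < n) f k.+1).
  apply: eq_bigr => k _; rewrite /f -mulrA -cisD; congr (U (z * cis _)).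
  by rewrite -[in RHS](natr1 k) [in RHS]mulrDl mul1r addrC.
apply: (@addrI _ (f 0%N)); rewrite -[LHS](big_ord_recl n f).
by rewrite big_ord_recr /= fn addrC.
Qed.

Lemma circle_mean_le r s : 0 <= r -> r <= s -> s < 1 -> circle_mean r <= circle_mean s.
Proof.
move=> r0; rewrite le_eqVlt => /predU1P[->//|rs] s1.
have s0 : 0 < s := le_lt_trans r0 rs.
have r1 := lt_trans rs s1.
have pi0 : 0 < pi :> R := pi_gt0 R.
apply/ler_addgt0Pl => e e0.
(* Each of the two Riemann sums, one per circle, costs pi e1. *)
pose e1 := e / (2 * pi); have e10 : 0 < e1 by rewrite divr_gt0// mulr_gt0.
have [d d0 Hd] := uniform_continuity (- (pi / 2)) (pi / 2) (circle_continuous r0 r1) e10.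
have [d' d'0 Hd'] := uniform_continuity (- (pi / 2)) (pi / 2) (circle_continuous (ltW s0) s1) e10.
pose n := (Num.truncn (pi / d) + Num.truncn (pi / d')).+1.
have n0 : 0 < n%:R :> R by rewrite ltr0n.
pose L : R := pi / n%:R; have L0 : 0 < L by rewrite divr_gt0.
have nL : n%:R * L = pi by rewrite /L mulrC divfK// gt_eqF.
have Ld : L < d.
  rewrite /L ltr_pdivrMr// mulrC -ltr_pdivrMr//; apply: lt_le_trans (truncnS_gt _) _.
  by rewrite ler_nat ltnS leq_addr.
have Ld' : L < d'.
  rewrite /L ltr_pdivrMr// mulrC -ltr_pdivrMr//; apply: lt_le_trans (truncnS_gt _) _.
  by rewrite ler_nat ltnS leq_addl.
have aE : - (pi / 2) + n%:R * L = pi / 2 by rewrite nL; lra.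
have vE q phi : v n (circ q (- (pi / 2) + phi)) =
    \sum_(k < n) U (circ q (- (pi / 2) + phi + k%:R * L)).
  by apply: eq_bigr => k _; rewrite /circ -mulrA -cisD.
have Hr : circle_mean r <= L * v n (circ r (- (pi / 2) + 0)) + pi * e1.
  have := @Riemann_sum_dist R (fun t => U (circ r t)) (- (pi / 2)) L 0 e1 n (circle_continuous r0 r1).
  rewrite lexx (ltW L0) aE nL => /(_ isT) H.
  have {}H := H (fun x y xab yx => ltW (Hd x y xab (le_lt_trans yx Ld))).
  by move: H; rewrite vE ler_norml => /andP[_]; rewrite /circle_mean -/U; lra.
have Hs phi : 0 <= phi <= L -> L * v n (circ s (- (pi / 2) + phi)) <= circle_mean s + pi * e1.
  move=> phiL.
  have := @Riemann_sum_dist R (fun t => U (circ s t)) (- (pi / 2)) L phi e1 n (circle_continuous (ltW s0) s1).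
  rewrite phiL aE nL => /(_ isT) H.
  have {}H := H (fun x y xab yx => ltW (Hd' x y xab (le_lt_trans yx Ld'))).
  by move: H; rewrite vE ler_norml => /andP[+ _]; rewrite /circle_mean -/U; lra.
have vs z : cabs z = s -> v n z <= (circle_mean s + pi * e1) / L.
  move=> zs; have [t [/andP[t0 tpi] zt]] := polar_half s0 zs.
  have -> : v n z = v n (circ s (- (pi / 2) + t)).
    case: zt => -> //; rewrite /v; apply: eq_bigr => k _.
    by rewrite mulNr UN.
  (* Rotating back by j steps brings the angle into the first cell, where [Hs] applies; [v n] does
     not change. *)
  pose j := Num.truncn (t / L).
  have /andP[j1 j2] := truncn_itv (divr_ge0 t0 (ltW L0)).
  rewrite -/j ler_pdivlMr// in j1; rewrite -/j ltr_pdivrMr// -natr1 mulrDl mul1r in j2.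
  have -> : circ s (- (pi / 2) + t) = circ s (- (pi / 2) + (t - j%:R * L)) * cis (j%:R * (pi / n%:R)).
    rewrite /circ -mulrA -cisD; congr (_ * cis _); rewrite -/L; ring.
  rewrite v_rot// ler_pdivlMr// mulrC; apply: Hs; apply/andP; split; lra.
have vle : v n (circ r (- (pi / 2) + 0)) <= (circle_mean s + pi * e1) / L.
  apply: (@maximum_principle R (v n) s) => //; first exact: ltW.
  - by move=> z z1; exact: v_continuous.
  - by move=> z z1; exact: v_submean.
  - by rewrite cabs_circ// ltW.
apply: le_trans Hr _; move: vle; rewrite ler_pdivlMr// mulrC => vle.
have : 2 * (pi * e1) = e.
  by rewrite mulrA [2 * pi * _]mulrC /e1 divfK// gt_eqF// mulr_gt0.
by move: vle; set x := L * _; lra.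
Qed.

End CircularMeans.

(** * Changes of variables in the plane *)

Section WeightedPushforward.
Local Open Scope ereal_scope.
Variable R : realType.
Local Notation mu := (@lebesgue_measure R).
Local Notation MR := (measurableTypeR R).
Variables (phi w : R -> R).
Hypotheses (mphi : measurable_fun setT phi) (mw : measurable_fun setT w).
Hypothesis w0 : forall x, (0 <= w x)%R.

Let mphi' : measurable_fun (setT : set MR) (phi : MR -> MR).
Proof. exact: mphi. Qed.

Let mw' : measurable_fun (setT : set MR) (w : MR -> R).
Proof. exact: mw. Qed.

(** The image under [phi] of the measure with density [w]. A substitution formula then becomes an
    equality of two measures. *)
Definition wpush (A : set (measurableTypeR R)) : \bar R := \int[mu]_(t in phi @^-1` A) (w t)%:E.

Let mpre (A : set (measurableTypeR R)) : measurable A -> measurable (phi @^-1` A).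
Proof. by move=> mA; rewrite -[_ @^-1` _]setTI; exact: mphi. Qed.

Let wpush0 : wpush set0 = 0.
Proof. by rewrite /wpush preimage_set0 integral_set0. Qed.

Let wpush_ge0 A : 0 <= wpush A.
Proof. by apply: integral_ge0 => x _; rewrite lee_fin. Qed.

Let wpush_sigma_additive : semi_sigma_additive wpush.
Proof.
move=> /= F mF tF mUF; rewrite /wpush; apply: cvg_toP.
  apply: ereal_nondecreasing_is_cvgn => m n mn.
  by apply: lee_sum_nneg_natr => // k _ _; apply: integral_ge0 => /= x _; rewrite lee_fin.
rewrite preimage_bigcup ge0_integral_bigcup//=.
- by move=> k; exact: mpre.
- exact/measurable_funTS/measurable_EFinP.
- by move=> x _; rewrite lee_fin.
- apply/trivIsetP => i j _ _ ij; rewrite -preimage_setI.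
  by rewrite (trivIsetP.1 tF i j)// preimage_set0.
Qed.

HB.instance Definition _ := isMeasure.Build _ _ _
  wpush wpush0 wpush_ge0 wpush_sigma_additive.

Import HBNNSimple.

(** By definition for indicators, by linearity for simple functions, and by monotone convergence
    along [nnsfun_approx] in general. *)
Lemma integral_wpush (h : R -> \bar R) : measurable_fun setT h -> (forall x, 0 <= h x) ->
  \int[wpush]_x h x = \int[mu]_x (h (phi x) * (w x)%:E).
Proof.
move=> mh h0; have mh' : measurable_fun (setT : set MR) h by exact: mh.
pose f_ := nnsfun_approx measurableT mh'.
have f_phi n : measurable_fun (setT : set MR) (fun x : MR => f_ n (phi x)).
  exact: (measurableT_comp (measurable_funP (f_ n)) mphi').
have mfib n r : measurable ((phi @^-1` (f_ n @^-1` [set r])) : set MR).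
  apply: mpre; have := measurable_funP (f_ n) measurableT _ (measurable_set1 r).
  by rewrite setTI.
have mind n r : measurable_fun (setT : set MR)
    (fun x : MR => \1_(phi @^-1` (f_ n @^-1` [set r])) x * w x : R)%R.
  by apply: measurable_funM => //; exact: measurable_indic (mfib n r).
transitivity (limn (fun n => \int[wpush]_x (f_ n x)%:E)).
  rewrite -monotone_convergence//.
  - by apply: eq_integral => y _; apply/esym/cvg_lim => //; exact: cvg_nnsfun_approx.
  - by move=> n; exact/measurable_EFinP/measurable_funP.
  - by move=> n y _; rewrite lee_fin.
  - by move=> y _ m n mn; rewrite lee_fin; exact/lefP/nd_nnsfun_approx.
rewrite [X in limn X](_ : _ = (fun n => \int[mu]_x ((f_ n (phi x) * w x)%:E))); last first.
  apply/funext => n.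
  transitivity (\sum_(k \in range (f_ n)) \int[mu]_x (k * (\1_(phi @^-1` (f_ n @^-1` [set k])) x * w x))%:E).
    under eq_integral do rewrite fimfunE -fsumEFin//.
    rewrite ge0_integral_fsum//; last 2 first.
    - by move=> y; exact/measurable_EFinP/measurable_funM.
    - by move=> y x _; rewrite nnfun_muleindic_ge0.
    apply: eq_fsbigr => r /[!inE] -[x _ fx].
    have r0 : (0 <= r)%R by rewrite -fx.
    rewrite integralZl_indic_nnsfun// integral_indic// setIT.
    under [RHS]eq_integral do rewrite EFinM.
    rewrite ge0_integralZl//; last 2 first.
    - exact: ((measurable_EFinP _ _).2 (mind n r)).
    - by move=> y _; rewrite lee_fin mulr_ge0.
    congr (_ * _); rewrite [LHS]/= /wpush [LHS]integral_mkcond; apply: eq_integral => y _.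
    rewrite patchE indicE; case: ifPn => _; first by rewrite mul1r.
    by rewrite mul0r.
  rewrite -ge0_integral_fsum//.
  - apply: eq_integral => x _; rewrite fsumEFin//; congr EFin.
    rewrite [in RHS]fimfunE mulr_fsuml; apply: eq_fsbigr => r _.
    by rewrite mulrA.
  - move=> r; have h1 : measurable_fun (setT : set MR)
      (fun x : MR => r * (\1_(phi @^-1` (f_ n @^-1` [set r])) x * w x) : R)%R.
      by apply: measurable_funM => //; exact: mind.
    exact: ((measurable_EFinP _ _).2 h1).
  - move=> r x _; rewrite mulrA EFinM mule_ge0 ?lee_fin//.
    by have := nnfun_muleindic_ge0 (f_ n) r (phi x); rewrite lee_fin.
rewrite -monotone_convergence//.
- apply: eq_integral => y _; apply/cvg_lim => //.
  rewrite (_ : (fun n => (f_ n (phi y) * w y)%:E) = (fun n => (w y)%:E * (f_ n (phi y))%:E)); last first.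
    by apply/funext => n; rewrite muleC.
  rewrite muleC; apply: cvgeZl => //.
  exact: cvg_nnsfun_approx.
- by move=> n; exact/measurable_EFinP/measurable_funM.
- by move=> n y _; rewrite lee_fin mulr_ge0.
- move=> y _ m n mn; rewrite lee_fin ler_wpM2r//.
  by have /lefP := nd_nnsfun_approx measurableT mh' mn; apply.
Qed.

End WeightedPushforward.

Section LineSubstitution.
Local Open Scope ereal_scope.
Variable R : realType.
Local Notation mu := (@lebesgue_measure R).

(** Always over the whole line. A map living on an interval is extended with density 0, so its
    values elsewhere contribute nothing; this makes substitutions composable. *)
Definition line_subst (phi w : R -> R) := [/\ measurable_fun setT phi, measurable_fun setT w,
  (forall x, (0 <= w x)%R) & forall h : R -> \bar R, measurable_fun setT h ->
  (forall x, 0 <= h x) -> \int[mu]_x h x = \int[mu]_x (h (phi x) * (w x)%:E)].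

(* The two sides are the integrals of h for measures that agree on half-open intervals. *)
Lemma line_subst_bij (A : set R) (F G f : R -> R) : open A ->
  (forall x y t, A x -> A y -> (x <= t <= y)%R -> A t) ->
  (forall y, A (G y) /\ F (G y) = y) -> (forall x, A x -> G (F x) = x) ->
  {homo G : x y / (x < y)%R} ->
  (forall x, A x -> is_derive x 1%R F (f x)) -> (forall x, A x -> (0 <= f x)%R) ->
  (forall x, A x -> {for x, continuous f}) ->
  line_subst (F \_ A) (f \_ A).
Proof.
move=> oA cA GA GF Gi dF f0 cf.
have mA : measurable A by exact: open_measurable.
have mphi : measurable_fun setT (F \_ A).
  apply/measurable_restrict => //; rewrite setTI.
  apply: open_continuous_measurable_fun => // x /set_mem Ax.
  have [dFx _] := dF x Ax.
  exact/differentiable_continuous/derivable1_diffP.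
have mw : measurable_fun setT (f \_ A).
  apply/measurable_restrict => //; rewrite setTI.
  by apply: open_continuous_measurable_fun => // x /set_mem; exact: cf.
have w0 x : (0 <= (f \_ A) x)%R.
  by rewrite patchE; case: ifPn => // /set_mem; exact: f0.
split => // h mh h0; rewrite -(integral_wpush mphi mw w0 mh h0).
apply: eq_measure_integral => X mX _.
apply: lebesgue_measure_unique => // _ [[x y] _ <-] /=.
rewrite /wpush /=.
have [yx|xy] := leP y x.
  rewrite set_itv_ge -?leNgt// measure0.
  by rewrite preimage_set0 integral_set0.
have Gxy := Gi _ _ xy.
rewrite -[LHS]/(mu `]x, y]) lebesgue_measure_itv /= lte_fin xy.
(* Inside A the preimage of ]x, y] is ]G x, G y], as G is increasing; the fundamental theorem then
   yields F (G y) - F (G x) = y - x. *)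
transitivity (\int[mu]_(t in `]G x, G y]) (f t)%:E); last first.
  rewrite [LHS]integral_mkcond [RHS]integral_mkcond; apply: eq_integral => t _; rewrite !patchE.
  have [At|nAt] := pselect (A t); last first.
    have h1 : t \in A = false by apply/negbTE; rewrite notin_setE.
    rewrite h1; case: ifPn => [/set_mem|_]; last by case: ifPn.
    rewrite /= in_itv /= => /andP[t1 t2]; exfalso; apply: nAt.
    by apply: (cA (G x) (G y)); [exact: (GA x).1|exact: (GA y).1|rewrite (ltW t1) t2].
  have Gm u : (u < F t)%R = (G u < t)%R.
    by rewrite -{2}(GF t At) (leW_mono (le_mono Gi)).
  have Gm' u : (F t <= u)%R = (t <= G u)%R by rewrite !leNgt Gm.
  rewrite (mem_set At).
  have -> : (t \in `]G x, G y]%classic) = (t \in (F \_ A) @^-1` `]x, y]).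
    apply/idP/idP => /set_mem; rewrite /= ?patchE ?(mem_set At) !in_itv /= => ht;
      apply/mem_set; rewrite /= ?patchE ?(mem_set At) in_itv /=.
      by rewrite Gm Gm'.
    by rewrite -Gm -Gm'.
  by [].
have Axy t : (G x <= t <= G y)%R -> A t.
  by move=> tt; apply: (cA (G x) (G y)) tt; [exact: (GA x).1|exact: (GA y).1].
rewrite integral_itv_obnd_cbnd; last first.
  apply/measurable_EFinP; apply: measurable_funS (_ : measurable_fun A f); first exact: mA.
    by move=> t; rewrite /= in_itv /= => /andP[t1 t2]; apply: Axy; rewrite (ltW t1).
  by apply: open_continuous_measurable_fun => // t /set_mem; exact: cf.
rewrite (@continuous_FTC2 _ f F)//.
- by rewrite (GA x).2 (GA y).2.
- by apply: continuous_in_subspaceT => t /set_mem; rewrite /= in_itv /= => /Axy /cf.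
- have cF t : A t -> {for t, continuous F}.
    by move=> At; apply/differentiable_continuous/derivable1_diffP; have [] := dF t At.
  split.
  + by move=> t; rewrite in_itv /= => /andP[t1 t2]; have [] := dF t (Axy t _); rewrite ?(ltW t1) ?(ltW t2).
  + by apply: cvg_at_right_filter; apply: cF; exact: (GA x).1.
  + by apply: cvg_at_left_filter; apply: cF; exact: (GA y).1.
- move=> t; rewrite in_itv /= => /andP[t1 t2]; rewrite derive1E.
  by have [] := dF t (Axy t _); rewrite ?(ltW t1) ?(ltW t2).
Qed.

End LineSubstitution.

Section LineSubstitutionExamples.
Local Open Scope ereal_scope.
Variable R : realType.
Local Notation mu := (@lebesgue_measure R).
Local Notation MR := (measurableTypeR R).
Implicit Types (h k : R -> \bar R).

(** Uses 1 / x = x exp(-2 ln |x|); at 0 both sides are 0 by the convention for the inverse. *)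
Lemma measurable_invr : measurable_fun [set: R] (fun x : R => x^-1)%R.
Proof.
rewrite (_ : (fun x => x^-1)%R = (fun x : R => x * expR (- (2 * ln `|x|)))%R).
  apply: measurable_funM => //; apply: measurableT_comp => //.
  apply: measurableT_comp => //; apply: measurable_funM => //.
  by apply: measurableT_comp => //; exact: measurable_ln.
apply/funext => x; have [->|x0] := eqVneq x 0%R; first by rewrite invr0 mul0r.
have nx0 : (0 < `|x|)%R by rewrite normr_gt0.
rewrite mulr_natl -lnXn// expRN lnK ?posrE ?exprn_gt0//.
by rewrite real_normK ?num_real// expr2 invfM mulrA divff// mul1r.
Qed.

Lemma line_subst_comp (phi1 w1 phi2 w2 : R -> R) :
  line_subst phi1 w1 -> line_subst phi2 w2 ->
  line_subst (phi1 \o phi2) (fun x => w1 (phi2 x) * w2 x)%R.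
Proof.
move=> [m1 mw1 p1 H1] [m2 mw2 p2 H2]; split.
- exact: measurableT_comp.
- by apply: measurable_funM => //; exact: measurableT_comp.
- by move=> x; rewrite mulr_ge0.
move=> h mh h0; rewrite H1// H2//.
- by apply: eq_integral => x _; rewrite EFinM muleA.
- by apply: emeasurable_funM; [exact: measurableT_comp|exact/measurable_EFinP].
- by move=> x; rewrite mule_ge0// lee_fin.
Qed.

Lemma line_subst_opp : line_subst (fun x : R => - x)%R (fun=> 1%R).
Proof.
have mo : measurable_fun [set: R] (fun x : R => - x)%R by exact: oppr_measurable.
split => // h mh h0.
under [RHS]eq_integral do rewrite mule1.
rewrite -[RHS](@ge0_integral_pushforward _ _ MR MR R (fun x : R => - x)%R mo mu setT h)//.
by apply: eq_measure_integral => A mA _; exact/esym/lebesgue_measureN.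
Qed.

Lemma line_subst_pos_affine (c d : R) : (0 < c)%R ->
  line_subst (fun x => c * x + d)%R (fun=> c).
Proof.
move=> c0; have := @line_subst_bij R setT (fun x => c * x + d)%R (fun y => (y - d) / c)%R (fun=> c).
rewrite !patch_setT; apply=> //.
- exact: openT.
- by move=> y; split=> //; rewrite mulrC divfK ?gt_eqF// subrK.
- by move=> x _; rewrite addrK mulrC mulKf// gt_eqF.
- by move=> x y xy; rewrite ltr_pM2r ?invr_gt0// ltrD2r.
- move=> x _; have d1 : is_derive x 1%R (fun x : R => c * x)%R (c * 1)%R.
    by have := is_deriveZ c (is_derive_id x (1%R : R)).
  have := is_deriveD d1 (is_derive_cst d x 1%R).
  by rewrite addr0 mulr1.
- by move=> x _; exact: ltW.
- by move=> x _; exact: cvg_cst.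
Qed.

Lemma line_subst_affine (c d : R) : c != 0%R ->
  line_subst (fun x => c * x + d)%R (fun=> `|c|)%R.
Proof.
move=> c0; have [cpos|cneg] := ltP 0%R c.
  by rewrite gtr0_norm//; exact: line_subst_pos_affine.
have {}cneg : (c < 0)%R by rewrite lt_neqAle c0.
have := line_subst_comp (@line_subst_pos_affine (- c) d _) line_subst_opp.
rewrite oppr_gt0 ltr0_norm// => /(_ cneg).
rewrite (_ : _ \o _ = (fun x => c * x + d)%R); last by apply/funext => x /=; rewrite mulrNN.
by rewrite (_ : (fun x => - c * 1)%R = (fun=> - c)%R)//; apply/funext => x; rewrite mulr1.
Qed.

Lemma line_subst_ln : line_subst (@ln R \_ `]0%R, +oo[) ((fun x : R => x^-1 : R)%R \_ `]0%R, +oo[).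
Proof.
apply: (@line_subst_bij R _ (@ln R) (@expR R)).
- exact: interval_open.
- move=> x y t /=; rewrite !in_itv /= !andbT => x0 _ /andP[xt _]; exact: lt_le_trans xt.
- by move=> y /=; rewrite in_itv /= expR_gt0 expRK.
- by move=> x /=; rewrite in_itv /= andbT => x0; rewrite lnK.
- by move=> x y; rewrite ltr_expR.
- by move=> x /=; rewrite in_itv /= andbT => x0; exact: is_derive1_ln.
- by move=> x /=; rewrite in_itv /= andbT => x0; rewrite invr_ge0 ltW.
- move=> x /=; rewrite in_itv /= andbT => x0; apply: cvgV; last exact: cvg_id.
  by rewrite gt_eqF.
Qed.

Lemma integral_halfline_fold h : measurable_fun setT h -> (forall x, 0 <= h x) ->
  \int[mu]_x h x = \int[mu]_(x in `]0%R, +oo[) (h x + h (- x)%R).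
Proof.
move=> mh h0; have mhN : measurable_fun setT (fun x : R => h (- x)%R).
  by apply: measurableT_comp => //; exact: oppr_measurable.
rewrite ge0_integralD//; [|exact: measurable_funTS|exact: measurable_funTS].
rewrite -(setUv (`]0%R, +oo[%classic : set MR)) ge0_integral_setU//=; last 3 first.
- exact: measurableC.
- by rewrite setUv.
- exact/disj_setPCl.
congr (_ + _); rewrite setCitvr -integral_itv_bndo_bndc; last exact: measurable_funTS.
have [_ _ _ H] := line_subst_opp.
rewrite integral_mkcond H; last 2 first.
- by apply/(measurable_restrictT _ _).1 => //; exact: measurable_funTS.
- by move=> x; apply: erestrict_ge0.
rewrite [RHS]integral_mkcond; apply: eq_integral => x _; rewrite mule1 !patchE.
have -> // : ((- x)%R \in `]-oo, 0%R[%classic) = (x \in `]0%R, +oo[%classic).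
by apply/idP/idP => /set_mem /= H1; apply/mem_set; move: H1; rewrite /= !in_itv /= andbT oppr_lt0.
Qed.

Lemma integral_exp_subst k : measurable_fun setT k -> (forall x, 0 <= k x) ->
  \int[mu]_s (k (expR s) * (expR s)%:E) = \int[mu]_(x in `]0%R, +oo[) k x.
Proof.
move=> mk k0; have [_ _ _ ->] := line_subst_ln; last 2 first.
- apply: emeasurable_funM; last by apply/measurable_EFinP; exact: measurable_expR.
  by apply: measurableT_comp => //; exact: measurable_expR.
- by move=> x; rewrite mule_ge0// lee_fin expR_ge0.
rewrite [RHS]integral_mkcond; apply: eq_integral => x _; rewrite !patchE.
case: ifPn => [/set_mem /=|_]; last by rewrite mule0.
rewrite in_itv /= andbT => x0; rewrite lnK// -muleA -EFinM divff ?mule1//.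
by rewrite gt_eqF.
Qed.

(** In the coordinate x = e^s, inversion is the reflection s -> -s. *)
Lemma integral_halfline_inv k : measurable_fun setT k -> (forall x, 0 <= k x) ->
  \int[mu]_(x in `]0%R, +oo[) k x =
  \int[mu]_(x in `]0%R, +oo[) (k x^-1%R * (x ^- 2)%:E).
Proof.
move=> mk k0; rewrite -integral_exp_subst//.
have [_ _ _ ->] := line_subst_opp; last 2 first.
- apply: emeasurable_funM; last by apply/measurable_EFinP; exact: measurable_expR.
  by apply: measurableT_comp => //; exact: measurable_expR.
- by move=> x; rewrite mule_ge0// lee_fin expR_ge0.
rewrite -(@integral_exp_subst (fun x => k x^-1%R * (x ^- 2)%:E)); last 2 first.
- apply: emeasurable_funM; first by apply: measurableT_comp => //; exact: measurable_invr.
  apply/measurable_EFinP; apply: measurableT_comp; first exact: measurable_invr.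
  by apply: measurable_funX.
- by move=> x; rewrite mule_ge0// lee_fin invr_ge0 sqr_ge0.
apply: eq_integral => x _; rewrite mule1 expRN -muleA -EFinM; congr (_ * _%:E).
by field; rewrite expR_eq0.
Qed.

Lemma line_subst_inv : line_subst (fun x : R => x^-1)%R (fun x : R => x ^- 2)%R.
Proof.
split.
- exact: measurable_invr.
- by apply: measurableT_comp; [exact: measurable_invr|exact: measurable_funX].
- by move=> x; rewrite invr_ge0 sqr_ge0.
move=> h mh h0; have mhN : measurable_fun setT (fun x : R => h (- x)%R).
  by apply: measurableT_comp => //; exact: oppr_measurable.
rewrite integral_halfline_fold// integral_halfline_inv; last 2 first.
- exact: emeasurable_funD.
- by move=> x; rewrite adde_ge0.
rewrite [RHS]integral_halfline_fold; last 2 first.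
- apply: emeasurable_funM; first by apply: measurableT_comp => //; exact: measurable_invr.
  by apply/measurable_EFinP; apply: measurableT_comp; [exact: measurable_invr|exact: measurable_funX].
- by move=> x; rewrite mule_ge0// lee_fin invr_ge0 sqr_ge0.
apply: eq_integral => x _; rewrite sqrrN invrN ge0_muleDl//.
Qed.

Lemma line_subst_tan : line_subst (@tan R \_ `](- (pi / 2))%R, (pi / 2)%R[)
  ((fun x : R => (cos x) ^- 2 : R)%R \_ `](- (pi / 2))%R, (pi / 2)%R[).
Proof.
apply: (@line_subst_bij R _ (@tan R) (@atan R)).
- exact: interval_open.
- move=> x y t /=; rewrite !in_itv /= => /andP[x1 x2] /andP[y1 y2] /andP[xt ty].
  by rewrite (lt_le_trans x1 xt) (le_lt_trans ty y2).
- by move=> y /=; rewrite in_itv /= atan_gtNpi2 atan_ltpi2 atanK.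
- by move=> x /= xA; rewrite tanK.
- exact: lt_atan.
- move=> x /=; rewrite in_itv /= => xA; apply: is_derive_tan.
  by rewrite gt_eqF// cos_gt0_pihalf.
- by move=> x _; rewrite invr_ge0 sqr_ge0.
- move=> x /=; rewrite in_itv /= => xA; apply: cvgV.
    by rewrite expf_neq0// gt_eqF// cos_gt0_pihalf.
  by apply: cvgM; exact: continuous_cos.
Qed.

End LineSubstitutionExamples.

(** * Substitutions in the plane, fibre by fibre *)

Section PlaneSubstitution.
Local Open Scope ereal_scope.
Variable R : realType.
Local Notation mu := (@lebesgue_measure R).
Local Notation MR := (measurableTypeR R).
Implicit Types (h : R * R -> \bar R).

Definition plane_integral h := \int[mu \x mu]_z h z.

Lemma plane_integral_xy h : measurable_fun setT h -> (forall z, 0 <= h z) ->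
  plane_integral h = \int[mu]_x \int[mu]_y h (x, y).
Proof. by move=> mh h0; exact: (@fubini_tonelli1 _ _ MR MR R mu mu h mh h0). Qed.

Lemma plane_integral_yx h : measurable_fun setT h -> (forall z, 0 <= h z) ->
  plane_integral h = \int[mu]_y \int[mu]_x h (x, y).
Proof. by move=> mh h0; exact: (@fubini_tonelli2 _ _ MR MR R mu mu h mh h0). Qed.

Lemma measurable_slice_x h y : measurable_fun setT h -> measurable_fun setT (fun x => h (x, y)).
Proof. by move=> mh; apply: (measurableT_comp mh); exact: measurable_fun_pair. Qed.

Lemma measurable_slice_y h x : measurable_fun setT h -> measurable_fun setT (fun y => h (x, y)).
Proof. by move=> mh; apply: (measurableT_comp mh); exact: measurable_fun_pair. Qed.

Lemma measurable_integral_x h : measurable_fun setT h -> (forall z, 0 <= h z) ->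
  measurable_fun setT (fun y => \int[mu]_x h (x, y)).
Proof. by move=> mh h0; exact: (@measurable_fun_fubini_tonelli_G _ _ MR MR R mu h mh h0). Qed.

Lemma measurable_integral_y h : measurable_fun setT h -> (forall z, 0 <= h z) ->
  measurable_fun setT (fun x => \int[mu]_y h (x, y)).
Proof. by move=> mh h0; exact: (@measurable_fun_fubini_tonelli_F _ _ MR MR R mu h mh h0). Qed.

(** A single fibre is negligible; the fibrewise maps below degenerate over the coordinate 0. *)
Lemma eq_integral_off0 (k1 k2 : R -> \bar R) :
  measurable_fun setT k1 -> measurable_fun setT k2 ->
  (forall y, y != 0%R -> k1 y = k2 y) -> \int[mu]_y k1 y = \int[mu]_y k2 y.
Proof.
move=> m1 m2 k12.
have m0 : measurable ((setT : set MR) `\ 0%R) by exact: measurableD.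
rewrite -[LHS](@integral_setD1 R k1 0%R setT)//; last exact: measurable_funTS.
rewrite -[RHS](@integral_setD1 R k2 0%R setT)//; last exact: measurable_funTS.
by apply: eq_integral => y /set_mem [_ /= /eqP]; exact: k12.
Qed.

Definition plane_subst (T : R * R -> R * R) (J : R * R -> R) :=
  [/\ measurable_fun setT T, measurable_fun setT J, (forall z, (0 <= J z)%R) &
  forall h, measurable_fun setT h -> (forall z, 0 <= h z) ->
  plane_integral h = plane_integral (fun z => h (T z) * (J z)%:E)].

Lemma plane_subst_measurable h (T : R * R -> R * R) (J : R * R -> R) : measurable_fun setT T -> measurable_fun setT J ->
  measurable_fun setT h -> measurable_fun setT (fun z => h (T z) * (J z)%:E).
Proof.
move=> mT mJ mh; apply: emeasurable_funM; first exact: (measurableT_comp mh mT).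
exact/measurable_EFinP.
Qed.

Lemma plane_subst_comp T1 J1 T2 J2 : plane_subst T1 J1 -> plane_subst T2 J2 ->
  plane_subst (T1 \o T2) (fun z => J1 (T2 z) * J2 z)%R.
Proof.
move=> [mT1 mJ1 p1 H1] [mT2 mJ2 p2 H2]; split.
- exact: (measurableT_comp mT1 mT2).
- by apply: measurable_funM => //; exact: (measurableT_comp mJ1 mT2).
- by move=> z; rewrite mulr_ge0.
move=> h mh h0; rewrite H1// H2//.
- by apply: eq_integral => z _; rewrite EFinM muleA.
- exact: plane_subst_measurable.
- by move=> z; rewrite mule_ge0// lee_fin.
Qed.

Lemma plane_subst_x (k j : R -> R -> R) :
  measurable_fun setT (fun z : R * R => k z.2 z.1) ->
  measurable_fun setT (fun z : R * R => j z.2 z.1) ->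
  (forall x y, (0 <= j y x)%R) ->
  (forall y, y != 0%R -> line_subst (k y) (j y)) ->
  plane_subst (fun z => (k z.2 z.1, z.2)) (fun z => j z.2 z.1).
Proof.
move=> mk mj j0 kj.
have mT : measurable_fun setT (fun z : R * R => (k z.2 z.1, z.2)).
  by apply: measurable_fun_pair.
split => // h mh h0.
have mhT : measurable_fun setT (fun z : R * R => h (k z.2 z.1, z.2) * (j z.2 z.1)%:E).
  exact: (plane_subst_measurable mT mj mh).
have hT0 z : 0 <= h (k z.2 z.1, z.2) * (j z.2 z.1)%:E by rewrite mule_ge0// lee_fin.
rewrite (plane_integral_yx mh h0) (plane_integral_yx mhT hT0); apply: eq_integral_off0.
- exact: measurable_integral_x.
- exact: (measurable_integral_x mhT hT0).
move=> y y0; have [_ _ _ ->]// := kj y y0.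
exact: measurable_slice_x.
Qed.

Lemma plane_subst_swap : plane_subst (fun z => (z.2, z.1)) (fun=> 1%R).
Proof.
have ms : measurable_fun setT (fun z : R * R => (z.2, z.1)) by exact: measurable_fun_pair.
split => // h mh h0.
under [in RHS]eq_fun do rewrite mule1.
rewrite (plane_integral_yx mh h0).
by rewrite (plane_integral_xy (measurableT_comp mh ms) (fun z => h0 _)).
Qed.

Lemma plane_subst_y (k j : R -> R -> R) :
  measurable_fun setT (fun z : R * R => k z.1 z.2) ->
  measurable_fun setT (fun z : R * R => j z.1 z.2) ->
  (forall x y, (0 <= j x y)%R) ->
  (forall x, x != 0%R -> line_subst (k x) (j x)) ->
  plane_subst (fun z => (z.1, k z.1 z.2)) (fun z => j z.1 z.2).
Proof.
move=> mk mj j0 kj.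
have ms : measurable_fun setT (fun z : R * R => (z.2, z.1)) by exact: measurable_fun_pair.
have := plane_subst_comp (plane_subst_comp plane_subst_swap
  (plane_subst_x (measurableT_comp mk ms) (measurableT_comp mj ms) (fun x y => j0 y x) kj)) plane_subst_swap.
rewrite (_ : _ \o _ = (fun z => (z.1, k z.1 z.2))); last by apply/funext => -[x y].
by rewrite (_ : (fun z : R * R => _)%R = (fun z => j z.1 z.2))//; apply/funext => -[x y] /=; rewrite mul1r mulr1.
Qed.

Lemma plane_subst_off0 T J (T' : R * R -> R * R) (J' : R * R -> R) : plane_subst T J ->
  measurable_fun setT T' -> measurable_fun setT J' -> (forall z, (0 <= J' z)%R) ->
  (forall x y, y != 0%R -> T (x, y) = T' (x, y) /\ J (x, y) = J' (x, y)) -> plane_subst T' J'.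
Proof.
move=> [mT mJ p H] mT' mJ' p' E; split => // h mh h0; rewrite H//.
have q1 := plane_subst_measurable mT mJ mh; have q2 := plane_subst_measurable mT' mJ' mh.
have r1 z : 0 <= h (T z) * (J z)%:E by rewrite mule_ge0// lee_fin.
have r2 z : 0 <= h (T' z) * (J' z)%:E by rewrite mule_ge0// lee_fin.
rewrite (plane_integral_yx q1 r1) (plane_integral_yx q2 r2); apply: eq_integral_off0.
- exact: (measurable_integral_x q1 r1).
- exact: (measurable_integral_x q2 r2).
by move=> y y0; apply: eq_integral => x _; have [-> ->] := E x y y0.
Qed.

Lemma plane_subst_translate (d1 d2 : R) : plane_subst (fun z => (z.1 + d1, z.2 + d2)%R) (fun=> 1%R).
Proof.
have lt (d : R) : line_subst (fun x => x + d)%R (fun=> 1%R).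
  have := @line_subst_affine R 1%R d (oner_neq0 _); rewrite normr1.
  by rewrite (_ : (fun x => 1 * x + d)%R = (fun x => x + d)%R)//; apply/funext => x; rewrite mul1r.
have := plane_subst_comp
  (@plane_subst_x (fun _ x => x + d1)%R (fun _ _ => 1%R) _ _ (fun _ _ => ler01) (fun _ _ => lt d1))
  (@plane_subst_y (fun _ x => x + d2)%R (fun _ _ => 1%R) _ _ (fun _ _ => ler01) (fun _ _ => lt d2)).
rewrite (_ : (fun z : R * R => 1 * 1)%R = (fun=> 1%R)); last by apply/funext => z; rewrite mul1r.
by apply => //; apply: measurable_funD.
Qed.

(** The matrix of multiplication by c1 + i c2 is factored into two triangular ones, each an affine
    map on fibres; c1 and q are the pivots. *)
Let plane_subst_mul_Re (c1 c2 : R) : c1 != 0%R ->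
  plane_subst (fun z => (c1 * z.1 - c2 * z.2, c2 * z.1 + c1 * z.2)%R) (fun=> (c1 ^+ 2 + c2 ^+ 2)%R).
Proof.
move=> c10; have n0 : (c1 ^+ 2 + c2 ^+ 2 != 0)%R.
  by rewrite gt_eqF// ltr_wpDr ?sqr_ge0// exprn_even_gt0.
pose q := ((c1 ^+ 2 + c2 ^+ 2) / c1)%R; have q0 : q != 0%R by rewrite mulf_neq0// invr_eq0.
have S1 := @plane_subst_y (fun u y => q * y + c2 / c1 * u)%R (fun _ _ => `|q|)%R.
have S2 := @plane_subst_x (fun y x => c1 * x + (- c2 * y))%R (fun _ _ => `|c1|)%R.
have := plane_subst_comp (S1 _ _ _ _) (S2 _ _ _ _).
rewrite (_ : _ \o _ = (fun z => (c1 * z.1 - c2 * z.2, c2 * z.1 + c1 * z.2)%R)); last first.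
  by apply/funext => -[x y]; rewrite /= /q; congr pair; field.
rewrite (_ : (fun z : R * R => `|q| * `|c1|)%R = (fun=> (c1 ^+ 2 + c2 ^+ 2)%R)); last first.
  by apply/funext => z; rewrite -normrM divfK// ger0_norm// addr_ge0 ?sqr_ge0.
apply => //.
- by apply: measurable_funD; apply: measurable_funM.
- by move=> x _; exact: line_subst_affine.
- by apply: measurable_funD; apply: measurable_funM.
- by move=> x _; exact: line_subst_affine.
Qed.

Lemma plane_subst_mul (c1 c2 : R) : (c1 != 0%R) || (c2 != 0%R) ->
  plane_subst (fun z => (c1 * z.1 - c2 * z.2, c2 * z.1 + c1 * z.2)%R) (fun=> (c1 ^+ 2 + c2 ^+ 2)%R).
Proof.
have [->|c10 _] := eqVneq c1 0%R; last exact: plane_subst_mul_Re.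
move=> /= c20; have o0 : (1 : R)%R != 0%R by exact: oner_neq0.
have c220 : (c2 / 2)%R != 0%R by rewrite mulf_neq0.
(* i c2 = (1 + i) (c2/2 + i c2/2) has factors with nonzero real part *)
have := plane_subst_comp (@plane_subst_mul_Re 1%R 1%R o0) (@plane_subst_mul_Re (c2 / 2)%R (c2 / 2)%R c220).
rewrite (_ : _ \o _ = (fun z => (0 * z.1 - c2 * z.2, c2 * z.1 + 0 * z.2)%R)); last first.
  by apply/funext => -[x y] /=; congr pair; field.
rewrite (_ : (fun z : R * R => (_ * _)%R) = (fun=> (0 ^+ 2 + c2 ^+ 2)%R))//.
by apply/funext => z; field.
Qed.

Let sq (z : R * R) := (z.1 ^+ 2 + z.2 ^+ 2)%R.

Let msq : measurable_fun setT sq.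
Proof. by apply: measurable_funD; apply: measurable_funX. Qed.

(** In the coordinates (t, y) = (x / y, y) this map fixes t and sends y to 1 / ((1 + t^2) y), a
    scaled inversion on each fibre. The map [S3] passes to these coordinates and [S1] returns from
    them; they break down on y = 0, whence [plane_subst_off0]. *)
Lemma plane_subst_inv :
  plane_subst (fun z => (z.1 / sq z, z.2 / sq z)%R) (fun z => (sq z) ^- 2)%R.
Proof.
have mV : measurable_fun [set: R] (fun x : R => x^-1)%R by exact: measurable_invr.
have S1 := @plane_subst_x (fun y x => y * x + 0)%R (fun y _ => `|y|)%R.
have S2 := @plane_subst_y (fun t v => (1 + t ^+ 2)^-1 * v^-1 + 0)%R
   (fun t v => `|(1 + t ^+ 2)^-1| * v ^- 2)%R.
have S3 := @plane_subst_x (fun y x => y^-1 * x + 0)%R (fun y _ => `|y^-1|)%R.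
apply: (plane_subst_off0 (plane_subst_comp (plane_subst_comp (S1 _ _ _ _) (S2 _ _ _ _)) (S3 _ _ _ _))) => //.
- by apply: measurable_funD => //; apply: measurable_funM.
- by apply: measurableT_comp.
- by move=> y y0; exact: line_subst_affine.
- apply: measurable_funD => //; apply: measurable_funM.
    by apply: (measurableT_comp mV); apply: measurable_funD => //; apply: measurable_funX.
  exact: (measurableT_comp mV).
- apply: measurable_funM.
    apply: measurableT_comp => //; apply: (measurableT_comp mV).
    by apply: measurable_funD => //; apply: measurable_funX.
  by apply: (measurableT_comp mV); apply: measurable_funX.
- by move=> x y; rewrite mulr_ge0// invr_ge0 sqr_ge0.
- move=> t _; have t0 : ((1 + t ^+ 2)^-1 != 0)%R.
    by rewrite invr_eq0 gt_eqF// ltr_wpDr ?sqr_ge0.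
  exact: (line_subst_comp (@line_subst_affine R _ 0%R t0) (@line_subst_inv R)).
- apply: measurable_funD => //; apply: measurable_funM => //.
  exact: (measurableT_comp mV).
- by apply: measurableT_comp => //; exact: (measurableT_comp mV).
- by move=> y y0; apply: line_subst_affine; rewrite invr_eq0.
- apply: measurable_fun_pair; apply: measurable_funM => //; exact: (measurableT_comp mV).
- by apply: (measurableT_comp mV); apply: measurable_funX.
- by move=> z; rewrite invr_ge0 sqr_ge0.
move=> x y y0; rewrite /sq /=.
have n0 : (x ^+ 2 + y ^+ 2 != 0)%R by rewrite gt_eqF// ltr_wpDl ?sqr_ge0// exprn_even_gt0.
have t0 : (0 < (1 + (y^-1 * x + 0) ^+ 2))%R by rewrite ltr_wpDr ?sqr_ge0.
have E : (1 + (y^-1 * x + 0) ^+ 2 = (x ^+ 2 + y ^+ 2) / y ^+ 2)%R by field.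
split.
  by rewrite E; congr pair; field; rewrite n0 y0.
rewrite E (ger0_norm (_ : 0 <= ((x ^+ 2 + y ^+ 2) / y ^+ 2)^-1)%R); last first.
  by rewrite invr_ge0 divr_ge0 ?addr_ge0 ?sqr_ge0.
rewrite addr0 normrM.
have -> : (`|((x ^+ 2 + y ^+ 2) / y ^+ 2)^-1| = y ^+ 2 / (x ^+ 2 + y ^+ 2))%R.
  by rewrite ger0_norm ?invr_ge0 ?divr_ge0 ?addr_ge0 ?sqr_ge0// invf_div.
have yy : (`|y^-1| * `|y^-1| = y ^- 2)%R by rewrite -normrM -invfM -expr2 ger0_norm// invr_ge0 sqr_ge0.
have rid (A B b c : R) : (A * b * (B * c) * b = A * B * c * (b * b))%R by ring.
by rewrite rid yy; field; rewrite n0 y0.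
Qed.

End PlaneSubstitution.

Section ComplexSubstitution.
Local Open Scope ereal_scope.
Variable R : realType.
Local Notation mu := (@lebesgue_measure R).
Local Notation rc x := ((x%:C)%C : CC R).
Implicit Types (z w a c d : CC R) (U h : CC R -> \bar R).

Definition area_measurable h := measurable_fun [set: R * R] (fun xy : R * R => h (cpt xy)).

Definition area h := plane_integral (fun xy : R * R => h (cpt xy)).

(** Measurability on [CC R] is expressed in real coordinates, so that of T is stated by composition
    with test functions. *)
Definition csubst (T : CC R -> CC R) (J : CC R -> R) :=
  [/\ forall h, area_measurable h -> area_measurable (fun z => h (T z)),
      measurable_fun [set: R * R] (fun xy : R * R => J (cpt xy)), (forall z, (0 <= J z)%R) &
      forall h, area_measurable h -> (forall z, 0 <= h z) ->
        area h = area (fun z => h (T z) * (J z)%:E)].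

Lemma csubst_of_plane (T : CC R -> CC R) (J : CC R -> R) TP JP : plane_subst TP JP ->
  (forall xy : R * R, cpt (TP xy) = T (cpt xy)) -> (forall xy : R * R, JP xy = J (cpt xy)) ->
  csubst T J.
Proof.
move=> [mT mJ p H] TE JE; split.
- move=> h mh; rewrite /area_measurable.
  under eq_fun do rewrite -TE.
  exact: (measurableT_comp mh mT).
- by rewrite (_ : (fun xy => _) = JP)//; apply/funext => xy; rewrite JE.
- by move=> z; have := p (complex.Re z, complex.Im z); rewrite JE; case: z.
move=> h mh h0; rewrite /area (H _ mh (fun xy => h0 _)).
by apply: eq_integral => xy _; rewrite TE JE.
Qed.

Lemma csubst_measurable T J h : csubst T J -> area_measurable h ->
  area_measurable (fun z => h (T z) * (J z)%:E).
Proof.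
move=> [mT mJ _ _] mh; apply: emeasurable_funM; first exact: mT.
exact/measurable_EFinP.
Qed.

Lemma csubst_comp T1 J1 T2 J2 : csubst T1 J1 -> csubst T2 J2 ->
  csubst (fun z => T1 (T2 z)) (fun z => J1 (T2 z) * J2 z)%R.
Proof.
move=> s1 s2; have [mT1 mJ1 p1 H1] := s1; have [mT2 mJ2 p2 H2] := s2.
have mJ12 : measurable_fun [set: R * R] (fun xy : R * R => J1 (T2 (cpt xy))).
  have := mT2 (fun z => (J1 z)%:E); rewrite /area_measurable => H.
  by apply/measurable_EFinP; apply: H; exact/measurable_EFinP.
split.
- by move=> h /mT1/mT2.
- exact: measurable_funM.
- by move=> z; rewrite mulr_ge0.
move=> h mh h0; rewrite (H1 _ mh h0) (H2 _ (csubst_measurable s1 mh)); last first.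
  by move=> z; rewrite mule_ge0// lee_fin.
by apply: eq_integral => z _; rewrite EFinM muleA.
Qed.

Lemma csubst_translate d : csubst (fun z => z + d)%R (fun=> 1%R).
Proof.
apply: (csubst_of_plane (plane_subst_translate (complex.Re d) (complex.Im d))) => //.
by move=> [x y]; case: d.
Qed.

Lemma csubst_mul c : c != 0%R -> csubst (fun z => c * z)%R (fun=> (cabs c ^+ 2)%R).
Proof.
case: c => c1 c2; rewrite eq_complex negb_and => c0.
apply: (csubst_of_plane (plane_subst_mul c0)) => [[x y]|xy]; last by rewrite cabs_sqr.
by rewrite /cpt [RHS]/GRing.mul /=; congr Complex; rewrite addrC.
Qed.

Lemma csubst_affine c d : c != 0%R -> csubst (fun z => c * z + d)%R (fun=> (cabs c ^+ 2)%R).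
Proof.
move=> c0; have := csubst_comp (csubst_translate d) (csubst_mul c0).
by rewrite (_ : (fun z => 1 * _)%R = (fun=> (cabs c ^+ 2)%R))//; apply/funext => z; rewrite mul1r.
Qed.

(** As 1 / z = conj z / |z|^2, this is a reflection followed by the real inversion. *)
Lemma csubst_inv : csubst (fun z => z^-1)%R (fun z => (cabs z ^+ 4)^-1)%R.
Proof.
have m1 : measurable_fun [set: R * R] (fun z : R * R => (-1 * z.2 + 0)%R).
  by apply: measurable_funD => //; apply: measurable_funM.
have refl : plane_subst (fun z : R * R => (z.1, (-1 * z.2 + 0)%R)) (fun z : R * R => `|-1 : R|%R).
  apply: (@plane_subst_y R (fun _ y => -1 * y + 0)%R (fun _ _ => `|-1|%R)) => //.
  by move=> x _; apply: line_subst_affine; rewrite oppr_eq0.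
apply: (csubst_of_plane (plane_subst_comp (plane_subst_inv R) refl)) => [[x y]|[x y]].
  rewrite /cpt /= mulN1r addr0 sqrrN [RHS]/GRing.inv /=; congr Complex.
  by rewrite mulNr.
rewrite (exprM _ 2 2) cabs_sqr.
by rewrite /= mulN1r addr0 sqrrN normrN normr1 mulr1.
Qed.

Definition moebius_den a z : CC R := (1 - conjc (a : R[i]) * z)%R.

Lemma phiE a z : phi a z = ((a - z) / moebius_den a z)%R.
Proof. by []. Qed.

Lemma cabs_sqr_sub1 a z : (cabs (moebius_den a z) ^+ 2 - cabs (a - z) ^+ 2 =
  (1 - cabs a ^+ 2) * (1 - cabs z ^+ 2))%R.
Proof.
rewrite !cabs_sqr /moebius_den; case: a z => a1 a2 [x y] /=; ring.
Qed.

Lemma moebius_den_neq0 a z : (cabs a < 1)%R -> (cabs z < 1)%R -> moebius_den a z != 0%R.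
Proof.
move=> a1 z1; rewrite -cabs_gt0; apply: lt_le_trans (cabs_sub_ge _ _).
rewrite cabs1 cabsM cabs_conj subr_gt0.
exact: (mulr_ilt1 (cabs_ge0 a) (cabs_ge0 z) a1 z1).
Qed.

(* The modulus of the derivative of phi a. *)
Definition moebius_jac a z : R := ((1 - cabs a ^+ 2) / cabs (moebius_den a z) ^+ 2)%R.

Lemma one_sub_cabs_phi a z : moebius_den a z != 0%R ->
  (1 - cabs (phi a z) ^+ 2 = (1 - cabs z ^+ 2) * moebius_jac a z)%R.
Proof.
move=> d0; have d0' : (cabs (moebius_den a z) != 0)%R by rewrite cabs_eq0.
rewrite phiE cabs_div expr_div_n /moebius_jac mulrCA mulrA -cabs_sqr_sub1.
by field.
Qed.

Lemma one_sub_sqr_gt0 a : (cabs a < 1)%R = (0 < 1 - cabs a ^+ 2)%R.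
Proof. by rewrite subr_gt0 expr_lt1 ?cabs_ge0. Qed.

Lemma moebius_jac_gt0 a z : (cabs a < 1)%R -> moebius_den a z != 0%R -> (0 < moebius_jac a z)%R.
Proof. by move=> a1 d0; rewrite divr_gt0 -?one_sub_sqr_gt0// exprn_gt0// cabs_gt0. Qed.

Lemma cabs_phi_lt1 a z : (cabs a < 1)%R -> moebius_den a z != 0%R ->
  (cabs (phi a z) < 1)%R = (cabs z < 1)%R.
Proof.
move=> a1 d0; rewrite !one_sub_sqr_gt0 one_sub_cabs_phi//.
by rewrite pmulr_lgt0// moebius_jac_gt0.
Qed.

Lemma phi_involutive a z : (cabs a < 1)%R -> (cabs z < 1)%R -> phi a (phi a z) = z.
Proof.
move=> a1 z1; have d0 := moebius_den_neq0 a1 z1.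
have n0 : (1 - conjc (a : R[i]) * a != 0 :> CC R)%R := moebius_den_neq0 a1 a1.
rewrite /phi; rewrite -/(moebius_den a z).
have E : (1 - conjc (a : R[i]) * ((a - z) / moebius_den a z) =
   (1 - conjc (a : R[i]) * a) / moebius_den a z :> CC R)%R.
  by rewrite /moebius_den in d0 *; field.
rewrite E; rewrite /moebius_den in d0 *; field; by rewrite d0 n0.
Qed.

(** Since phi a is an involution, [one_sub_cabs_phi] used at phi a z and at z multiplies 1 - |z|^2
    by both Jacobians and returns it unchanged. *)
Lemma moebius_jac_phi a z : (cabs a < 1)%R -> (cabs z < 1)%R ->
  (moebius_jac a (phi a z) * moebius_jac a z = 1)%R.
Proof.
move=> a1 z1; have d0 := moebius_den_neq0 a1 z1.
have p1 : (cabs (phi a z) < 1)%R by rewrite cabs_phi_lt1.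
have := one_sub_cabs_phi (moebius_den_neq0 a1 p1).
rewrite phi_involutive// one_sub_cabs_phi// => E.
have n0 : (1 - cabs z ^+ 2 != 0)%R by rewrite gt_eqF// -one_sub_sqr_gt0.
by apply: (mulfI n0); rewrite mulr1 {2}E mulrA mulrAC.
Qed.

(* phi a z = (a - 1 / conj a) / (1 - conj a * z) + 1 / conj a. *)
Let csubst_moebius_neq0 a : (cabs a < 1)%R -> a != 0%R ->
  exists T, csubst T (fun z => moebius_jac a z ^+ 2)%R /\
  forall z, moebius_den a z != 0%R -> T z = phi a z.
Proof.
move=> a1 a0.
have ca0 : conjc (a : R[i]) != 0%R :> CC R by rewrite conjc_eq0.
have n0 : (1 - conjc (a : R[i]) * a != 0 :> CC R)%R := moebius_den_neq0 a1 a1.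
pose c1 : CC R := (a - (conjc (a : R[i]))^-1)%R.
have c1E : c1 = (- (1 - conjc (a : R[i]) * a) / conjc (a : R[i]) : CC R)%R by rewrite /c1; field.
have c10 : c1 != 0%R by rewrite c1E mulf_neq0 ?oppr_eq0// invr_eq0.
have cc0 : (- conjc (a : R[i]) != 0 :> CC R)%R by rewrite oppr_eq0.
have := csubst_comp (csubst_affine (conjc (a : R[i]))^-1%R c10)
  (csubst_comp csubst_inv (csubst_affine 1%R cc0)).
have dE z : (- conjc (a : R[i]) * z + 1 = moebius_den a z :> CC R)%R by rewrite /moebius_den; ring.
rewrite (_ : (fun z => _)%R = (fun z => moebius_jac a z ^+ 2)%R); last first.
  apply/funext => z; rewrite dE /moebius_jac c1E cabs_div cabsN cabsN cabs_conj.
  have -> : cabs (1 - conjc (a : R[i]) * a : CC R)%R = (1 - cabs a ^+ 2)%R.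
    rewrite mulrC mulcJ_cabs (_ : (1 - _ = rc (1 - cabs a ^+ 2) :> CC R)%R); last by rewrite rmorphB.
    by rewrite cabs_real gtr0_norm// -one_sub_sqr_gt0.
  have na0 : (cabs a != 0)%R by rewrite cabs_eq0.
  (* At the pole both weights are 0, by the convention for the inverse of 0. *)
  have [->|k0] := eqVneq (cabs (moebius_den a z)) 0%R; last by field; rewrite na0 k0.
  by rewrite !expr0n /= !invr0 mul0r !mulr0 expr0n.
move=> H; eexists; split; first exact: H.
move=> z d0; rewrite /= dE phiE /c1; rewrite /moebius_den in d0 *; field.
by rewrite ca0 d0.
Qed.

Lemma csubst_moebius a : (cabs a < 1)%R ->
  exists T, csubst T (fun z => moebius_jac a z ^+ 2)%R /\
  forall z, moebius_den a z != 0%R -> T z = phi a z.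
Proof.
move=> a1; have [->|] := eqVneq a 0%R; last exact: csubst_moebius_neq0.
have m10 : (-1 != 0 :> CC R)%R by rewrite oppr_eq0 oner_eq0.
exists (fun z => -1 * z + 0)%R; split; last first.
  by move=> z _; rewrite /phi conjc0 mul0r subr0 divr1 sub0r mulN1r addr0.
have := csubst_affine 0%R m10.
rewrite (_ : (fun=> _) = (fun z => moebius_jac 0 z ^+ 2)%R)//.
apply/funext => z; rewrite /moebius_jac /moebius_den conjc0 mul0r subr0 cabsN cabs1 cabs0.
by rewrite !expr1n expr0n /= subr0 divr1 expr1n.
Qed.

Definition on_disk U z := if (cabs z < 1)%R then U z else 0.

(** Away from the pole phi a z lies in the disk exactly when z does, so extension by zero is
    preserved; at the pole the Jacobian is 0. *)
Lemma on_disk_moebius a U : (cabs a < 1)%R -> area_measurable (on_disk U) ->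
  (forall z, 0 <= U z) ->
  area_measurable (on_disk (fun z => U (phi a z) * (moebius_jac a z ^+ 2)%:E)) /\
  area (on_disk U) = area (on_disk (fun z => U (phi a z) * (moebius_jac a z ^+ 2)%:E)).
Proof.
move=> a1 mU U0; have [T [sT TE]] := csubst_moebius a1.
have E z : on_disk U (T z) * (moebius_jac a z ^+ 2)%:E =
    on_disk (fun z => U (phi a z) * (moebius_jac a z ^+ 2)%:E) z.
  rewrite /on_disk; have [d0|d0] := eqVneq (moebius_den a z) 0%R.
    rewrite /moebius_jac d0 cabs0 expr0n /= invr0 mulr0 expr0n /= mule0.
    by case: ifPn => // z1; rewrite mule0.
  by rewrite TE// cabs_phi_lt1//; case: ifPn => // _; rewrite mul0e.
split.
  have := csubst_measurable sT mU; rewrite /area_measurable.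
  by under eq_fun do rewrite E.
have [_ _ _ ->//] := sT; first by apply: eq_integral => z _; rewrite E.
by move=> z; rewrite /on_disk; case: ifPn.
Qed.

End ComplexSubstitution.

Section PolarCoordinates.
Local Open Scope ereal_scope.
Variable R : realType.
Local Notation mu := (@lebesgue_measure R).
Local Notation MR := (measurableTypeR R).
Local Notation A := (`](- (pi / 2))%R, (pi / 2)%R[%classic : set R).
Implicit Types (U : CC R -> \bar R).

Lemma measurable_cos : measurable_fun [set: R] (@cos R).
Proof. exact: (continuous_measurable_fun (@continuous_cos R)). Qed.

Lemma measurable_sin : measurable_fun [set: R] (@sin R).
Proof. exact: (continuous_measurable_fun (@continuous_sin R)). Qed.

Let polar_measurable : measurable_fun [set: R * R]
  (fun z : R * R => (z.1 * cos z.2, z.1 * sin z.2)%R).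
Proof.
by apply: measurable_fun_pair; apply: measurable_funM => //; apply: measurableT_comp => //;
  [exact: measurable_cos|exact: measurable_sin].
Qed.

Let circE (r t : R) : circ r t = cpt (r * cos t, r * sin t)%R.
Proof. by rewrite /circ /cis /cpt [LHS]/GRing.mul /= !mul0r subr0 addr0. Qed.

Let opp_circE (r t : R) : (- circ r t = cpt (- r * cos t, - r * sin t) :> CC R)%R.
Proof. by rewrite circE /cpt [LHS]/GRing.opp /= !mulNr. Qed.

Lemma circ_measurable U (r : R) : area_measurable U ->
  measurable_fun [set: R] (fun t => U (circ r t)) /\
  measurable_fun [set: R] (fun t => U (- circ r t)%R).
Proof.
have m s : measurable_fun [set: R] (fun t => (s * cos t, s * sin t)%R : R * R).
  by apply: measurable_fun_pair; apply: measurable_funM => //;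
    [exact: measurable_cos|exact: measurable_sin].
move=> mU; split.
  have := measurableT_comp mU (m r).
  by congr (measurable_fun _ _); apply/funext => t; rewrite circE.
have := measurableT_comp mU (m (- r)%R).
by congr (measurable_fun _ _); apply/funext => t; rewrite opp_circE.
Qed.

(** Polar coordinates by line substitutions: y = x u on vertical fibres, u = tan t, then x = r cos
    t. The densities |r cos t|, 1 / cos^2 t and cos t multiply to |r|. Here r takes both signs, and
    folding r with -r yields the opposite half circle. *)
Lemma polar_integral U : area_measurable U -> (forall z, 0 <= U z) ->
  area U = \int[mu]_(r in `]0%R, +oo[)
    ((\int[mu]_(t in A) (U (circ r t) + U (- circ r t)%R)) * r%:E).
Proof.
move=> mU U0; pose h := fun xy : R * R => U (cpt xy).
have mh : measurable_fun setT h by exact: mU.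
have h0 z : 0 <= h z by exact: U0.
have mA : measurable (A : set MR) by exact: measurable_itv.
pose k := fun x y : R => (x * y + 0)%R; pose j := fun x y : R => `|x|%R.
have mk : measurable_fun [set: R * R] (fun z : R * R => k z.1 z.2).
  by apply: measurable_funD => //; apply: measurable_funM.
have mj : measurable_fun [set: R * R] (fun z : R * R => j z.1 z.2).
  by apply: measurableT_comp.
have j0 (x y : R) : (0 <= j x y)%R by rewrite /j.
have [mT mJ _ S] := plane_subst_y mk mj j0 (fun x x0 => line_subst_affine 0%R x0).
have mhT := plane_subst_measurable mT mJ mh.
have hT0 (z : R * R) : 0 <= h (z.1, k z.1 z.2) * (j z.1 z.2)%:E by rewrite mule_ge0// lee_fin.
rewrite /area -/h (S _ mh h0) (plane_integral_yx mhT hT0).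
have [_ _ _ ->] := line_subst_tan R; last 2 first.
- exact: (measurable_integral_x mhT hT0).
- by move=> y; apply: integral_ge0 => x _; exact: hT0.
pose g (z : R * R) := h (z.1 * cos z.2, z.1 * sin z.2)%R * (`|z.1| * \1_A z.2)%:E.
have mg : measurable_fun [set: R * R] g.
  apply: emeasurable_funM; first exact: (measurableT_comp mh polar_measurable).
  apply/measurable_EFinP; apply: measurable_funM; first exact: measurableT_comp.
  by apply: measurableT_comp => //; exact: measurable_indic.
have g0 z : 0 <= g z by rewrite /g mule_ge0// lee_fin mulr_ge0.
transitivity (\int[mu]_t \int[mu]_s g (s, t)).
  apply: eq_integral => t _; rewrite !patchE; case: ifPn => [/set_mem tA|tA]; last first.
    rewrite mule0 integral0_eq// => s _; rewrite /g indicE (negbTE tA) mulr0 mule0//.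
  have c0 : (0 < cos t)%R by apply: cos_gt0_pihalf; move: tA; rewrite /= in_itv.
  have c1 : cos t != 0%R by rewrite gt_eqF.
  have [_ _ _ H] := line_subst_affine 0%R c1.
  rewrite H; last 2 first.
  - exact: (@measurable_slice_x R (fun z => h (z.1, k z.1 z.2) * (j z.1 z.2)%:E) (tan t) mhT).
  - by move=> x; exact: hT0.
  rewrite -ge0_integralZr//; last 3 first.
  - apply: emeasurable_funM => //.
    have m1 : measurable_fun [set: R] (fun x : R => cos t * x + 0)%R.
      by apply: measurable_funD => //; apply: measurable_funM.
    exact: (measurableT_comp (@measurable_slice_x R (fun z => h (z.1, k z.1 z.2) * (j z.1 z.2)%:E) (tan t) mhT) m1).
  - by move=> x _; rewrite mule_ge0// lee_fin.
  - by rewrite lee_fin invr_ge0 sqr_ge0.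
  apply: eq_integral => s _; rewrite /g /k /j !addr0 indicE (mem_set tA) mulr1.
  rewrite -!muleA -!EFinM; congr (h (_, _) * _%:E).
  - by rewrite mulrC.
  - by rewrite /tan /=; field.
  - by rewrite /= normrM gtr0_norm//; field.
rewrite -(plane_integral_yx mg g0) (plane_integral_xy mg g0).
rewrite integral_halfline_fold; last 2 first.
- exact: (measurable_integral_y mg g0).
- by move=> s; apply: integral_ge0.
apply: eq_integral => r /set_mem /=; rewrite in_itv /= andbT => r0.
have [m1 m2] := circ_measurable r mU.
rewrite -ge0_integralD//; last 2 first.
- exact: measurable_slice_y.
- exact: measurable_slice_y.
rewrite -ge0_integralZr//; last 3 first.
- by apply: measurable_funTS; exact: emeasurable_funD.
- by move=> t _; rewrite adde_ge0.
- by rewrite lee_fin ltW.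
rewrite [RHS]integral_mkcond; apply: eq_integral => t _; rewrite patchE /g !indicE.
case: ifPn => tA; last by rewrite /= !mulr0 !mule0 adde0.
rewrite /h /= opp_circE circE normrN gtr0_norm// mulr1.
by rewrite ge0_muleDl.
Qed.

End PolarCoordinates.

(** * Gamma, Beta and the radial moments *)

Section GammaBeta.
Local Open Scope ereal_scope.
Variable R : realType.
Local Notation mu := (@lebesgue_measure R).
Local Notation MR := (measurableTypeR R).
Local Notation H := (`]0%R, +oo[%classic : set R).

(* In the library t `^ x is 1 for t < 0. *)
Definition halfpow (x t : R) : R := (if 0 < t then t `^ x else 0)%R.

Lemma halfpowE x t : (0 < t)%R -> halfpow x t = (t `^ x)%R.
Proof. by rewrite /halfpow => ->. Qed.

Lemma halfpow0 x t : (t <= 0)%R -> halfpow x t = 0%R.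
Proof. by rewrite /halfpow ltNge => ->. Qed.

Lemma halfpow_ge0 x t : (0 <= halfpow x t)%R.
Proof. by rewrite /halfpow; case: ifPn => // _; exact: powR_ge0. Qed.

Lemma measurable_halfpow x : measurable_fun [set: R] (halfpow x).
Proof.
have mH : measurable (H : set MR) by exact: measurable_itv.
have := (measurable_restrictT (fun t : R => t `^ x)%R mH).1 (measurable_funTS (measurable_powR x)).
rewrite (_ : _ \_ _ = halfpow x)//; apply/funext => t; rewrite patchE /halfpow.
by rewrite mem_setE in_itv /= andbT.
Qed.

Lemma halfpowM x c t : (0 < c)%R -> halfpow x (c * t) = (c `^ x * halfpow x t)%R.
Proof.
move=> c0; rewrite /halfpow pmulr_rgt0//; case: ifPn => t0; last by rewrite mulr0.
by rewrite powRM// ltW.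
Qed.

Lemma halfpowD x y t : (halfpow x t * halfpow y t)%R = halfpow (x + y) t.
Proof.
rewrite /halfpow; case: ifPn => t0; last by rewrite mul0r.
by rewrite powRD// (gt_eqF t0) implybT.
Qed.

Definition eGamma x := \int[mu]_t (halfpow (x - 1) t * expR (- t))%:E.

Lemma GammaE x : Gamma x = fine (eGamma x).
Proof.
congr fine; rewrite [LHS]integral_mkcond; apply: eq_integral => t _.
rewrite patchE /halfpow (_ : (t \in _) = (0 < t)%R); last first.
  by apply/idP/idP => [/set_mem//|t0]; exact/mem_set.
by case: ifPn => // _; rewrite mul0r.
Qed.

Let measurable_expN c : measurable_fun [set: R] (fun t : R => expR (- (c * t)))%R.
Proof.
apply: measurableT_comp; first exact: measurable_expR.
by apply: measurableT_comp => //; exact: measurable_funM.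
Qed.

Let measurable_gamma c x : measurable_fun [set: R] (fun t => (halfpow x t * expR (- (c * t)))%:E).
Proof.
by apply/measurable_EFinP; apply: measurable_funM; [exact: measurable_halfpow|exact: measurable_expN].
Qed.

Lemma eGamma_ge0 x : 0 <= eGamma x.
Proof. by apply: integral_ge0 => t _; rewrite lee_fin mulr_ge0 ?halfpow_ge0 ?expR_ge0. Qed.

Lemma eGamma_scale c x : (0 < c)%R ->
  \int[mu]_t (halfpow (x - 1) t * expR (- (c * t)))%:E = (c `^ (- x))%:E * eGamma x.
Proof.
move=> c0; have [_ _ _ L] := line_subst_pos_affine 0%R c0.
have E : eGamma x = (c `^ x)%:E * \int[mu]_t (halfpow (x - 1) t * expR (- (c * t)))%:E.
  rewrite /eGamma L; last 2 first.
  - by have := measurable_gamma 1%R (x - 1); under eq_fun do rewrite mul1r.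
  - by move=> t; rewrite lee_fin mulr_ge0 ?halfpow_ge0 ?expR_ge0.
  rewrite -ge0_integralZl//; last 3 first.
  - exact: measurable_gamma.
  - by move=> t _; rewrite lee_fin mulr_ge0 ?halfpow_ge0 ?expR_ge0.
  - by rewrite lee_fin powR_ge0.
  apply: eq_integral => t _; rewrite addr0 halfpowM// -!EFinM; congr EFin.
  have -> : (c `^ x = c `^ (x - 1) * c)%R by rewrite -{3}(powRr1 (ltW c0)) -powRD ?subrK// (gt_eqF c0) implybT.
  by ring.
rewrite E muleA -EFinM -powRD ?addNr ?powRr0 ?mul1e//.
by rewrite (gt_eqF c0) implybT.
Qed.

(** Euler's Beta function in its half-line form. Extended values let Tonelli relate it to [eGamma]
    with no convergence condition. *)
Definition eBeta x y := \int[mu]_t (halfpow (y - 1) t * (1 + t) `^ (- (x + y)))%:E.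

(* Tonelli for t^(x+y-1) s^(y-1) e^(-(1+s)t), whose two inner integrals are rescaled
   Gamma integrals. *)
Lemma eGamma_mul x y : eGamma x * eGamma y = eGamma (x + y) * eBeta x y.
Proof.
pose g (z : R * R) := (halfpow (x + y - 1) z.1 * halfpow (y - 1) z.2 *
  expR (- ((1 + z.2) * z.1)))%:E.
have mg : measurable_fun [set: R * R] g.
  apply/measurable_EFinP; apply: measurable_funM.
    by apply: measurable_funM; apply: measurableT_comp => //; exact: measurable_halfpow.
  apply: measurableT_comp; first exact: measurable_expR.
  apply: measurableT_comp; first exact: oppr_measurable.
  by apply: measurable_funM => //; exact: measurable_funD.
have g0 z : 0 <= g z by rewrite lee_fin !mulr_ge0 ?halfpow_ge0 ?expR_ge0.
have := plane_integral_xy mg g0; rewrite (plane_integral_yx mg g0) => E.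
transitivity (\int[mu]_t \int[mu]_s g (t, s)).
  transitivity (\int[mu]_t ((halfpow (x - 1) t * expR (- t))%:E * eGamma y)).
    rewrite ge0_integralZr; [by []|exact: measurableT| | |exact: eGamma_ge0].
    - by have := measurable_gamma 1%R (x - 1); under eq_fun do rewrite mul1r.
    - by move=> t _; rewrite lee_fin mulr_ge0 ?halfpow_ge0 ?expR_ge0.
  apply: eq_integral => t _; have [t0|t0] := ltP 0%R t; last first.
    rewrite (halfpow0 _ t0) mul0r mul0e integral0_eq; [by []|move=> s _].
    by rewrite /g /= (halfpow0 _ t0) !mul0r.
  transitivity (\int[mu]_s ((halfpow (x + y - 1) t * expR (- t))%:E *
     (halfpow (y - 1) s * expR (- (t * s)))%:E)); last first.
    apply: eq_integral => s _; rewrite -EFinM /g /= mulrDl mul1r opprD expRD (mulrC s).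
    by congr EFin; ring.
  rewrite ge0_integralZl; last 4 first.
  - exact: measurableT.
  - exact: measurable_gamma.
  - by move=> s _; rewrite lee_fin mulr_ge0 ?halfpow_ge0 ?expR_ge0.
  - by rewrite lee_fin mulr_ge0 ?halfpow_ge0 ?expR_ge0.
  rewrite (eGamma_scale _ t0) muleA -EFinM; congr (_%:E * _).
  rewrite mulrAC; congr (_ * _)%R; rewrite -(halfpowE _ t0) halfpowD.
  by congr halfpow; ring.
rewrite -E.
transitivity (\int[mu]_t (eGamma (x + y) * (halfpow (y - 1) t * (1 + t) `^ (- (x + y)))%:E)); last first.
  rewrite ge0_integralZl; [by []|exact: measurableT| | |exact: eGamma_ge0].
  - apply/measurable_EFinP; apply: measurable_funM; first exact: measurable_halfpow.
    apply: (measurableT_comp (measurable_powR _)).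
    exact: measurable_funD.
  - by move=> t _; rewrite lee_fin mulr_ge0 ?halfpow_ge0 ?powR_ge0.
apply: eq_integral => s _; have [s0|s0] := ltP 0%R s; last first.
  rewrite (halfpow0 _ s0) mul0r mule0 integral0_eq; [by []|move=> t _].
  by rewrite /g /= (halfpow0 _ s0) mulr0 mul0r.
transitivity (\int[mu]_t ((halfpow (y - 1) s)%:E *
   (halfpow (x + y - 1) t * expR (- ((1 + s) * t)))%:E)).
  by apply: eq_integral => t _; rewrite -EFinM /g /=; congr EFin; ring.
rewrite ge0_integralZl; last 4 first.
- exact: measurableT.
- exact: measurable_gamma.
- by move=> t _; rewrite lee_fin mulr_ge0 ?halfpow_ge0 ?expR_ge0.
- by rewrite lee_fin halfpow_ge0.
have s1 : (0 < 1 + s)%R by rewrite addr_gt0.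
by rewrite (eGamma_scale _ s1) muleA -EFinM muleC.
Qed.

(** The total mass of the exponential law of rate 1, whose density differs from the integrand only
    at 0. *)
Lemma eGamma1 : eGamma 1 = 1.
Proof.
rewrite -(@integral_exponential_pdf R 1%R ltr01) /eGamma subrr.
apply: eq_integral_off0.
- by have := measurable_gamma 1%R 0%R; under eq_fun do rewrite mul1r.
- by apply/measurable_EFinP; exact: measurable_exponential_pdf.
move=> t t0; congr EFin; have [tp|tn] := ltP 0%R t.
  by rewrite exponential_pdfE ?ltW// halfpowE// powRr0 !mul1r mulN1r.
by rewrite halfpow0// mul0r lt0_exponential_pdf// lt_neqAle t0.
Qed.

Lemma eGamma_lty x : (1 <= x)%R -> eGamma x < +oo.
Proof.
move=> x1; pose s := (x - 1)%R; have s0 : (0 <= s)%R by rewrite subr_ge0.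
have [C C0 HC] : exists2 C : R, (0 <= C)%R & forall t, (0 < t)%R -> (t `^ s <= C * expR (t / 2))%R.
  have [->|sn0] := eqVneq s 0%R.
    exists 1%R => // t t0; rewrite powRr0 mul1r -expR0 ler_expR.
    by rewrite divr_ge0// ltW.
  have sp : (0 < s)%R by rewrite lt_neqAle eq_sym sn0.
  (* Put u = t / (2 s): then t^s = (2 s)^s u^s, and ln u <= u bounds u^s by e^(s u) = e^(t / 2). *)
  exists ((2 * s) `^ s)%R; first exact: powR_ge0.
  move=> t t0; have s2 : (0 < 2 * s)%R by rewrite mulr_gt0.
  have -> : t = (2 * s * (t / (2 * s)))%R by field; exact: lt0r_neq0.
  have q0 : (0 < t / (2 * s))%R by rewrite divr_gt0.
  rewrite (powRM _ (ltW s2) (ltW q0)) (ler_wpM2l (powR_ge0 _ _))// /powR (gt_eqF q0) ler_expR.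
  have -> : (2 * s * (t / (2 * s)) / 2 = s * (t / (2 * s)))%R by field; exact: lt0r_neq0.
  by rewrite ler_wpM2l// (ltW (ln_sublinear q0)).
have h0 : (0 < 2^-1 :> R)%R by rewrite invr_gt0.
apply: (@le_lt_trans _ _ (\int[mu]_t (C%:E * (halfpow (1 - 1) t * expR (- (2^-1 * t)))%:E))).
  apply: ge0_le_integral => //.
  - by move=> t _; rewrite lee_fin mulr_ge0 ?halfpow_ge0 ?expR_ge0.
  - by have := measurable_gamma 1%R (x - 1); under eq_fun do rewrite mul1r.
  - by apply: emeasurable_funM => //; exact: measurable_gamma.
  move=> t _; rewrite -EFinM lee_fin; have [t0|t0] := ltP 0%R t; last first.
    by rewrite !halfpow0// !mul0r mulr0.
  rewrite !halfpowE// subrr powRr0 mul1r.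
  apply: (le_trans (ler_wpM2r (expR_ge0 _) (HC t t0))).
  by rewrite -mulrA -expRD ler_wpM2l// ler_expR; lra.
rewrite ge0_integralZl; last 4 first.
- exact: measurableT.
- exact: measurable_gamma.
- by move=> t _; rewrite lee_fin mulr_ge0 ?halfpow_ge0 ?expR_ge0.
  by rewrite lee_fin.
by rewrite (eGamma_scale _ h0) eGamma1 mule1 -EFinM ltry.
Qed.

Lemma eGamma_gt0 x : (1 <= x)%R -> 0 < eGamma x.
Proof.
move=> x1.
apply: (@lt_le_trans _ _ (\int[mu]_(t in `[1%R, 2%R]) (expR (- 2))%:E)).
  have -> : \int[mu]_(t in `[1%R, 2%R]) (expR (- 2) : R)%:E = (expR (- 2) : R)%:E * mu (`[1%R, 2%R]%classic : set R).
    by rewrite -integral_cst//; exact: measurable_itv.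
  rewrite lebesgue_measure_itv /= lte_fin ltr1n -EFinB -EFinM lte_fin.
  by rewrite mulr_gt0 ?expR_gt0// subr_gt0 ltr1n.
rewrite /eGamma integral_mkcond; apply: ge0_le_integral => //.
- by move=> t _; rewrite erestrict_ge0// => ? _; rewrite lee_fin expR_ge0.
- by apply/(measurable_restrictT _ _).1 => //; exact: measurable_itv.
- by have := measurable_gamma 1%R (x - 1); under eq_fun do rewrite mul1r.
move=> t _; rewrite patchE; case: ifPn => [/set_mem|_]; last first.
  by rewrite lee_fin mulr_ge0 ?halfpow_ge0 ?expR_ge0.
rewrite /= in_itv /= => /andP[t1 t2]; rewrite lee_fin halfpowE ?(lt_le_trans ltr01)//.
rewrite -[leLHS]mul1r; apply: ler_pM; rewrite ?expR_ge0 ?ler_expR ?lerN2//.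
by rewrite -[leLHS](powRr0 t) ler_powR// subr_ge0.
Qed.

End GammaBeta.

Section RadialWeight.
Local Open Scope ereal_scope.
Variable R : realType.
Local Notation mu := (@lebesgue_measure R).
Local Notation MR := (measurableTypeR R).
Local Notation I01 := (`]0%R, 1%R[%classic : set R).

Definition radial_density (alpha r : R) : R := ((1 - r ^+ 2) `^ alpha * r)%R.

Let sqr_lt1 (r : R) : (0 < r < 1)%R -> (0 < 1 - r ^+ 2)%R.
Proof. by move=> /andP[r0 r1]; rewrite subr_gt0 expr_lt1// ltW. Qed.

(** The coordinate is s = ln (r^2 / (1 - r^2)), with inverse the square root of e^s / (1 + e^s).
    Combined with t = e^s it turns the half-line Beta integral into an integral over 0 < r < 1. *)
Lemma line_subst_odds : line_subst
  ((fun r : R => 2 * ln r - ln (1 - r ^+ 2))%R \_ I01)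
  ((fun r : R => 2 * r^-1 + 2 * r * (1 - r ^+ 2)^-1 : R)%R \_ I01).
Proof.
pose G (s : R) := expR ((s - ln (1 + expR s)) / 2) : R.
have e1 s : (0 < 1 + expR s :> R)%R by rewrite addr_gt0 ?expR_gt0.
have e2 s : (s < ln (1 + expR s) :> R)%R.
  by rewrite -{1}(expRK s) ltr_ln ?posrE ?expR_gt0// ltrDr.
have G0 s : (0 < G s)%R by exact: expR_gt0.
have G1 s : (G s < 1)%R.
  by rewrite -expR0 ltr_expR pmulr_llt0 ?invr_gt0// subr_lt0.
have G2 s : (1 - G s ^+ 2 = (1 + expR s)^-1)%R.
  rewrite /G -expRM_natr -(mulr_natr _ 2) divfK// expRD expRN lnK ?posrE//.
  by field; rewrite gt_eqF.
apply: (@line_subst_bij R _ _ G).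
- exact: interval_open.
- move=> x y t /=; rewrite !in_itv /= => /andP[x0 x1] /andP[y0 y1] /andP[xt ty].
  by rewrite (lt_le_trans x0 xt) (le_lt_trans ty y1).
- move=> s /=; rewrite in_itv /= G0 G1; split => //.
  rewrite G2 lnV ?posrE// /G expRK; by field.
- move=> r /=; rewrite in_itv /= => r01; have /andP[r0 _] := r01.
  have q0 := sqr_lt1 r01.
  have E : (expR (2 * ln r - ln (1 - r ^+ 2)) = r ^+ 2 / (1 - r ^+ 2))%R.
    by rewrite expRD expRN lnK ?posrE// mulr_natl -lnXn// lnK// posrE exprn_gt0.
  rewrite /G E (_ : 1 + r ^+ 2 / (1 - r ^+ 2) = (1 - r ^+ 2)^-1)%R; last by field; rewrite gt_eqF.
  rewrite lnV ?posrE// opprK subrK mulrAC divff// mul1r lnK//.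
- move=> s t st; rewrite /G ltr_expR ltr_pM2r ?invr_gt0//.
  suff L : (ln (1 + expR t) < (t - s) + ln (1 + expR s))%R by lra.
  rewrite -[X in (X + ln _)%R]expRK -lnM ?posrE ?expR_gt0//.
  rewrite ltr_ln ?posrE ?mulr_gt0 ?expR_gt0// mulrDr mulr1 -expRD subrK ltrD2r.
  by rewrite -expR0 ltr_expR subr_gt0.
- move=> r /=; rewrite in_itv /= => r01; have /andP[r0 _] := r01.
  have q0 := sqr_lt1 r01.
  have d0 : is_derive r 1%R (fun r : R => r ^+ 2)%R (2 * r)%R.
    have := is_deriveM (is_derive_id r (1%R : R)) (is_derive_id r (1%R : R)).
    by rewrite /GRing.scale/= !mulr1 mulr_natl mulr2n.
  have d1 : is_derive r 1%R (fun r : R => 1 - r ^+ 2)%R (0 - 2 * r)%R.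
    exact: (is_deriveB (is_derive_cst (1%R : R) r (1%R : R)) d0).
  have d2 : is_derive r 1%R (fun r : R => ln (1 - r ^+ 2))%R ((1 - r ^+ 2)^-1 * (0 - 2 * r))%R.
    exact: (@is_derive1_comp R (@ln R) (fun r : R => 1 - r ^+ 2)%R r _ _ (is_derive1_ln q0) d1).
  have d3 := is_deriveZ 2%R (is_derive1_ln r0).
  have -> : (2 / r + 2 * r / (1 - r ^+ 2) = 2 *: r^-1 - (1 - r ^+ 2)^-1 * (0 - 2 * r))%R.
    by rewrite /GRing.scale/=; ring.
  exact: (is_deriveB d3 d2).
- move=> r /=; rewrite in_itv /= => r01; have /andP[r0 _] := r01.
  by rewrite addr_ge0// !mulr_ge0 ?invr_ge0 ?ltW// sqr_lt1.
- move=> r /=; rewrite in_itv /= => r01; have /andP[r0 _] := r01.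
  apply: cvgD; first by apply: cvgM; [exact: cvg_cst|apply: cvgV; [rewrite gt_eqF|exact: cvg_id]].
  apply: cvgM; first by apply: cvgM; [exact: cvg_cst|exact: cvg_id].
  apply: cvgV; first by rewrite gt_eqF// sqr_lt1.
  by apply: cvgB; [exact: cvg_cst|exact: exprn_continuous].
Qed.

(* t = r^2 / (1 - r^2). *)
Lemma eBeta_radial (alpha b : R) : eBeta (alpha + 1) (b + 1) =
  2%:E * \int[mu]_(r in I01) (r `^ (2 * b) * radial_density alpha r)%:E.
Proof.
pose k t := (halfpow (b + 1 - 1) t * (1 + t) `^ (- (alpha + 1 + (b + 1))))%:E : \bar R.
have mk : measurable_fun [set: R] k.
  apply/measurable_EFinP; apply: measurable_funM; first exact: measurable_halfpow.
  by apply: (measurableT_comp (measurable_powR _)); exact: measurable_funD.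
have k0 t : 0 <= k t by rewrite lee_fin mulr_ge0 ?halfpow_ge0 ?powR_ge0.
have -> : eBeta (alpha + 1) (b + 1) = \int[mu]_(t in `]0%R, +oo[) k t.
  rewrite [RHS]integral_mkcond; apply: eq_integral => t _; rewrite patchE.
  case: ifPn => // tn; rewrite halfpow0 ?mul0r// leNgt; apply: contra tn => t0.
  by apply/mem_set; rewrite /= in_itv /= t0.
rewrite -(integral_exp_subst mk k0).
have [_ _ _ ->] := line_subst_odds; last 2 first.
- apply: emeasurable_funM; last by apply/measurable_EFinP; exact: measurable_expR.
  by apply: measurableT_comp => //; exact: measurable_expR.
- by move=> x; rewrite mule_ge0// lee_fin expR_ge0.
rewrite -ge0_integralZl; last 4 first.
- exact: measurable_itv.
- apply/measurable_EFinP; apply: measurable_funM; first exact: measurable_funTS (measurable_powR _).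
  apply: measurable_funM => //; apply: measurable_funTS; apply: (measurableT_comp (measurable_powR _)).
  by apply: measurable_funB => //; exact: measurable_funX.
- move=> r /=; rewrite in_itv /= => /andP[r0 _].
  by rewrite lee_fin !mulr_ge0 ?powR_ge0// ltW.
- by rewrite lee_fin.
rewrite [RHS]integral_mkcond; apply: eq_integral => r _; rewrite !patchE.
case: ifPn => [/set_mem|_]; last by rewrite mule0.
rewrite /= in_itv /= => r01; have /andP[r0 r1] := r01; have q0 := sqr_lt1 r01.
rewrite /k halfpowE ?expR_gt0// -!EFinM addrK; congr EFin.
have E : (1 + expR (2 * ln r - ln (1 - r ^+ 2)) = expR (- ln (1 - r ^+ 2)))%R.
  rewrite expRD expRN lnK ?posrE// mulr_natl -lnXn// lnK ?posrE ?exprn_gt0//.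
  by field; rewrite gt_eqF.
rewrite E /radial_density /powR !gt_eqF ?expR_gt0// !expRK.
have -> : (2 * r^-1 + 2 * r * (1 - r ^+ 2)^-1 = 2 * (expR (- ln r) * expR (- ln (1 - r ^+ 2))))%R.
  by rewrite !expRN !lnK ?posrE//; field; rewrite !gt_eqF.
rewrite mulrCA; congr (_ * _)%R.
rewrite -[X in (_ = _ * (_ * X))%R](lnK (x := r)) ?posrE//.
rewrite -!expRD; congr expR; ring.
Qed.

(** The substitution 1 + t = e^s turns the integral of (1 + t)^(-x-1) into a rescaled [eGamma 1]. *)
Lemma eBeta1 (x : R) : (0 < x)%R -> eBeta x 1 = (x^-1)%:E.
Proof.
move=> x0.
(* The first factor is the indicator of t > 1. *)
pose k t := (halfpow 0 (t - 1) * halfpow (- (x + 1)) t)%:E : \bar R.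
have mk : measurable_fun [set: R] k.
  apply/measurable_EFinP; apply: measurable_funM; last exact: measurable_halfpow.
  by apply: (measurableT_comp (measurable_halfpow _)); exact: measurable_funB.
have k0 t : 0 <= k t by rewrite lee_fin mulr_ge0 ?halfpow_ge0.
transitivity (\int[mu]_t k t).
  have [_ _ _ ->//] := line_subst_pos_affine 1%R (ltr01 : (0 < 1 :> R)%R).
  apply: eq_integral => t _; rewrite mule1 /k mul1r addrK subrr.
  have [t0|t0] := ltP 0%R t; last by rewrite !(halfpow0 _ t0) !mul0r.
  by rewrite (halfpowE (- (x + 1))) ?addr_gt0// (addrC t).
have -> : \int[mu]_t k t = \int[mu]_(t in `]0%R, +oo[) k t.
  rewrite [RHS]integral_mkcond; apply: eq_integral => t _; rewrite patchE.
  case: ifPn => // tn; rewrite /k (halfpow0 (- _)) ?mulr0// leNgt; apply: contra tn => t0.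
  by apply/mem_set; rewrite /= in_itv /= t0.
rewrite -(integral_exp_subst mk k0).
transitivity (\int[mu]_s (halfpow (1 - 1) s * expR (- (x * s)))%:E).
  apply: eq_integral => s _; rewrite /k subrr (halfpowE _ (expR_gt0 s)).
  have [s0|s0] := ltP 0%R s; last by rewrite !halfpow0 ?mul0r ?mul0e// subr_le0 -expR0 ler_expR.
  rewrite !halfpowE ?powRr0; [|exact: s0|by rewrite subr_gt0 -expR0 ltr_expR].
  rewrite !mul1r -EFinM; congr EFin; rewrite /powR gt_eqF ?expR_gt0// expRK -expRD.
  by congr expR; ring.
by rewrite eGamma_scale// eGamma1 mule1 powR_inv1// ltW.
Qed.

Lemma Gamma_gt0 (x : R) : (1 <= x)%R -> (0 < Gamma x)%R.
Proof. by move=> x1; rewrite GammaE fine_gt0// eGamma_gt0// eGamma_lty. Qed.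

Lemma eGamma_fin (x : R) : (1 <= x)%R -> eGamma x = (Gamma x)%:E.
Proof.
move=> x1; rewrite GammaE fineK// ge0_fin_numE ?eGamma_lty//.
exact: eGamma_ge0.
Qed.

Lemma radial_moments (alpha b : R) : (-1 < alpha)%R -> (0 <= b)%R ->
  exists2 I : R, (0 < I)%R &
    \int[mu]_(r in I01) (radial_density alpha r)%:E = I%:E /\
    \int[mu]_(r in I01) (r `^ (2 * b) * radial_density alpha r)%:E =
    (Gamma (b + 1) * Gamma (2 + alpha) / Gamma (b + 2 + alpha) * I)%:E.
Proof.
move=> a1 b0; have a0 : (0 < alpha + 1)%R by rewrite -ltrBlDr sub0r.
exists (2^-1 * (alpha + 1)^-1)%R; first by rewrite mulr_gt0 ?invr_gt0.
have two_cancel (X : \bar R) (y : R) : 2%:E * X = y%:E -> X = (2^-1 * y)%:E.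
  by rewrite EFinM => <-; rewrite muleA -EFinM mulVf ?mul1e.
split.
  apply: two_cancel; rewrite -(eBeta1 a0).
  have := eBeta_radial alpha 0%R; rewrite add0r => ->; congr (_ * _).
  by apply: eq_integral => r _; rewrite mulr0 powRr0 mul1r.
rewrite mulrCA; apply: two_cancel; rewrite -eBeta_radial.
have g2 : (1 <= 2 + alpha)%R by lra.
have gb : (1 <= b + 1)%R by lra.
have gb2 : (1 <= b + 2 + alpha)%R by lra.
(* Here alpha + 1 may be less than 1, outside the range of [eGamma_fin]; the value comes from the
   recurrence, that is from [eGamma_mul] with second argument 1. *)
have EG : eGamma (alpha + 1) = (Gamma (2 + alpha) / (alpha + 1))%:E.
  have := eGamma_mul (alpha + 1) 1; rewrite eGamma1 mule1 => ->.
  by rewrite (eBeta1 a0) (_ : alpha + 1 + 1 = 2 + alpha)%R ?eGamma_fin//; ring.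
have := eGamma_mul (alpha + 1) (b + 1).
rewrite EG.
rewrite (_ : alpha + 1 + (b + 1) = b + 2 + alpha)%R; last by ring.
rewrite !eGamma_fin// => E.
have gn := Gamma_gt0 gb2; have gn0 : (Gamma (b + 2 + alpha) != 0)%R by rewrite gt_eqF.
have -> : eBeta (alpha + 1) (b + 1) =
    ((Gamma (b + 2 + alpha))^-1)%:E * ((Gamma (b + 2 + alpha))%:E * eBeta (alpha + 1) (b + 1)).
  by rewrite muleA -EFinM mulVf ?mul1e.
rewrite -E -!EFinM; congr EFin; move: gn0 (lt0r_neq0 a0); clear.
by move: (Gamma (b + 2 + alpha)) (Gamma (2 + alpha)) (Gamma (b + 1)) => g3 g2 g1 g0 q0; field; rewrite g0 q0.
Qed.

End RadialWeight.

(** * Chebyshev's integral inequality and measurability in the plane *)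

Section Chebyshev.
Local Open Scope ereal_scope.
Context d (T : measurableType d) (R : realType) (mu : {measure set T -> \bar R}).
Variable D : set T.
Hypothesis mD : measurable D.

Let lin (F G : T -> R) (a b : \bar R) : measurable_fun D F -> measurable_fun D G ->
  (forall x, D x -> (0 <= F x)%R) -> (forall x, D x -> (0 <= G x)%R) -> 0 <= a -> 0 <= b ->
  \int[mu]_(x in D) ((F x)%:E * a + (G x)%:E * b) =
  (\int[mu]_(x in D) (F x)%:E) * a + (\int[mu]_(x in D) (G x)%:E) * b.
Proof.
move=> /measurable_EFinP mF /measurable_EFinP mG F0 G0 a0 b0.
rewrite ge0_integralD//.
- by congr (_ + _); apply: ge0_integralZr => // x Dx; rewrite lee_fin ?F0 ?G0.
- by move=> x Dx; rewrite mule_ge0// lee_fin F0.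
- exact: emeasurable_funM.
- by move=> x Dx; rewrite mule_ge0// lee_fin G0.
- exact: emeasurable_funM.
Qed.

(* Integrate (f x - f y) (g x - g y) w x w y >= 0 in both variables. *)
Lemma chebyshev_integral (f g w : T -> R) :
  measurable_fun D f -> measurable_fun D g -> measurable_fun D w ->
  (forall x, D x -> (0 <= f x)%R) -> (forall x, D x -> (0 <= g x)%R) ->
  (forall x, D x -> (0 <= w x)%R) ->
  (forall x y, D x -> D y -> (0 <= (f x - f y) * (g x - g y))%R) ->
  (\int[mu]_(x in D) (f x * w x)%:E) * (\int[mu]_(x in D) (g x * w x)%:E) <=
  (\int[mu]_(x in D) (f x * g x * w x)%:E) * (\int[mu]_(x in D) (w x)%:E).
Proof.
move=> mf mg mw f0 g0 w0 fg.
set X := \int[mu]_(x in D) (f x * w x)%:E; set Y := \int[mu]_(x in D) (g x * w x)%:E.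
set Z := \int[mu]_(x in D) (f x * g x * w x)%:E; set W := \int[mu]_(x in D) (w x)%:E.
have mfw := measurable_funM mf mw; have mgw := measurable_funM mg mw.
have mfgw := measurable_funM (measurable_funM mf mg) mw.
have fw0 x : D x -> (0 <= f x * w x)%R by move=> Dx; exact: (mulr_ge0 (f0 x Dx) (w0 x Dx)).
have gw0 x : D x -> (0 <= g x * w x)%R by move=> Dx; exact: (mulr_ge0 (g0 x Dx) (w0 x Dx)).
have fgw0 x : D x -> (0 <= f x * g x * w x)%R.
  by move=> Dx; exact: (mulr_ge0 (mulr_ge0 (f0 x Dx) (g0 x Dx)) (w0 x Dx)).
have X0 : 0 <= X by apply: integral_ge0 => x Dx; rewrite lee_fin fw0.
have Y0 : 0 <= Y by apply: integral_ge0 => x Dx; rewrite lee_fin gw0.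
have Z0 : 0 <= Z by apply: integral_ge0 => x Dx; rewrite lee_fin fgw0.
have W0 : 0 <= W by apply: integral_ge0 => x Dx; rewrite lee_fin w0.
have mlin (F G : T -> R) (a b : \bar R) : measurable_fun D F -> measurable_fun D G ->
    measurable_fun D (fun x => (F x)%:E * a + (G x)%:E * b).
  by move=> /measurable_EFinP mF /measurable_EFinP mG; apply: emeasurable_funD; exact: emeasurable_funM.
(* The inequality integrated in x, y being fixed. The negative terms of the expanded product are
   moved to the left, since the integrals may be infinite. *)
have slice y : D y -> (f y * w y)%:E * Y + (g y * w y)%:E * X <=
    (f y * g y * w y)%:E * W + (w y)%:E * Z.
  move=> Dy; rewrite [leLHS]addeC ![(_ * _)%:E * _]muleC ![(w y)%:E * _]muleC.
  rewrite -(lin mfw mgw fw0 gw0)  ?lee_fin ?fw0 ?gw0//.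
  rewrite -(lin mw mfgw w0 fgw0) ?lee_fin ?fgw0 ?w0//.
  apply: ge0_le_integral => //.
  - by move=> x Dx; rewrite -!EFinM -EFinD lee_fin addr_ge0// mulr_ge0 ?fw0 ?gw0.
  - exact: mlin.
  - exact: mlin.
  move=> x Dx; rewrite -!EFinM -!EFinD lee_fin -subr_ge0.
  have := mulr_ge0 (fg x y Dx Dy) (mulr_ge0 (w0 x Dx) (w0 y Dy)).
  by congr (0 <= _)%R => /=; ring.
have : X * Y + Y * X <= Z * W + W * Z.
  rewrite -(lin mfw mgw fw0 gw0 Y0 X0) -(lin mfgw mw fgw0 w0 W0 Z0).
  apply: ge0_le_integral => //.
  - by move=> x Dx; rewrite adde_ge0// mule_ge0// lee_fin ?fw0 ?gw0.
  - exact: mlin.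
  - exact: mlin.
rewrite [Y * X]muleC [W * Z]muleC.
have dbl (x : \bar R) : 0 <= x -> x + x = 2%:E * x.
  by move=> x0; rewrite -{1 2}(mul1e x) -ge0_muleDl.
rewrite !dbl ?mule_ge0// lee_pmul2l//.
Qed.

End Chebyshev.

Section PlaneMeasurability.
Variable R : realType.
Local Notation MR := (measurableTypeR R).

(** Such a set is the countable union of the squares with rational centre and radius that it
    contains, and these belong to the product sigma-algebra. *)
Lemma box_open_measurable (S : set (R * R)) :
  (forall z, S z -> exists2 e : R, 0 < e & forall w, `|w.1 - z.1| < e -> `|w.2 - z.2| < e -> S w) ->
  measurable (S : set (MR * MR)).
Proof.
move=> oS.
pose B (q : rat * rat * rat) : set (MR * MR) :=
  (`](ratr q.1.1 - ratr q.2), (ratr q.1.1 + ratr q.2)[ `*`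
   `](ratr q.1.2 - ratr q.2), (ratr q.1.2 + ratr q.2)[)%classic.
pose F q := if `[< B q `<=` S >] then B q else set0.
have -> : S = \bigcup_(q in setT) F q.
  apply/seteqP; split => [z Sz|z [q _]]; last first.
    by rewrite /F; case: ifPn => // /asboolP; exact.
  have [e e0 He] := oS z Sz.
  have [q3] := @rat_in_itvoo R 0 (e / 2) (divr_gt0 e0 (ltr0Sn R 1)).
  rewrite in_itv /= => /andP[q30 q3e].
  have near_rat x : exists q : rat, x - ratr q3 < ratr q :> R /\ ratr q < x + ratr q3 :> R.
    have [|q] := @rat_in_itvoo R (x - ratr q3) (x + ratr q3); first by lra.
    by rewrite in_itv /= => /andP[]; exists q.
  have [q1 [q11 q12]] := near_rat z.1; have [q2 [q21 q22]] := near_rat z.2.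
  exists (q1, q2, q3) => //; rewrite /F asboolT.
    by split; rewrite /= in_itv /=; apply/andP; split; lra.
  move=> w [] /=; rewrite !in_itv /= => /andP[h1 h2] /andP[h3 h4].
  by apply: He; rewrite ltr_norml; apply/andP; split; lra.
apply: countable_bigcupT_measurable => [|q]; first exact: countableP.
by rewrite /F; case: ifPn => // _; apply: measurableX; exact: measurable_itv.
Qed.

Lemma continuous_on_disk_measurable (F : CC R -> R) :
  (forall z, cabs z < 1 -> {for z, continuous F}) ->
  area_measurable (on_disk (fun z => (F z)%:E)).
Proof.
move=> cF; pose D := [set xy : R * R | cabs (cpt xy) < 1].
have near_plane (P : set (CC R)) xy : (\forall w \near cpt xy, P w) ->
    exists2 e : R, 0 < e & forall w : R * R, `|w.1 - xy.1| < e -> `|w.2 - xy.2| < e -> P (cpt w).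
  move=> /nbhs_CC[d d0 H]; exists (d / 2); first by rewrite divr_gt0.
  move=> w h1 h2; apply: H; apply: le_lt_trans (cabs_le_ReIm _) _.
  case: xy h1 h2 => x y; case: w => u v /=; lra.
have mD : measurable (D : set (MR * MR)).
  by apply: box_open_measurable => z Dz; exact: (near_plane [set w | cabs w < 1] z (disk_nbhs Dz)).
have mF : measurable_fun (D : set (MR * MR)) (fun xy => F (cpt xy) : MR).
  move=> _; apply: (measurability _ (RGenOInfty.measurableE R)) => //.
  move=> _ [_ [c ->] <-].
  apply: box_open_measurable => z [Dz]; rewrite /= in_itv /= andbT => cz.
  have e0 : 0 < F (cpt z) - c by rewrite subr_gt0.
  have H : \forall t \near cpt z, `|F (cpt z) - F t| < F (cpt z) - c.
    exact: ((@cvgrPdist_lt _ _ _ (nbhs (cpt z)) _ F (F (cpt z))).1 (cF _ Dz) _ e0).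
  have [e e1 He] := near_plane _ z (filterI (disk_nbhs Dz) H).
  exists e => // w w1 w2; have [] := He w w1 w2.
  rewrite /= ltr_norml => h1 /andP[_ h2]; split => //.
  by rewrite /= in_itv /= andbT; lra.
have := (measurable_restrictT _ mD).1 mF.
move=> /measurable_EFinP; rewrite /area_measurable; congr (measurable_fun _ _).
apply/funext => xy; rewrite /on_disk /= patchE.
rewrite (_ : (xy \in D) = (cabs (cpt xy) < 1)); last by apply/idP/idP => [/set_mem//|h]; exact/mem_set.
by case: ifP.
Qed.

End PlaneMeasurability.

(** * Division by a Moebius factor *)

Section ComplexPower.
Variable R : realType.
Local Notation rc x := ((x%:C)%C : CC R).
Implicit Types (z w a : CC R).

Let is_derive_dist (f : R -> R) (x d : R) : is_derive x 1 f d ->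
  forall e, 0 < e -> exists2 del, 0 < del &
    forall h, `|h| < del -> `|f (x + h) - f x - d * h| <= e * `|h|.
Proof.
move=> [df vf] e e0.
set D := fun h : R => h^-1 *: ((f \o shift x) (h *: (1 : R)) - f x).
have Dc : D h @[h --> 0^'] --> d by rewrite -vf; exact: df.
have Hn : nbhs (0 : R) (fun h => h != 0 -> `|d - D h| < e) by exact: ((@cvgrPdist_lt _ _ _ (0^') _ D d).1 Dc e e0).
have [del /= del0 H] := (nbhs_ballP (0 : R) _).1 Hn; exists del => // h hd.
have [->|h0] := eqVneq h 0; first by rewrite addr0 mulr0 !subrr normr0 mulr0.
have := H h; rewrite /ball /= sub0r normrN => /(_ hd h0).
have -> : d - D h = - ((f (x + h) - f x - d * h) / h).
  by rewrite /D /= /GRing.scale /= mulr1 (addrC h x); field.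
by rewrite normrN normrM normfV ltr_pdivrMr ?normr_gt0// => /ltW.
Qed.

Definition cexp z : CC R := rc (expR (complex.Re z)) * cis (complex.Im z).

Lemma cexpD z w : cexp (z + w) = cexp z * cexp w.
Proof.
by rewrite /cexp !raddfD /= expRD cisD rmorphM /= mulrACA.
Qed.

Lemma cabs_cexp z : cabs (cexp z) = expR (complex.Re z).
Proof. by rewrite /cexp cabsM cabs_cis mulr1 cabs_real ger0_norm// expR_ge0. Qed.

Lemma cexp_neq0 z : cexp z != 0.
Proof. by rewrite -cabs_gt0 cabs_cexp expR_gt0. Qed.

Lemma is_derive_cexp z : is_derive z 1 cexp (cexp z).
Proof.
apply/is_deriveCP => e e0.
have n0 := cexp_neq0 z; rewrite -cabs_gt0 in n0.
(* After factoring out cexp z, the errors of exp, of the cross term and of cis are at most e', 3 e'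
   and 2 e' times |h|. *)
pose e' := e / (6 * cabs (cexp z)); have e'0 : 0 < e' by rewrite divr_gt0 ?mulr_gt0.
have [d1 d10 H1] := is_derive_dist (is_derive_expR (0 : R)) e'0.
have [d2 d20 H2] := is_derive_dist (is_derive_cos (0 : R)) e'0.
have [d3 d30 H3] := is_derive_dist (is_derive_sin (0 : R)) e'0.
pose e'' := Num.min 1 e'.
have e''0 : 0 < e'' by rewrite lt_min ltr01.
exists (Num.min (Num.min d1 d2) (Num.min d3 e'')).
  by rewrite !lt_min d10 d20 d30 ltr01.
move=> h; rewrite !lt_min => /andP[/andP[h1 h2] /andP[h3 /andP[h4 h5]]].
set x := complex.Re h; set y := complex.Im h.
have xh : `|x| <= cabs h by exact: Re_le_cabs.
have yh : `|y| <= cabs h by exact: Im_le_cabs.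
have {}H1 : `|expR x - 1 - x| <= e' * `|x|.
  by have := H1 x (le_lt_trans xh h1); rewrite add0r expR0 mul1r.
have {}H2 : `|cos y - 1| <= e' * `|y|.
  by have := H2 y (le_lt_trans yh h2); rewrite add0r cos0 sin0 oppr0 mul0r subr0.
have {}H3 : `|sin y - y| <= e' * `|y|.
  by have := H3 y (le_lt_trans yh h3); rewrite add0r sin0 cos0 mul1r subr0.
pose c1 : CC R := cis y - 1 - Complex 0 y.
have C1 : cabs c1 <= 2 * e' * `|y|.
  apply: (le_trans (cabs_le_ReIm _)); rewrite /c1 /cis /=; rewrite !subr0.
  by move: H2 H3; lra.
have C2 : cabs (cis y - 1) <= cabs c1 + `|y|.
  have -> : cis y - 1 = c1 + Complex 0 y by rewrite /c1 subrK.
  apply: (le_trans (cabsD _ _)); rewrite lerD2l.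
  by apply: (le_trans (cabs_le_ReIm _)); rewrite /= normr0 add0r.
have -> : cexp (z + h) - cexp z - cexp z * h =
    cexp z * (rc (expR x - 1 - x) * cis y + rc x * (cis y - 1) + c1).
  rewrite cexpD /c1 /cexp -/x -/y.
  have -> : h = rc x + Complex 0 y.
    by rewrite /x /y; case: (h) => u v; rewrite [RHS]/GRing.add /= addr0 add0r.
  rewrite !rmorphB rmorph1; ring.
rewrite cabsM.
suff B : cabs (rc (expR x - 1 - x) * cis y + rc x * (cis y - 1) + c1) <= 6 * e' * cabs h.
  apply: (le_trans (ler_wpM2l (cabs_ge0 _) B)).
  by rewrite le_eqVlt; apply/orP; left; apply/eqP; rewrite /e'; field; exact: lt0r_neq0.
apply: (le_trans (cabsD _ _)); apply: (le_trans (lerD (cabsD _ _) (lexx _))).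
rewrite !cabsM !cabs_real cabs_cis mulr1.
have X1 : `|x| * cabs (cis y - 1) <= 3 * e' * `|y|.
  have m1 : `|x| * cabs (cis y - 1) <= `|x| * (2 * e' * `|y| + `|y|).
    by apply: ler_wpM2l => //; lra.
  apply: (le_trans m1); rewrite mulrDr.
  have m2 : `|x| * (2 * e' * `|y|) <= 1 * (2 * e' * `|y|).
    by apply: ler_wpM2r; [exact: (mulr_ge0 (mulr_ge0 (ler0n _ 2) (ltW e'0)) (normr_ge0 y))|move: xh h4; lra].
  have m3 : `|x| * `|y| <= e' * `|y|.
    by apply: ler_wpM2r => //; move: xh h5; lra.
  lra.
have y1 := ler_wpM2l (ltW e'0) yh; have x1 := ler_wpM2l (ltW e'0) xh.
lra.
Qed.

(** The principal logarithm on the right half-plane, the only region where this arctangent is used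
    as the argument; [moebius_den a z] stays there. *)
Definition clog w : CC R := Complex (ln (cabs w)) (atan (complex.Im w / complex.Re w)).

Lemma cexp_clog w : 0 < complex.Re w -> cexp (clog w) = w.
Proof.
move=> w0; have c0 : 0 < cabs w by apply: (lt_le_trans w0); apply: le_trans (ler_norm _) (Re_le_cabs w).
have E : Num.sqrt (1 + (complex.Im w / complex.Re w) ^+ 2) = cabs w / complex.Re w.
  have -> : 1 + (complex.Im w / complex.Re w) ^+ 2 = (cabs w / complex.Re w) ^+ 2.
    by rewrite !expr_div_n cabs_sqr; field; exact: lt0r_neq0.
  by rewrite sqrtr_sqr ger0_norm// divr_ge0// ?cabs_ge0 ?(ltW w0).
have S : sin (atan (complex.Im w / complex.Re w)) =
    complex.Im w / complex.Re w * cos (atan (complex.Im w / complex.Re w)).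
  rewrite -{2}(atanK (complex.Im w / complex.Re w)) /tan divfK//.
  by rewrite cos_atan invr_eq0 E mulf_neq0 ?invr_eq0 ?lt0r_neq0.
rewrite /cexp /clog /= lnK ?posrE// /cis S cos_atan E.
case: w w0 c0 {E S} => x y /= x0 c0; rewrite [LHS]/GRing.mul /= !mul0r subr0 addr0.
have n0 := lt0r_neq0 c0; have xn0 := lt0r_neq0 x0.
by congr Complex; field; rewrite n0 xn0.
Qed.

Lemma clog_continuous w : 0 < complex.Re w -> {for w, continuous clog}.
Proof.
move=> w0; have c0 : 0 < cabs w by apply: (lt_le_trans w0); apply: le_trans (ler_norm _) (Re_le_cabs w).
apply: (@cvg_Complex R _ (nbhs w) _ (fun w => ln (cabs w))
  (fun w => atan (complex.Im w / complex.Re w)) (ln (cabs w))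
  (atan (complex.Im w / complex.Re w))).
  apply: continuous_cvg; last exact: cabs_continuous.
  exact: continuous_ln.
apply: continuous_cvg; first exact: continuous_atan.
apply: cvgM; first exact: Im_continuous.
by apply: cvgV; [exact: lt0r_neq0|exact: Re_continuous].
Qed.

(* clog is a continuous right inverse of cexp, whose derivative does not vanish. *)
Lemma derivable_clog w : 0 < complex.Re w -> derivable clog w 1.
Proof.
move=> w0; have wn0 : w != 0 by apply: contraTneq w0 => ->; rewrite /= ltxx.
have c0 : 0 < cabs w by rewrite cabs_gt0.
suff : is_derive w 1 clog w^-1 by case.
apply/is_deriveCP => e e0.
(* The first bound absorbs the error and gives |w| |k| <= 2 |h|; the second then turns e' |k| into
   at most e |w| |h|. *)
pose e' := Num.min (cabs w / 2) (e * cabs w ^+ 2 / 2).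
have e'0 : 0 < e' by rewrite lt_min !divr_gt0// mulr_gt0// exprn_gt0.
have dE := is_derive_cexp (clog w); rewrite cexp_clog// in dE.
have [d d0 H] := (is_deriveCP _ _ _).1 dE e' e'0.
have [d2 d20 H2] := (continuous_CCP _ _).1 (clog_continuous w0) d d0.
exists (Num.min d2 (complex.Re w)); first by rewrite lt_min d20.
move=> h; rewrite lt_min => /andP[hd hw].
have wh0 : 0 < complex.Re (w + h).
  by rewrite raddfD /=; have := Re_le_cabs h; rewrite ler_norml => /andP[]; move: hw; lra.
pose k := clog (w + h) - clog w.
have kd : cabs k < d by apply: H2; rewrite addrC addKr.
have kE : clog w + k = clog (w + h) by rewrite /k addrC subrK.
have := H k kd; rewrite kE (cexp_clog w0) (cexp_clog wh0) [w + h - w](addrAC) subrr add0r => B.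
have e'1 : e' <= cabs w / 2 by rewrite ge_min lexx.
have e'2 : e' <= e * cabs w ^+ 2 / 2 by rewrite ge_min lexx orbT.
have K1 : cabs w * cabs k <= 2 * cabs h.
  have B1 : cabs (w * k) - cabs h <= cabs (h - w * k).
    by rewrite cabs_distC; exact: cabs_sub_ge.
  rewrite cabsM in B1; have := ler_wpM2r (cabs_ge0 k) e'1; lra.
rewrite -/k; have -> : k - w^-1 * h = - ((h - w * k) / w) by field.
rewrite cabsN cabs_div ler_pdivrMr//; apply: (le_trans B).
have B2 := ler_wpM2r (cabs_ge0 k) e'2; apply: (le_trans B2).
have := ler_wpM2l (ltW (mulr_gt0 e0 c0)) K1.
have -> : e * cabs w ^+ 2 / 2 * cabs k = 2^-1 * (e * cabs w * (cabs w * cabs k)) by field.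
have -> : e * cabs w * (2 * cabs h) = 2 * (e * cabs h * cabs w) by ring.
lra.
Qed.

Lemma Re_moebius_den_gt0 a z : cabs a < 1 -> cabs z < 1 -> 0 < complex.Re (moebius_den a z).
Proof.
move=> a1 z1; rewrite /moebius_den raddfB /= subr_gt0.
apply: (le_lt_trans (ler_norm _)); apply: (le_lt_trans (Re_le_cabs _)).
rewrite cabsM cabs_conj; exact: (mulr_ilt1 (cabs_ge0 a) (cabs_ge0 z) a1 z1).
Qed.

Lemma holo_moebius_den a : holo_disk (moebius_den a).
Proof. exact: (holoB (@holo_cst R 1) (holoM (@holo_cst R _) (@holo_id R))). Qed.

(** The real part of [moebius_den a] is positive on the disk, so exp(s log) is a single-valued
    branch of its power s. *)
Lemma holo_power a (s : R) : cabs a < 1 -> exists2 h, holo_disk h &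
  forall z, cabs z < 1 -> cabs (h z) = cabs (moebius_den a z) `^ s.
Proof.
move=> a1; exists (fun z => cexp (rc s * clog (moebius_den a z))).
  move=> z; rewrite in_diskE => z1.
  apply: derivable_compCC; last by case: (is_derive_cexp (rc s * clog (moebius_den a z))).
  apply: derivableM; first exact: derivable_cst.
  apply: derivable_compCC; first exact: (holo_derivable (@holo_moebius_den a) z1).
  exact: (derivable_clog (Re_moebius_den_gt0 a1 z1)).
move=> z z1; have d0 := moebius_den_neq0 a1 z1.
rewrite cabs_cexp /powR cabs_eq0 (negbTE d0); congr expR.
by rewrite [X in complex.Re X]/GRing.mul /= mul0r subr0.
Qed.

End ComplexPower.

(** * Weighted radial integrals: the inequality at a = 0 *)

Section WeightedMeans.
Local Open Scope ereal_scope.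
Variable R : realType.
Local Notation mu := (@lebesgue_measure R).
Local Notation MR := (measurableTypeR R).
Local Notation I01 := (`]0%R, 1%R[%classic : set R).
Variables (G : CC R -> CC R) (p : R).
Hypotheses (hG : holo_disk G) (p0 : (0 < p)%R).

Lemma circle_mean_ge0 r : (0 <= circle_mean G p r)%R.
Proof. by apply: Rintegral_ge0 => t _; rewrite addr_ge0 ?powR_ge0. Qed.

Lemma integral_circle r : (0 <= r)%R -> (r < 1)%R ->
  \int[mu]_(t in `](- (pi / 2))%R, (pi / 2)%R[)
    (cabs (G (circ r t)) `^ p + cabs (G (- circ r t)%R) `^ p)%:E = (circle_mean G p r)%:E.
Proof.
move=> r0 r1; have c := circle_continuous hG p0 r0 r1.
have m := continuous_measurable_fun c.
rewrite integral_itv_bndo_bndc; last exact/measurable_EFinP/measurable_funTS.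
rewrite integral_itv_obnd_cbnd; last exact/measurable_EFinP/measurable_funTS.
rewrite -[RHS]/(fine _)%:E fineK//; apply: integrable_fin_num; first exact: measurable_itv.
exact: (@cont_on_integrable _ _ (- (pi / 2))%R (pi / 2)%R (fun t _ => c t)).
Qed.

(** Monotonicity makes the superlevel sets in ]0, 1[ intervals. *)
Lemma measurable_circle_mean : measurable_fun I01 (circle_mean G p).
Proof.
have mI : measurable (I01 : set MR) by exact: measurable_itv.
suff : measurable_fun (I01 : set MR) (circle_mean G p : MR -> MR) by [].
move=> _; apply: (measurability _ (RGenOInfty.measurableE R)) => //.
move=> _ [_ [c ->] <-]; apply: is_interval_measurable.
move=> x y [x01 xc] [y01 yc] t /andP[xt ty]; split.
  by move: x01 y01; rewrite /= !in_itv /= => /andP[h1 h2] /andP[h3 h4]; apply/andP; split; lra.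
have {}xc : (c < circle_mean G p x)%R.
  by have /andP[] : (c < circle_mean G p x)%R && true := xc.
suff h : (c < circle_mean G p t)%R by have : (c < circle_mean G p t)%R && true by rewrite h.
have {x01}/andP[h1 h2] : (0 < x < 1)%R := x01; have {y01}/andP[h3 h4] : (0 < y < 1)%R := y01.
by apply: (lt_le_trans xc); apply: (circle_mean_le hG p0 (ltW h1) xt (le_lt_trans ty h4)).
Qed.

Lemma area_radial (v : R -> R) : (forall r, (0 <= v r)%R) ->
  area_measurable (on_disk (fun z => (v (cabs z) * cabs (G z) `^ p)%:E)) ->
  area (on_disk (fun z => (v (cabs z) * cabs (G z) `^ p)%:E)) =
  \int[mu]_(r in I01) (circle_mean G p r * (v r * r))%:E.
Proof.
move=> v0 mU; rewrite polar_integral//; last first.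
  by move=> z; rewrite /on_disk; case: ifPn => // _; rewrite lee_fin mulr_ge0 ?powR_ge0.
rewrite [LHS]integral_mkcond [RHS]integral_mkcond; apply: eq_integral => r _; rewrite !patchE.
have [r0|r0] := ltP 0%R r; last first.
  rewrite !ifF//; apply/negbTE; rewrite notin_setE /= in_itv /= => /andP[]; lra.
rewrite mem_set; last by rewrite /= in_itv /= r0.
have cr t : cabs (circ r t) = r by rewrite cabs_circ// ltW.
have cNr t : cabs (- circ r t)%R = r by rewrite cabsN.
have [r1|r1] := ltP r 1%R; last first.
  rewrite ifF; last by apply/negbTE; rewrite notin_setE /= in_itv /= => /andP[]; lra.
  rewrite integral0_eq ?mul0e// => t _.
  by rewrite /on_disk cr cNr ltNge r1 adde0.
rewrite mem_set; last by rewrite /= in_itv /= r0.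
transitivity ((\int[mu]_(t in `](- (pi / 2))%R, (pi / 2)%R[)
    ((v r)%:E * (cabs (G (circ r t)) `^ p + cabs (G (- circ r t)%R) `^ p)%:E)) * r%:E).
  by congr (_ * _); apply: eq_integral => t _; rewrite /on_disk cr cNr r1 -EFinD -mulrDr.
rewrite ge0_integralZl; last 4 first.
- exact: measurable_itv.
- apply/measurable_EFinP/measurable_funTS.
  exact: (continuous_measurable_fun (circle_continuous hG p0 (ltW r0) r1)).
- by move=> t _; rewrite lee_fin addr_ge0 ?powR_ge0.
- by rewrite lee_fin.
by rewrite (integral_circle (ltW r0) r1) -!EFinM; congr EFin; ring.
Qed.

Variables (alpha b : R).
Hypotheses (alpha1 : (-1 < alpha)%R) (b0 : (0 <= b)%R).

(** The quotient of the radial moments of exponents 2 b and 0. For b = N p / 2 its inverse is the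
    constant of the theorem before the p-th root. *)
Let c := (Gamma (b + 1) * Gamma (2 + alpha) / Gamma (b + 2 + alpha))%R.

Let continuous_pow z : (cabs z < 1)%R -> {for z, continuous (fun z : CC R => cabs (G z) `^ p)%R}.
Proof.
move=> z1; have c3 : {for G z, continuous (fun u : CC R => cabs u `^ p)%R} := @cabs_powR_continuous R p p0 _.
exact: (@continuous_comp _ _ _ G (fun u : CC R => cabs u `^ p)%R z (holo_continuous hG z1) c3).
Qed.

Lemma measurable_radial (v : R -> R) : measurable_fun [set: R] v ->
  area_measurable (on_disk (fun z => (v (cabs z) * cabs (G z) `^ p)%:E)).
Proof.
move=> mv; have m1 := continuous_on_disk_measurable continuous_pow.
have m2 : measurable_fun [set: R * R] (fun xy : R * R => cabs (cpt xy)).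
  rewrite (_ : (fun xy => _) = (fun xy : R * R => Num.sqrt (xy.1 ^+ 2 + xy.2 ^+ 2)%R)); last first.
    by apply/funext => -[x y].
  apply: (measurableT_comp (continuous_measurable_fun (@sqrt_continuous R))).
  by apply: measurable_funD; exact: measurable_funX.
have m3 : area_measurable (fun z => (v (cabs z))%:E).
  by apply/measurable_EFinP; exact: (measurableT_comp mv m2).
have := emeasurable_funM m3 m1; rewrite /area_measurable; congr (measurable_fun _ _).
by apply/funext => xy; rewrite /on_disk /=; case: ifPn => _; rewrite ?mule0// EFinM.
Qed.

Let w (r : R) := ((1 - r ^+ 2) `^ alpha)%R.

Let mw : measurable_fun [set: R] w.
Proof.
apply: (measurableT_comp (measurable_powR _)).
by apply: measurable_funB => //; exact: measurable_funX.
Qed.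

Let w0 r : (0 <= w r)%R. Proof. exact: powR_ge0. Qed.

Lemma radial_weight_le :
  c%:E * area (on_disk (fun z => (w (cabs z) * cabs (G z) `^ p)%:E)) <=
  area (on_disk (fun z => (cabs z `^ (2 * b) * w (cabs z) * cabs (G z) `^ p)%:E)).
Proof.
have mv := measurable_funM (measurable_powR (2 * b)%R) mw.
have v0 r : (0 <= r `^ (2 * b) * w r)%R by rewrite mulr_ge0 ?powR_ge0.
rewrite (area_radial w0 (measurable_radial mw)).
rewrite (area_radial v0 (measurable_radial mv)).
have [I I0 [E1 E2]] := radial_moments alpha1 b0.
have mr : measurable_fun I01 (radial_density alpha).
  by apply: measurable_funTS; exact: measurable_funM.
have mI : measurable (I01 : set MR) by exact: measurable_itv.
have := @chebyshev_integral _ MR R mu I01 mI (circle_mean G p) (fun r => r `^ (2 * b))%R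
  (radial_density alpha) measurable_circle_mean (measurable_funTS (measurable_powR _)) mr.
rewrite E1 E2 -/c => H.
have If : (0 < I%:E :> \bar R) by rewrite lte_fin.
(* The moment I is finite and positive, so it cancels even if the other integrals are infinite. *)
rewrite -(@lee_pmul2r _ I%:E)//.
move: H; rewrite EFinM muleA [_ * c%:E]muleC => H.
apply: le_trans (H _ _ _ _) _.
- by move=> r _; exact: circle_mean_ge0.
- by move=> r _; exact: powR_ge0.
- by move=> r; rewrite /= in_itv /= => /andP[r0 _]; rewrite mulr_ge0 ?powR_ge0// ltW.
- move=> r s; rewrite /= !in_itv /= => /andP[r0 r1] /andP[s0 s1].
  have mono (x y : R) : (0 < x)%R -> (y < 1)%R -> (x <= y)%R -> (0 <= circle_mean G p y - circle_mean G p x)%R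
      /\ (0 <= y `^ (2 * b) - x `^ (2 * b))%R.
    move=> x0 y1 xy; rewrite !subr_ge0; split; first exact: (circle_mean_le hG p0 (ltW x0) xy y1).
    by apply: ge0_ler_powR; rewrite ?nnegrE ?mulr_ge0//; lra.
  have [rs|/ltW sr] := leP r s.
    by have [h1 h2] := mono r s r0 s1 rs; rewrite -mulrNN !opprB mulr_ge0.
  by have [h1 h2] := mono s r s0 r1 sr; rewrite mulr_ge0.
rewrite lee_pmul2r// le_eqVlt; apply/orP; left; apply/eqP; apply: eq_integral => r _.
by congr EFin; rewrite /radial_density /w; ring.
Qed.

(** The circular means are constant, so both integrals are the same multiple of the two moments; the
    finiteness puts the extremal function in the space. *)
Lemma radial_weight_eq (k : R) : (forall z, (cabs z < 1)%R -> cabs (G z) = k) ->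
  [/\ c%:E * area (on_disk (fun z => (w (cabs z) * cabs (G z) `^ p)%:E)) =
  area (on_disk (fun z => (cabs z `^ (2 * b) * w (cabs z) * cabs (G z) `^ p)%:E)) &
  area (on_disk (fun z => (w (cabs z) * cabs (G z) `^ p)%:E)) < +oo].
Proof.
move=> Gk; have mv := measurable_funM (measurable_powR (2 * b)%R) mw.
have v0 r : (0 <= r `^ (2 * b) * w r)%R by rewrite mulr_ge0 ?powR_ge0.
rewrite (area_radial w0 (measurable_radial mw)).
rewrite (area_radial v0 (measurable_radial mv)).
have [I I0 [E1 E2]] := radial_moments alpha1 b0.
pose K := circle_mean G p 0.
have KE r : (0 < r < 1)%R -> circle_mean G p r = K.
  move=> /andP[r0 r1]; apply: eq_Rintegral => t _.
  have h s : (0 <= s)%R -> (s < 1)%R -> cabs (G (circ s t)) = k /\ cabs (G (- circ s t)%R) = k.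
    by move=> s0 s1; rewrite !Gk ?cabsN ?cabs_circ.
  have [-> ->] := h r (ltW r0) r1; have [-> ->//] := h 0%R (lexx _) ltr01.
have K0 : (0 <= K)%R by exact: circle_mean_ge0.
have mr : measurable_fun I01 (radial_density alpha).
  by apply: measurable_funTS; exact: measurable_funM.
have mI : measurable (I01 : set MR) by exact: measurable_itv.
have wr0 (r : R) : I01 r -> (0 <= radial_density alpha r)%R.
  by rewrite /= in_itv /= => /andP[r0 _]; rewrite mulr_ge0 ?powR_ge0// ltW.
have -> : \int[mu]_(r in I01) (circle_mean G p r * (w r * r))%:E = (K * I)%:E.
  transitivity (\int[mu]_(r in I01) (K%:E * (radial_density alpha r)%:E)).
    apply: eq_integral => r /set_mem; rewrite /= in_itv /= => r01.
    by rewrite (KE _ r01) -EFinM.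
  rewrite ge0_integralZl; [by rewrite E1 -EFinM|exact: mI|exact/measurable_EFinP| |].
  - by move=> r Ir; rewrite lee_fin (wr0 _ Ir).
  - by rewrite lee_fin.
have -> : \int[mu]_(r in I01) (circle_mean G p r * (r `^ (2 * b) * w r * r))%:E = (K * (c * I))%:E.
  transitivity (\int[mu]_(r in I01) (K%:E * (r `^ (2 * b) * radial_density alpha r)%:E)).
    apply: eq_integral => r /set_mem; rewrite /= in_itv /= => r01.
    by rewrite (KE _ r01) -EFinM -mulrA.
  rewrite ge0_integralZl; [by rewrite E2 -EFinM|exact: mI| | |].
  - by apply/measurable_EFinP; apply: measurable_funM => //; exact: (measurable_funTS (measurable_powR _)).
  - by move=> r Ir; rewrite lee_fin mulr_ge0 ?powR_ge0 ?(wr0 _ Ir).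
  - by rewrite lee_fin.
by split; [rewrite -EFinM mulrCA|rewrite ltry].
Qed.

End WeightedMeans.

(** * Transfer from the origin to the point a *)

Section MoebiusTransfer.
Variable R : realType.
Implicit Types (z a : CC R).

Lemma holo_phi a : cabs a < 1 -> holo_disk (phi a).
Proof.
move=> a1; have hd : holo_disk (fun z => (moebius_den a z)^-1).
  by apply: holoV; [move=> z; exact: moebius_den_neq0|exact: holo_moebius_den].
exact: (holoM (holoB (@holo_cst R a) (@holo_id R)) hd).
Qed.

Lemma phi_lt1 a z : cabs a < 1 -> cabs z < 1 -> cabs (phi a z) < 1.
Proof. by move=> a1 z1; rewrite cabs_phi_lt1// moebius_den_neq0. Qed.

Lemma moebius_power a (s : R) : cabs a < 1 -> exists2 h, holo_disk h &
  forall z, cabs z < 1 -> cabs (h z) = moebius_jac a z `^ s.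
Proof.
move=> a1; have [h hh hE] := holo_power (- (2 * s)) a1.
have a0 : 0 < 1 - cabs a ^+ 2 by rewrite -one_sub_sqr_gt0.
exists (fun z => (((1 - cabs a ^+ 2) `^ s)%:C)%C * h z).
  exact: (holoM (@holo_cst R _) hh).
move=> z z1; rewrite cabsM cabs_real (ger0_norm (powR_ge0 _ _)) hE// /moebius_jac.
have d0 : 0 < cabs (moebius_den a z) by rewrite cabs_gt0 moebius_den_neq0.
rewrite powRM ?(ltW a0) ?invr_ge0 ?exprn_ge0 ?(ltW d0)//; congr (_ * _).
by rewrite powRN powRrM powR_mulrn ?(ltW d0)// -[in RHS]powR_inv1 ?exprn_ge0 ?(ltW d0)// -[in RHS]powRrM mulN1r powRN.
Qed.

Variables (a : CC R) (p alpha : R).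
Hypotheses (a1 : cabs a < 1) (p0 : 0 < p) (alpha1 : -1 < alpha).
Let w (r : R) := (1 - r ^+ 2) `^ alpha.

(* Since |h|^p = |phi a'|^(alpha + 2), the map g |-> (g o phi a) h is an isometry of A^p_alpha. *)
Lemma area_moebius (u : R -> R) (g h : CC R -> CC R) :
  measurable_fun [set: R] u -> (forall r, 0 <= u r) -> holo_disk g -> holo_disk h ->
  (forall z, cabs z < 1 -> cabs (h z) = moebius_jac a z `^ ((alpha + 2) / p)) ->
  area_measurable (on_disk (fun z => (u (cabs (phi a z)) * w (cabs z) * cabs (g z) `^ p)%:E)) /\
  area (on_disk (fun z => (u (cabs (phi a z)) * w (cabs z) * cabs (g z) `^ p)%:E)) =
  area (on_disk (fun z => (u (cabs z) * w (cabs z) * cabs (g (phi a z) * h z) `^ p)%:E)).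
Proof.
move=> mu u0 hg hh hE.
have hG : holo_disk (fun z => g (phi a z) * h z).
  exact: (holoM (@holo_comp R (phi a) g (fun z => @phi_lt1 a z a1) (holo_phi a1) hg) hh).
have mw : measurable_fun [set: R] w.
  apply: (measurableT_comp (measurable_powR _)).
  by apply: measurable_funB => //; exact: measurable_funX.
have mU := measurable_radial hG p0 (measurable_funM mu mw).
have U0 z : (0 <= (u (cabs z) * w (cabs z) * cabs (g (phi a z) * h z) `^ p)%:E)%E.
  by rewrite lee_fin !mulr_ge0 ?powR_ge0.
have [m E] := on_disk_moebius a1 mU U0.
suff EU : on_disk (fun z => ((u (cabs (phi a z)) * w (cabs (phi a z)) *
    cabs (g (phi a (phi a z)) * h (phi a z)) `^ p)%:E * (moebius_jac a z ^+ 2)%:E)%E) =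
  on_disk (fun z => (u (cabs (phi a z)) * w (cabs z) * cabs (g z) `^ p)%:E).
  by rewrite -EU; split; [exact: m|rewrite E].
apply/funext => z; rewrite /on_disk; case: ifPn => // z1.
have d0 := moebius_den_neq0 a1 z1; have q1 := phi_lt1 a1 z1.
have j0 := moebius_jac_gt0 a1 d0; have j1 := moebius_jac_gt0 a1 (moebius_den_neq0 a1 q1).
have z0 : 0 < 1 - cabs z ^+ 2 by rewrite -one_sub_sqr_gt0.
rewrite phi_involutive// cabsM hE// -EFinM; congr EFin.
rewrite powRM ?cabs_ge0 ?powR_ge0// -powRrM divfK ?lt0r_neq0//.
rewrite /w one_sub_cabs_phi// powRM ?ltW//.
have -> : moebius_jac a (phi a z) = (moebius_jac a z)^-1.
  by apply: (mulIf (lt0r_neq0 j0)); rewrite moebius_jac_phi// mulVf// lt0r_neq0.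
have -> : moebius_jac a z ^+ 2 = moebius_jac a z `^ 2 by rewrite powR_mulrn// ltW.
(* The weight contributes the exponent alpha and the area element 2; |h|^p is taken at phi a z,
   where the Jacobian is inverted, and cancels both. *)
have J : moebius_jac a z `^ alpha * moebius_jac a z `^ 2 * (moebius_jac a z)^-1 `^ (alpha + 2) = 1.
  rewrite -powRD; last by rewrite (gt_eqF j0) implybT.
  by rewrite -powRM ?ltW// ?divff ?powR1 ?lt0r_neq0// invr_gt0.
rewrite -[RHS]mulr1 -[X in _ = _ * X]J; ring.
Qed.

End MoebiusTransfer.

(** * The inequality, its extremal function and the constant *)

Section DivisionByBlaschkeFactor.
Variable R : realType.
Implicit Types (z a : CC R) (f g : CC R -> CC R).

Lemma Gamma1 : Gamma (1 : R) = 1.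
Proof. by rewrite GammaE eGamma1. Qed.

Lemma GammaS (x : R) : 1 <= x -> Gamma (x + 1) = x * Gamma x.
Proof.
move=> x1; have x0 : 0 < x by lra.
have x2 : 1 <= x + 1 by lra.
have := eGamma_mul x 1; rewrite eGamma1 mule1 (eBeta1 x0) (eGamma_fin x1) (eGamma_fin x2).
by rewrite -EFinM => -[->]; field; exact: lt0r_neq0.
Qed.

Lemma cabsX_powR z n (p : R) : 0 < p -> cabs (z ^+ n) `^ p = cabs z `^ (2 * (n%:R * p / 2)).
Proof.
move=> p0; have -> : 2 * (n%:R * p / 2) = n%:R * p by field.
by rewrite cabsX -powR_mulrn ?cabs_ge0// powRrM.
Qed.

Lemma sub_phi a z : cabs a < 1 -> cabs z < 1 -> z - a = phi a z * - moebius_den a z.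
Proof.
move=> a1 z1; have d0 := moebius_den_neq0 a1 z1.
by rewrite phiE; move: d0; move: (moebius_den a z) => d d0; field.
Qed.

Lemma phi_neq0 a z : cabs a < 1 -> cabs z < 1 -> z != a -> phi a z != 0.
Proof.
move=> a1 z1 za; rewrite phiE mulf_neq0 ?invr_eq0 ?moebius_den_neq0//.
by rewrite subr_eq0 eq_sym.
Qed.

Let eq_area (U V : CC R -> \bar R) : (forall z, cabs z < 1 -> U z = V z) ->
  area (on_disk U) = area (on_disk V).
Proof.
move=> UV; suff -> : on_disk U = on_disk V by [].
by apply/funext => z; rewrite /on_disk; case: ifPn => [/UV|].
Qed.

Variables (p alpha : R) (a : CC R) (N : nat).
Hypotheses (p0 : 0 < p) (alpha1 : -1 < alpha) (a1 : cabs a < 1).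

(** The Bergman integral without the factor (alpha + 1) / pi, which is common to both sides. *)
Let mass f := area (on_disk (fun z => ((1 - cabs z ^+ 2) `^ alpha * cabs (f z) `^ p)%:E)).
Let b := N%:R * p / 2.
Let b0 : 0 <= b. Proof. by rewrite divr_ge0// mulr_ge0// ltW. Qed.
Let c := Gamma (b + 1) * Gamma (2 + alpha) / Gamma (b + 2 + alpha).

Let c0 : 0 < c.
Proof.
rewrite /c; move: (b) b0 alpha1 => x x0 h.
by apply: divr_gt0; [apply: mulr_gt0|]; apply: Gamma_gt0; lra.
Qed.

Let measurable_mass f : holo_disk f ->
  area_measurable (on_disk (fun z => ((1 - cabs z ^+ 2) `^ alpha * cabs (f z) `^ p)%:E)).
Proof.
move=> hf; apply: (@measurable_radial R f p hf p0 (fun r => (1 - r ^+ 2) `^ alpha)).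
apply: (measurableT_comp (measurable_powR _)).
by apply: measurable_funB => //; exact: measurable_funX.
Qed.

Let mass_ge0 f : (0 <= mass f)%E.
Proof.
apply: integral_ge0 => xy _; rewrite /on_disk; case: ifPn => // _.
by rewrite lee_fin mulr_ge0 ?powR_ge0.
Qed.

Let k0 : 0 < (alpha + 1) / pi.
Proof. by apply: divr_gt0; [have := alpha1; lra|exact: pi_gt0]. Qed.

Let bergman_intE f : holo_disk f -> bergman_int p alpha f = (((alpha + 1) / pi)%:E * mass f)%E.
Proof.
move=> hf; rewrite /mass /area /plane_integral -ge0_integralZl; last 4 first.
- exact: measurableT.
- exact: measurable_mass.
- move=> xy _; rewrite /on_disk; case: ifPn => // _.
  by rewrite lee_fin mulr_ge0 ?powR_ge0.
- by rewrite lee_fin ltW.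
rewrite /bergman_int [LHS]integral_mkcond; apply: eq_integral => xy _.
rewrite patchE /on_disk (_ : (xy \in _) = (cabs (cpt xy) < 1)); last first.
  by apply/idP/idP => [/set_mem//|h]; exact/mem_set.
case: ifP => _; last by rewrite mule0.
by rewrite -EFinM; congr EFin; ring.
Qed.

Let mass_phi f g : (forall z, cabs z < 1 -> f z = phi a z ^+ N * g z) ->
  mass f = area (on_disk (fun z =>
    (cabs (phi a z) `^ (2 * b) * (1 - cabs z ^+ 2) `^ alpha * cabs (g z) `^ p)%:E)).
Proof.
move=> fg; apply: eq_area => z z1; congr EFin.
by rewrite (fg _ z1) cabsM (powRM _ (cabs_ge0 _) (cabs_ge0 _)) (cabsX_powR _ _ p0) mulrCA mulrA.
Qed.

(** The radial inequality for G = (g o phi a) h, pulled back by [area_moebius] with u = 1 for g and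
    u = r^(2b) for f. Neither mass is assumed finite: membership of g in the space is deduced from
    this bound. *)
Let mass_le f g : holo_disk g -> (forall z, cabs z < 1 -> f z = phi a z ^+ N * g z) ->
  (c%:E * mass g <= mass f)%E.
Proof.
move=> hg fg; have [h hh hE] := moebius_power ((alpha + 2) / p) a1.
have hG : holo_disk (fun z => g (phi a z) * h z).
  exact: (holoM (@holo_comp R (phi a) g (fun z => @phi_lt1 R a z a1) (holo_phi a1) hg) hh).
have [_ E1] := @area_moebius R a p alpha a1 p0 (fun=> 1) g h (measurable_cst _) (fun=> ler01) hg hh hE.
have [_ E2] := @area_moebius R a p alpha a1 p0 (fun r => r `^ (2 * b)) g h
  (measurable_powR _) (fun r => powR_ge0 _ _) hg hh hE.
have Eg : mass g = area (on_disk (fun z =>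
    (1 * (1 - cabs z ^+ 2) `^ alpha * cabs (g z) `^ p)%:E)).
  by apply: eq_area => z _; rewrite mul1r.
rewrite (mass_phi fg) E2 Eg E1.
have -> : area (on_disk (fun z => (1 * (1 - cabs z ^+ 2) `^ alpha * cabs (g (phi a z) * h z) `^ p)%:E)) =
    area (on_disk (fun z => ((1 - cabs z ^+ 2) `^ alpha * cabs (g (phi a z) * h z) `^ p)%:E)).
  by apply: eq_area => z _; rewrite mul1r.
exact: (@radial_weight_le R _ p hG p0 alpha b alpha1 b0).
Qed.

Lemma bergman_division_le f g : in_Apa p alpha f -> holo_disk g ->
  (forall z, cabs z < 1 -> f z = phi a z ^+ N * g z) ->
  in_Apa p alpha g /\ bergman_norm p alpha g <= c^-1 `^ p^-1 * bergman_norm p alpha f.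
Proof.
move=> [hf ff] hg fg; have L := mass_le hg fg.
have ci0 : 0 < c^-1 by rewrite invr_gt0.
have L2 : (bergman_int p alpha g <= c^-1%:E * bergman_int p alpha f)%E.
  rewrite !bergman_intE// muleCA lee_pmul2l ?lte_fin//.
  have -> : mass g = (c^-1%:E * (c%:E * mass g))%E by rewrite muleA -EFinM mulVf ?mul1e// lt0r_neq0.
  by rewrite lee_pmul2l ?lte_fin.
have bi0 u : holo_disk u -> (0 <= bergman_int p alpha u)%E.
  by move=> hu; rewrite (bergman_intE hu); apply: mule_ge0; [rewrite lee_fin (ltW k0)|exact: mass_ge0].
have ffin : bergman_int p alpha f \is a fin_num by rewrite ge0_fin_numE// bi0.
have gf : (bergman_int p alpha g < +oo)%E.
  by apply: (le_lt_trans L2); rewrite -(fineK ffin) -EFinM ltry.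
have gfin : bergman_int p alpha g \is a fin_num by rewrite ge0_fin_numE// bi0.
split; first by split.
rewrite /bergman_norm -powRM ?fine_ge0 ?bi0 ?(ltW ci0)//.
apply: ge0_ler_powR; rewrite ?nnegrE ?mulr_ge0 ?invr_ge0 ?fine_ge0 ?bi0 ?(ltW ci0) ?(ltW p0) ?(ltW c0)//.
by move: L2; rewrite -{1}(fineK gfin) -{1}(fineK ffin) -EFinM lee_fin.
Qed.

(** Since z - a is phi a z times the zero-free factor - [moebius_den a z], dividing by (z - a)^N and
    multiplying by the N-th power of that factor gives the analytic extension. *)
Lemma divisible_phi f : holo_disk f -> (forall k, (k < N)%N -> cderiv k f a = 0) ->
  exists2 g, holo_disk g & forall z, cabs z < 1 -> f z = phi a z ^+ N * g z.
Proof.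
move=> hf zf; have [q hq fq] := divide_zeros hf a1 zf.
pose d z : CC R := -1 * moebius_den a z.
have hd : holo_disk d := holoM (@holo_cst R (-1)) (@holo_moebius_den R a).
exists (fun z => d z ^+ N * q z); first exact: (holoM (@holoX R d N hd) hq).
by move=> z z1; rewrite fq (sub_phi a1 z1) exprMn mulrA /d mulN1r.
Qed.

Lemma is_div_ext_phi f g : holo_disk g ->
  (forall z, cabs z < 1 -> f z = phi a z ^+ N * g z) -> is_div_ext a N f g.
Proof.
move=> hg fg; split; first exact: hg.
move=> z; rewrite in_diskE => z1 za; rewrite fg// mulrAC divff ?mul1r//.
by rewrite expf_neq0// phi_neq0.
Qed.

(* For g = h as in [moebius_power], (g o phi a) h has constant modulus 1, hence constant
   circular means. *)
Lemma bergman_division_extremal : exists f, exists2 g, in_Apa p alpha f /\ holo_disk g &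
  [/\ (forall z, cabs z < 1 -> f z = phi a z ^+ N * g z),
      (forall z, cabs z < 1 -> g z != 0),
      (forall k, (k < N)%N -> cderiv k f a = 0) &
      bergman_norm p alpha g = c^-1 `^ p^-1 * bergman_norm p alpha f].
Proof.
have [h hh hE] := moebius_power ((alpha + 2) / p) a1.
pose d z : CC R := -1 * moebius_den a z.
have hd : holo_disk d := holoM (@holo_cst R (-1)) (@holo_moebius_den R a).
have dn0 z : cabs z < 1 -> d z != 0.
  by move=> z1; rewrite /d mulN1r oppr_eq0 moebius_den_neq0.
(* Chosen so that (z - a)^N q equals phi_a^N h on the disk; in the first form the zeros at a follow
   from [cderiv_zeros]. *)
pose q z := (d z)^-1 ^+ N * h z.
have hq : holo_disk q := holoM (@holoX R (fun z => (d z)^-1) N (holoV dn0 hd)) hh.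
pose f z := (z - a) ^+ N * q z.
have hf : holo_disk f := holoM (@holoX R (fun z => z - a) N (holoB (@holo_id R) (@holo_cst R a))) hq.
have fE z : cabs z < 1 -> f z = phi a z ^+ N * h z.
  move=> z1; rewrite /f /q mulrA -exprMn (sub_phi a1 z1) /d mulN1r.
  by rewrite mulfK// oppr_eq0 moebius_den_neq0.
have jac0 z : cabs z < 1 -> 0 < moebius_jac a z.
  by move=> z1; exact: (moebius_jac_gt0 a1 (moebius_den_neq0 a1 z1)).
have hn0 z : cabs z < 1 -> h z != 0.
  by move=> z1; rewrite -cabs_gt0 (hE _ z1) powR_gt0// jac0.
have hG : holo_disk (fun z => h (phi a z) * h z).
  exact: (holoM (@holo_comp R (phi a) h (fun z => @phi_lt1 R a z a1) (holo_phi a1) hh) hh).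
have G1 z : cabs z < 1 -> cabs (h (phi a z) * h z) = 1.
  move=> z1; have q1 := phi_lt1 a1 z1.
  rewrite cabsM (hE _ z1) (hE _ q1) -powRM ?(ltW (jac0 _ _))//.
  by rewrite moebius_jac_phi// powR1.
have [M Mf] := @radial_weight_eq R _ p hG p0 alpha b alpha1 b0 1 G1.
have [_ E1] := @area_moebius R a p alpha a1 p0 (fun=> 1) h h (measurable_cst _) (fun=> ler01) hh hh hE.
have [_ E2] := @area_moebius R a p alpha a1 p0 (fun r => r `^ (2 * b)) h h
  (measurable_powR _) (fun r => powR_ge0 _ _) hh hh hE.
have Ef := mass_phi fE; rewrite E2 -M in Ef.
have Eh : mass h = area (on_disk (fun z =>
    ((1 - cabs z ^+ 2) `^ alpha * cabs (h (phi a z) * h z) `^ p)%:E)).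
  transitivity (area (on_disk (fun z => (1 * (1 - cabs z ^+ 2) `^ alpha * cabs (h z) `^ p)%:E))).
    by apply: eq_area => z _; rewrite mul1r.
  by rewrite E1; apply: eq_area => z _; rewrite mul1r.
rewrite -Eh in Ef Mf.
have mhfin : mass h \is a fin_num by rewrite ge0_fin_numE.
have BE : bergman_int p alpha f = (c%:E * bergman_int p alpha h)%E.
  by rewrite (bergman_intE hf) (bergman_intE hh) Ef muleCA.
have hfin : bergman_int p alpha h \is a fin_num.
  by rewrite (bergman_intE hh) -(fineK mhfin) -EFinM.
have h0 : 0 <= fine (bergman_int p alpha h).
  apply: fine_ge0; rewrite (bergman_intE hh); apply: mule_ge0; last exact: mass_ge0.
  by rewrite lee_fin (ltW k0).
exists f, h; first split; [split; [exact: hf|]|exact: hh|split].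
- by rewrite BE -(fineK hfin) -EFinM ltry.
- exact: fE.
- exact: hn0.
- by move=> k kN; exact: cderiv_zeros.
rewrite /bergman_norm BE (fineM (isT : c%:E \is a fin_num) hfin) [fine c%:E]/=.
move: (fine _) h0 => B B0; have ci0 : 0 <= c^-1 by rewrite invr_ge0 (ltW c0).
by rewrite -(powRM _ ci0 (mulr_ge0 (ltW c0) B0)) (mulKf (lt0r_neq0 c0)).
Qed.

End DivisionByBlaschkeFactor.

Section SharpConstant.
Variable R : realType.

Lemma Gamma_ratio1 (p : R) : 0 < p ->
  Gamma (1%:R * p / 2 + 2 + 0) / (Gamma (2 + 0) * Gamma (1%:R * p / 2 + 1)) = (p + 2) / 2.
Proof.
move=> p0; have y1 : 1 <= p / 2 + 1 by lra.
have G2 : Gamma (2 : R) = 1.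
  have := @GammaS R 1 (lexx 1); rewrite Gamma1 mulr1.
  by have -> : 1 + 1 = 2 :> R by [].
rewrite (_ : 1%:R * p / 2 + 2 + 0 = p / 2 + 1 + 1); last by ring.
rewrite (_ : 1%:R * p / 2 + 1 = p / 2 + 1); last by ring.
have g0 := lt0r_neq0 (Gamma_gt0 y1).
rewrite (GammaS y1) addr0 G2; move: (Gamma _) g0 => g g0.
by field.
Qed.

Let inv_ratio (x y z : R) : (x * y / z)^-1 = z / (y * x).
Proof. by rewrite invf_div (mulrC x). Qed.

Variables (p alpha : R) (a : CC R) (N : nat).
Hypotheses (p0 : 0 < p) (alpha1 : -1 < alpha) (a1 : cabs a < 1).

Let K := (Gamma (N%:R * p / 2 + 2 + alpha)
            / (Gamma (2 + alpha) * Gamma (N%:R * p / 2 + 1))) `^ (p^-1).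

Let KE : K = ((Gamma (N%:R * p / 2 + 1) * Gamma (2 + alpha) / Gamma (N%:R * p / 2 + 2 + alpha))^-1) `^ p^-1.
Proof. by rewrite inv_ratio. Qed.

Lemma bergman_division (f : CC R -> CC R) : in_Apa p alpha f ->
  (forall k : nat, (k < N)%N -> cderiv k f a = 0) ->
  exists g : CC R -> CC R, is_div_ext a N f g /\ in_Apa p alpha g /\
    bergman_norm p alpha g <= K * bergman_norm p alpha f.
Proof.
move=> hf zf; have [g hg fg] := divisible_phi a1 hf.1 zf.
exists g; split; first exact: (is_div_ext_phi a1 hg fg).
by rewrite KE; exact: (bergman_division_le p0 alpha1 a1 hf hg fg).
Qed.

(** A point where the extremal function is nonzero: in the disk neither phi a off a nor h
    vanishes. *)
Let other_point : exists2 z, cabs z < 1 & z != a.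
Proof.
have [a0|a0] := eqVneq a 0; last by exists 0; [rewrite cabs0|rewrite eq_sym].
exists ((2^-1%:C)%C : CC R).
  by rewrite cabs_real ger0_norm ?invf_lt1 ?invr_ge0// ltr1n.
by rewrite a0 -cabs_gt0 cabs_real normr_gt0 invr_eq0 pnatr_eq0.
Qed.

Lemma bergman_division_sharp : exists f : CC R -> CC R,
  in_Apa p alpha f /\ (exists z, z \in disk /\ f z != 0) /\
  (forall k : nat, (k < N)%N -> cderiv k f a = 0) /\
  exists g : CC R -> CC R, is_div_ext a N f g /\ in_Apa p alpha g /\
    bergman_norm p alpha g = K * bergman_norm p alpha f.
Proof.
have [f [g [hf hg] [fg gn0 zf E]]] := bergman_division_extremal N p0 alpha1 a1.
have [z z1 za] := other_point.
exists f; split; first exact: hf.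
split.
  exists z; split; first by rewrite in_diskE.
  by rewrite (fg _ z1); apply: mulf_neq0; [apply: expf_neq0; exact: phi_neq0|exact: gn0].
split; first exact: zf.
exists g; split; first exact: (is_div_ext_phi a1 hg fg).
split; first exact: (bergman_division_le p0 alpha1 a1 hf hg fg).1.
by rewrite KE.
Qed.

End SharpConstant.

Unset Implicit Arguments.
Local Close Scope classical_set_scope.

Theorem theorem3p3 (R : realType) (p alpha : R) (a : CC R) (N : nat) :
  0 < p -> -1 < alpha -> a \in disk -> (0 < N)%N ->
  let K := (Gamma (N%:R * p / 2 + 2 + alpha)
            / (Gamma (2 + alpha) * Gamma (N%:R * p / 2 + 1))) `^ (p^-1) in
  (* the inequality *)
  (forall f : CC R -> CC R,
     in_Apa p alpha f ->
     (forall k : nat, (k < N)%N -> cderiv k f a = 0) ->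
     exists g : CC R -> CC R,
       is_div_ext a N f g /\ in_Apa p alpha g /\
       bergman_norm p alpha g <= K * bergman_norm p alpha f) /\
  (* sharpness *)
  (exists f : CC R -> CC R,
     in_Apa p alpha f /\ (exists z, z \in disk /\ f z != 0) /\
     (forall k : nat, (k < N)%N -> cderiv k f a = 0) /\
     exists g : CC R -> CC R,
       is_div_ext a N f g /\ in_Apa p alpha g /\
       bergman_norm p alpha g = K * bergman_norm p alpha f) /\
  (* the particular case A^p = A^p_0, N = 1 *)
  (forall f : CC R -> CC R,
     in_Apa p 0 f -> f a = 0 ->
     exists g : CC R -> CC R,
       is_div_ext a 1 f g /\ in_Apa p 0 g /\
       bergman_norm p 0 g <= ((p + 2) / 2) `^ (p^-1) * bergman_norm p 0 f).
Proof.
move=> p0 alpha1 aD N0 K; have a1 : cabs a < 1 by rewrite -in_diskE.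
split; first by move=> f; exact: bergman_division.
split; first exact: bergman_division_sharp.
move=> f hf fa; have zf k : (k < 1)%N -> cderiv k f a = 0 by rewrite ltnS leqn0 => /eqP ->.
by have := bergman_division p0 (ltrN10 R) a1 hf zf; rewrite (Gamma_ratio1 p0).
Qed.
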